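(* The normal order of $\log\big(\lambda(\varphi(n))/\lambda(\lambda(n))\big)$ is $\log\log n \cdot \log\log\log n$. That is, there is a set of positive integers $n$ of asymptotic density $1$ on which \[ \log \frac{\lambda(\varphi(n))}{\lambda(\lambda(n))} = (1+o(1))\,\log\log n\,\log\log\log n \qquad (n\to\infty). \]
   Context: $\varphi$ is Euler's totient function. $\lambda$ is Carmichael's function: $\lambda(n)$ is the smallest positive integer $m$ with $a^m\equiv 1 \pmod n$ for all integers $a$ coprime to $n$; equivalently $\lambda(p^a)=p^{a-1}(p-1)$ if $p\ge 3$ or $a\le 2$, $\lambda(2^a)=2^{a-2}$ for $a\ge 3$, and $\lambda(n)=\mathrm{lcm}(\lambda(p_1^{a_1}),\dots,\lambda(p_k^{a_k}))$ for $n=p_1^{a_1}\cdots p_k^{a_k}$. *)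

(* Defs.v *)
From HB Require Import structures.
From mathcomp Require Import all_boot all_order all_algebra cyclic.
From mathcomp Require Import all_classical all_reals all_analysis.
Import Order.TTheory GRing.Theory Num.Theory.
Import numFieldNormedType.Exports.

Set Implicit Arguments.
Unset Strict Implicit.
Unset Printing Implicit Defensive.

Local Open Scope classical_set_scope.
Local Open Scope ring_scope.

Definition universal_exponent (n m : nat) : Prop :=
  (0 < m)%N /\
  forall a : int, coprimez a n%:Z -> (a ^+ m = 1 %[mod n%:Z])%Z.

Lemma universal_exponent_exists (n : nat) :
  exists m, `[< universal_exponent n m >].
Proof.
case: n => [|n].
  exists 2%N; apply/asboolP; split=> // a.
  rewrite coprimezE /coprime gcdn0 => /eqP a1.
  by rewrite -real_normK ?num_real // -abszE a1 expr1n.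
exists (totient n.+1); apply/asboolP; split; first by rewrite totient_gt0.
move=> a; rewrite -modzXm /coprimez -gcdz_modl.
have : 0 <= (a %% n.+1%:Z)%Z by exact: modz_ge0.
case: (a %% n.+1%:Z)%Z => // b _ cb.
rewrite -rmorphXn natrXE -[1]/(1%:Z) !modz_nat; congr Posz.
exact: Euler_exp_totient.
Qed.

Definition carmichael (n : nat) : nat := ex_minn (universal_exponent_exists n).

(* The value of the quotient at N = 0 is immaterial. *)
Definition has_density (R : realType) (S : set nat) (d : R) : Prop :=
  (\sum_(1 <= k < N.+1) \1_S k) / N%:R @[N --> \oo] --> d.

(* Junk values: ln vanishes on nonpositive reals, so an equality involving
   iterated logarithms is only meaningful for large n; it is required
   eventually along S. *)
Definition normal_order (R : realType) (f g : nat -> R) : Prop :=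
  exists S : set nat,
    [/\ S `<=` [set n | (0 < n)%N],
        has_density S (1 : R)
      & exists eps : nat -> R,
          eps n @[n --> within S \oo] --> (0 : R) /\
          \forall n \near within S \oo, f n = (1 + eps n) * g n].

(* Main.v *)
Require Import Defs.
From HB Require Import structures.
From mathcomp Require Import all_boot all_order all_algebra.
From mathcomp Require Import cyclic finfield cyclotomic separable complex.
From mathcomp Require Import all_classical all_reals all_analysis.
From mathcomp Require Import ring lra zify.
Import Order.TTheory GRing.Theory Num.Theory.
Import numFieldNormedType.Exports.

Set Implicit Arguments.
Unset Strict Implicit.
Unset Printing Implicit Defensive.

Local Open Scope classical_set_scope.
Local Open Scope ring_scope.

(** Writing [v_q] for the exponent of [q], the logarithm in question is the
    sum over primes [q] of [(v_q (lambda (phi n)) - v_q (lambda (lambda n))) log q].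
    Let [y = log log x], [Y = y / log y] and [Y' = y log y].  Since
    [v_q N - 2 <= v_q (lambda N)], and [v_q (lambda (phi n))] exceeds
    [v_q (lambda (lambda n))] by at most [v_q (phi n) - 1], for almost all
    [n <= x] the sum differs by [o(y log y)] from
    [F n = sum_(q <= Y) log q * #{p | n : p = 1 mod q}]: the primes [q > Y]
    contribute little on average, and for almost all [n] no prime power above
    [y ^ 4] with base at most [Y] divides [lambda (lambda n)].  Turan's
    variance bound concentrates [F] around its mean
    [sum_(q <= Y) log q * sum_(p <= x, p = 1 mod q) 1 / p], which is
    [(1 + o(1)) y log y] because the inner sum is [y / (q - 1) + O(1)]
    uniformly in [q].

    This uniformity combines two facts.  A Selberg sieve bounds the inner sum
    by [O((1 + y) / q)], which disposes of the primes [p] with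
    [log p <= exp (O(q))].  For the larger primes, Dirichlet's theorem modulo
    [q] with error [exp (O(q))] is derived from lower bounds for finite partial
    sums of [chi n / n]: the inequality [3 + 4 cos t + cos (2 t) >= 0]
    when [chi] is complex, and [sum_(n <= X) (1 * chi) n / sqrt n >= log X / 2] when it is
    real. *)

(** * Sums over divisors and primes *)

(** The moduli [q] grow with [x], so estimates for a fixed modulus do not apply and the errors of
    all [q] add up. The cut [Y = y / log y] is where an error [O(1)] per [q] becomes affordable:
    weighted by [log q] it costs [O(Y)]. The loss of 2 in [v_q] also costs [O(Y)], and prime powers
    up to order [y ^ 4] in lambda(lambda n) cost [O(Y log y) = O(y)]. Between [Y] and [Y'] the mean
    is [O(y log (Y' / Y))], of order [y log log y]. Beyond [Y'] a first moment is too large; but the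
    upper bound contains [v_q (phi n) - 1], so a single prime [p = 1 mod q] contributes nothing
    unless [q ^ 2] divides [p - 1] or [n]. Counting pairs of such primes gives [y ^ 2 log Y' / Y'],
    of order [y]; this fixes [Y']. An error exponential in [q] is harmless in Dirichlet's theorem:
    partial summation divides it by the logarithm of the starting point, and a starting point whose
    logarithm exceeds it has log log of order [q], so that the sieve leaves only [O(1)] below it.
    Hence exponentially weak lower bounds for the partial sums of [chi n / n] are enough. *)

Section DivisorSums.
Variable V : nmodType.

Lemma sum_multiples (F : nat -> V) (d x : nat) : (0 < d)%N ->
  \sum_(1 <= n < x.+1 | (d %| n)%N) F n
  = \sum_(1 <= m < (x %/ d).+1) F (d * m)%N.
Proof.
move=> d0; elim: x => [|x IH]; first by rewrite div0n !big_geq.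
rewrite big_mkcond big_nat_recr //= -big_mkcond /= IH divnS //.
case: ifP => [dv|_] /=; last by rewrite addr0 add0n.
rewrite add1n [RHS]big_nat_recr //=; congr (_ + F _).
by rewrite -[LHS](divnK dv) divnS // dv add1n mulnC.
Qed.

(** Decouples ranges: once the divisors of every [n <= N] run up to the same bound, double sums can
    be exchanged. *)
Lemma sum_divisors_widen (F : nat -> V) (n N : nat) : (0 < n <= N)%N ->
  \sum_(1 <= d < N.+1 | (d %| n)%N) F d
  = \sum_(1 <= d < n.+1 | (d %| n)%N) F d.
Proof.
move=> /andP[n0 nN]; rewrite (big_cat_nat _ (n := n.+1)) //=.
rewrite [X in _ + X]big_nat_cond [X in _ + X]big1 ?addr0 // => d.
by move=> /andP[/andP[nd _]] /(dvdn_leq n0); rewrite leqNgt nd.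
Qed.

Lemma sum_hyperbola (F : nat -> nat -> V) (x : nat) :
  \sum_(1 <= n < x.+1) \sum_(1 <= d < x.+1 | (d %| n)%N) F d (n %/ d)%N
  = \sum_(1 <= d < x.+1) \sum_(1 <= m < (x %/ d).+1) F d m.
Proof.
under eq_bigr => n _ do rewrite big_mkcond.
rewrite exchange_big_nat /=; apply: eq_big_nat => d /andP[d0 _].
rewrite -big_mkcond /= sum_multiples //; apply: eq_big_nat => m _.
by rewrite mulKn.
Qed.

Lemma sum_divisors_rev (F : nat -> nat -> V) (n : nat) : (0 < n)%N ->
  \sum_(1 <= d < n.+1 | (d %| n)%N) F d (n %/ d)%N
  = \sum_(1 <= d < n.+1 | (d %| n)%N) F (n %/ d)%N d.
Proof.
move=> n0; have E (G : nat -> V) : \sum_(1 <= d < n.+1 | (d %| n)%N) G d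
   = \sum_(d <- divisors n) G d.
  rewrite -big_filter; apply: perm_big; apply: uniq_perm.
  - by rewrite filter_uniq // iota_uniq.
  - exact: divisors_uniq.
  move=> d; rewrite mem_filter mem_index_iota -dvdn_divisors //.
  case: (boolP (d %| n)%N) => //= dn; rewrite (dvdn_gt0 n0 dn) ltnS.
  by rewrite dvdn_leq.
rewrite !E; have P : perm_eq (divisors n) [seq (n %/ d)%N | d <- divisors n].
  apply: uniq_perm; first exact: divisors_uniq.
    rewrite map_inj_in_uniq ?divisors_uniq // => a b.
    rewrite -!dvdn_divisors // => an bn ab.
    have := divnK an; rewrite ab => h1; have h2 := divnK bn.
    have q0 : (0 < n %/ b)%N by rewrite divn_gt0 ?(dvdn_gt0 n0 bn) // dvdn_leq.
    by apply/eqP; rewrite -(eqn_pmul2l q0) h1 h2.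
  move=> d; rewrite -dvdn_divisors //; apply/idP/mapP => [dn|[e]].
    exists (n %/ d)%N; first by rewrite -dvdn_divisors // dvdn_div.
    by rewrite divnA // mulKn.
  by rewrite -dvdn_divisors // => en ->; rewrite dvdn_div.
rewrite (perm_big _ P) big_map; rewrite big_seq [RHS]big_seq.
apply: eq_bigr => d; rewrite -dvdn_divisors // => dn.
by rewrite divnA // mulKn.
Qed.

(** Associativity of Dirichlet convolution: both sides run over the pairs with [d * e] dividing
    [n]. *)
Lemma sum_divisors_assoc (F : nat -> nat -> V) (n : nat) : (0 < n)%N ->
  \sum_(1 <= d < n.+1 | (d %| n)%N) \sum_(1 <= e < n.+1 | (e %| n %/ d)%N) F d e
  = \sum_(1 <= e < n.+1 | (e %| n)%N) \sum_(1 <= d < n.+1 | (d %| n %/ e)%N) F d e.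
Proof.
move=> n0; rewrite big_mkcond [RHS]big_mkcond /=.
have E (a b : nat) : (0 < a)%N -> (0 < b)%N ->
  (a %| n)%N && (b %| n %/ a)%N = (a * b %| n)%N.
  move=> a0 b0; apply/andP/idP => [[an]|abn].
    by rewrite dvdn_divRL // mulnC.
  have an : (a %| n)%N by apply: dvdn_trans abn; rewrite dvdn_mulr.
  by rewrite dvdn_divRL // mulnC.
transitivity (\sum_(1 <= d < n.+1) \sum_(1 <= e < n.+1)
   if (d * e %| n)%N then F d e else 0).
  apply: eq_big_nat => d /andP[d0 _]; rewrite big_mkcond.
  case: ifP => dn.
    apply: eq_big_nat => e /andP[e0 _]; by rewrite -E // dn.
  by rewrite big_nat_cond big1 // => e /andP[/andP[e0 _] _]; rewrite -E // dn.
rewrite exchange_big_nat /=; apply: eq_big_nat => e /andP[e0 _].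
rewrite [X in _ = if _ then X else _]big_mkcond; case: ifP => en.
  by apply: eq_big_nat => d /andP[d0 _]; rewrite mulnC -E // en.
by rewrite big_nat_cond big1 // => d /andP[/andP[d0 _] _]; rewrite mulnC -E // en.
Qed.

End DivisorSums.

(** * Elementary bounds for logarithms, harmonic sums and factorials *)

Section LogBounds.
Variable R : realType.

Lemma ln_le_subr1 (x : R) : 0 < x -> ln x <= x - 1.
Proof.
move=> x0; have -> : x = 1 + (x - 1) by lra.
apply: le_trans (le_ln1Dx _) _; lra.
Qed.

Lemma natR_gt0 (n : nat) : (0 < n)%N -> 0 < n%:R :> R.
Proof. by rewrite ltr0n. Qed.

Lemma ln_natM (a b : nat) : (0 < a)%N -> (0 < b)%N ->
  ln (a * b)%:R = ln a%:R + ln b%:R :> R.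
Proof. by move=> a0 b0; rewrite natrM lnM // posrE ltr0n. Qed.

Lemma ln_natX (a k : nat) : (0 < a)%N -> ln (a ^ k)%:R = k%:R * ln a%:R :> R.
Proof. by move=> a0; rewrite natrX lnXn ?ltr0n // mulr_natl. Qed.

Lemma ln_nat_ge0 (n : nat) : 0 <= ln n%:R :> R.
Proof.
case: n => [|n]; first by rewrite ln0.
by apply: ln_ge0; rewrite ler1n.
Qed.

Lemma ler_ln_nat (a b : nat) : (0 < a <= b)%N -> ln a%:R <= ln b%:R :> R.
Proof.
move=> /andP[a0 ab]; rewrite ler_ln ?posrE ?ltr0n ?ler_nat //.
exact: leq_trans ab.
Qed.

Lemma ln_succ_le (n : nat) : (0 < n)%N ->
  ln n.+1%:R - ln n%:R <= n%:R^-1 :> R.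
Proof.
move=> n0; have n0R := natR_gt0 n0.
rewrite -ln_div ?posrE ?ltr0n //; apply: le_trans (ln_le_subr1 _) _.
  by rewrite divr_gt0 ?ltr0n.
rewrite -natr1 mulrDl mulfV ?gt_eqF //; lra.
Qed.

Lemma ln_succ_ge (n : nat) : (0 < n)%N ->
  n.+1%:R^-1 <= ln n.+1%:R - ln n%:R :> R.
Proof.
move=> n0; have n0R := natR_gt0 n0; have n1 : 0 < n.+1%:R :> R by rewrite ltr0n.
rewrite -lerN2 opprB.
rewrite -ln_div ?posrE //; apply: le_trans (ln_le_subr1 _) _.
  by rewrite divr_gt0.
have e : n%:R = n.+1%:R - 1 :> R by rewrite -natr1 addrK.
rewrite e; move: n1; move: (n.+1%:R) => u u0.
by rewrite (_ : (u - 1) / u - 1 = - u^-1) //; field; rewrite gt_eqF.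
Qed.

Definition Hsum (n : nat) : R := \sum_(1 <= k < n.+1) k%:R^-1.

Lemma Hsum_ge (n : nat) : ln n.+1%:R <= Hsum n.
Proof.
rewrite /Hsum; elim: n => [|n IH]; first by rewrite big_geq // ln1.
rewrite big_nat_recr //=; apply: le_trans _ (lerD IH (@ln_succ_le n.+1 isT)).
by rewrite [X in _ <= X]addrC subrK.
Qed.

Lemma Hsum_le (n : nat) : Hsum n <= 1 + ln n%:R.
Proof.
rewrite /Hsum; case: n => [|n]; first by rewrite big_geq // ln0 // addr0 ler01.
elim: n => [|n IH]; first by rewrite big_nat1 ln1 invr1 addr0.
rewrite big_nat_recr //=; apply: le_trans (lerD IH (@ln_succ_ge n.+1 isT)) _.
by rewrite -addrA [X in 1 + X <= _]addrC subrK.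
Qed.

Lemma ln_prodn (I : Type) (r : seq I) (P : pred I) (F : I -> nat) :
  (forall i, 0 < F i)%N ->
  ln (\prod_(i <- r | P i) F i)%:R = \sum_(i <- r | P i) ln (F i)%:R :> R.
Proof.
move=> F0; elim: r => [|i r IH]; first by rewrite !big_nil ln1.
rewrite !big_cons; case: ifP => // _; rewrite ln_natM ?IH //.
by apply: prodn_gt0.
Qed.

Lemma ln_fact (n : nat) : ln n`!%:R = \sum_(1 <= k < n.+1) ln k%:R :> R.
Proof.
elim: n => [|n IH]; first by rewrite big_geq // ln1.
by rewrite big_nat_recr //= factS mulnC ln_natM ?fact_gt0 // IH.
Qed.

Lemma ln_fact_ge (n : nat) : n%:R * ln n%:R - n%:R <= ln n`!%:R :> R.
Proof.
elim: n => [|n IH]; first by rewrite mul0r ln1 subr0.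
rewrite factS ln_natM ?fact_gt0 //.
case: n IH => [|n] IH; first by rewrite /= ln1 mulr0; lra.
have n0 : 0 < n.+1%:R :> R by rewrite ltr0n.
have h := @ln_succ_le n.+1 isT.
have h2 : n.+1%:R * (ln n.+2%:R - ln n.+1%:R) <= 1 :> R.
  by rewrite -ler_pdivlMl // mulr1.
rewrite -[X in X * _](natr1) -[X in _ - X <= _](natr1).
move: IH h2; lra.
Qed.

Lemma ln_fact_le (n : nat) : ln n`!%:R <= n%:R * ln n%:R :> R.
Proof.
elim: n => [|n IH]; first by rewrite mul0r ln1.
rewrite factS ln_natM ?fact_gt0 //.
rewrite -[X in X * _](natr1) mulrDl mul1r [X in _ <= X]addrC lerD2l.
apply: le_trans IH _; rewrite ler_wpM2l ?ler0n //.
by case: n => [|n]; [rewrite ln0 // ln_nat_ge0 | rewrite ler_ln_nat //= leqnSn].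
Qed.

(** The majorant [(ln n + 2) / n] telescopes: it is the antiderivative [(ln t + 1) / t] of
    [- ln t / t ^ 2] with its constant raised by 1 to absorb the discretisation. *)
Lemma sum_ln_over_sq (Q N : nat) : (0 < Q)%N ->
  \sum_(Q.+1 <= n < N) ln n%:R / (n%:R * (n%:R - 1)) <= (ln Q%:R + 2) / Q%:R :> R.
Proof.
move=> Q0; have Q0R := natR_gt0 Q0.
pose g (n : nat) : R := (ln n%:R + 2) / n%:R.
have g0 n : 0 <= g n by rewrite divr_ge0 ?ler0n // addr_ge0 ?ln_nat_ge0 ?ler0n.
case: (leqP N Q.+1) => [NQ|QN]; first by rewrite big_geq //; exact: g0.
suff : \sum_(Q.+1 <= n < N) ln n%:R / (n%:R * (n%:R - 1)) <= g Q - g N.-1.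
  by have := g0 N.-1; rewrite /g; lra.
case: N QN => // N; rewrite ltnS /= => QN.
have -> : g Q - g N = \sum_(Q.+1 <= n < N.+1) (g n.-1 - g n).
  transitivity (- g N - (- g Q)); first by ring.
  rewrite -(telescope_sumr (fun i => - g i)) 1?ltnW // big_add1.
  by apply: eq_bigr => i _ /=; ring.
rewrite big_nat_cond [X in _ <= X]big_nat_cond; apply: ler_sum => -[|n] /andP[/andP[Qn _] _] //=.
have n0 : (0 < n)%N by apply: leq_trans Q0 _.
have n0R := natR_gt0 n0; have n1 : 0 < n.+1%:R :> R by rewrite ltr0n.
rewrite /g -natr1 addrK natr1.
have h := @ln_succ_le n n0.
have h2 : n.+1%:R * (ln n.+1%:R - ln n%:R) <= 2 :> R.
  apply: (@le_trans _ _ (n.+1%:R * n%:R^-1)); first by rewrite ler_wpM2l // ler0n.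
  rewrite ler_pdivrMr // -natr1; have : 1 <= n%:R :> R by rewrite ler1n.
  lra.
have -> : (ln n%:R + 2) / n%:R - (ln n.+1%:R + 2) / n.+1%:R =
  (ln n.+1%:R - n.+1%:R * (ln n.+1%:R - ln n%:R) + 2) / (n.+1%:R * n%:R) :> R.
  move: (ln n%:R) (ln n.+1%:R) => a b; rewrite -natr1.
  by field; rewrite !gt_eqF //; lra.
rewrite ler_pM2r ?invr_gt0 ?mulr_gt0 //; move: h2; lra.
Qed.

End LogBounds.

(** * Von Mangoldt's function and the estimates of Chebyshev and Mertens *)

Section VonMangoldt.
Variable R : realType.

(** Von Mangoldt's function, as a sum over all representations [p ^ k = d]. At most one term is
    nonzero, and a sum over [d] turns into a sum over pairs [p], [k] by mere exchange. *)
Definition Lam (d : nat) : R :=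
  \sum_(1 <= p < d.+1 | prime p) \sum_(1 <= k < d.+1 | (p ^ k)%N == d) ln p%:R.

Lemma Lam_ge0 d : 0 <= Lam d.
Proof. by do 2 apply: sumr_ge0 => ? _; exact: ln_nat_ge0. Qed.

Lemma Lam_widen (d N : nat) : (0 < d <= N)%N -> Lam d =
  \sum_(1 <= p < N.+1 | prime p) \sum_(1 <= k < N.+1 | (p ^ k)%N == d) ln p%:R.
Proof.
move=> /andP[d0 dN]; rewrite [RHS](big_cat_nat _ (n := d.+1)) //=.
rewrite [X in _ = _ + X]big_nat_cond [X in _ = _ + X]big1 ?addr0; last first.
  move=> p /andP[/andP[dp _] pp]; rewrite big_nat_cond big1 // => k.
  move=> /andP[/andP[k0 _] /eqP pk]; exfalso; move: dp; rewrite -pk ltnNge.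
  by rewrite -{1}(expn1 p) leq_exp2l ?prime_gt1 // k0.
apply: eq_bigr => p pp; rewrite [RHS](big_cat_nat _ (n := d.+1)) //=.
rewrite [X in _ = _ + X]big_nat_cond [X in _ = _ + X]big1 ?addr0 // => k.
move=> /andP[/andP[dk _] /eqP pk]; exfalso; move: dk; rewrite -pk ltnNge.
by rewrite ltnW // ltn_expl // prime_gt1.
Qed.

Lemma sum_Lam (N : nat) (f : nat -> R) :
  \sum_(1 <= d < N.+1) Lam d * f d =
  \sum_(1 <= p < N.+1 | prime p) \sum_(1 <= k < N.+1 | (p ^ k <= N)%N)
     ln p%:R * f (p ^ k)%N.
Proof.
transitivity (\sum_(1 <= d < N.+1) \sum_(1 <= p < N.+1 | prime p)
   \sum_(1 <= k < N.+1) if (p ^ k)%N == d then ln p%:R * f (p ^ k)%N else 0).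
  apply: eq_big_nat => d /andP[d0 dN]; rewrite (@Lam_widen d N) ?d0 //.
  rewrite mulr_suml; apply: eq_bigr => p pp; rewrite mulr_suml big_mkcond.
  by apply: eq_bigr => k _; case: eqP => // ->.
rewrite exchange_big /=; apply: eq_bigr => p pp.
rewrite exchange_big_nat /= [RHS]big_mkcond.
apply: eq_big_nat => k /andP[k0 _]; case: (leqP (p ^ k) N) => pk.
  rewrite -big_mkcond /= (big_rem (p ^ k)%N) ?mem_index_iota; last first.
    by rewrite expn_gt0 prime_gt0 //= ltnS.
  rewrite /= eqxx [X in _ + X]big_seq_cond [X in _ + X]big1 ?addr0 // => i.
  rewrite rem_filter ?iota_uniq //.
  by rewrite mem_filter /= => /andP[/andP[/negP h _] /eqP h']; case: h; rewrite -h'.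
rewrite big_nat_cond big1 // => d /andP[/andP[_ dN] _]; case: eqP => // h.
by move: dN; rewrite ltnS -h leqNgt pk.
Qed.

Lemma sum_ltn_cond (N v : nat) (c : R) : (v <= N)%N ->
  \sum_(1 <= k < N.+1 | (k <= v)%N) c = v%:R * c.
Proof.
move=> vN; rewrite (big_cat_nat _ (n := v.+1)) //=.
rewrite [X in _ + X]big_nat_cond [X in _ + X]big1 ?addr0; last first.
  by move=> k /andP[/andP[vk _]]; rewrite leqNgt vk.
transitivity (\sum_(1 <= k < v.+1) c).
  rewrite big_nat_cond [RHS]big_nat_cond; apply: eq_bigl => k.
  by rewrite andbT ltnS; case: (k <= v)%N; rewrite ?andbF ?andbT.
by rewrite sumr_const_nat subSS subn0 mulr_natl.
Qed.

Lemma ln_logn (n N : nat) : (0 < n <= N)%N ->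
  ln n%:R = \sum_(1 <= p < N.+1 | prime p) (logn p n)%:R * ln p%:R :> R.
Proof.
move=> /andP[n0 nN]; rewrite -{1}(partnT n0) /partn ln_prodn; last first.
  by move=> p; rewrite expn_gt0; case: p.
transitivity (\sum_(1 <= p < n.+1 | prime p) (logn p n)%:R * ln p%:R : R).
  rewrite (eq_bigl xpredT) // big_ltn //= lognE /= ln1 add0r [RHS]big_mkcond.
  apply: eq_big_nat => p /andP[p0 _] /=; case: ifP => pp.
    by rewrite ln_natX.
  by rewrite lognE pp /= ln1.
rewrite [RHS](big_cat_nat _ (n := n.+1)) //=.
rewrite [X in _ = _ + X]big_nat_cond [X in _ = _ + X]big1 ?addr0 // => p.
move=> /andP[/andP[np _] pp]; rewrite lognE; case: ifP; rewrite ?mul0r //.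
by move=> /and3P[_ _ /(dvdn_leq n0)]; rewrite leqNgt np.
Qed.

Lemma sum_Lam_dvd (n : nat) : (0 < n)%N ->
  \sum_(1 <= d < n.+1 | (d %| n)%N) Lam d = ln n%:R.
Proof.
move=> n0; transitivity (\sum_(1 <= d < n.+1) Lam d * (if (d %| n)%N then 1 else 0)).
  by rewrite big_mkcond; apply: eq_bigr => d _; case: ifP; rewrite ?mulr1 ?mulr0.
rewrite sum_Lam (@ln_logn n n) ?n0 ?leqnn //.
apply: eq_bigr => p pp.
have vn : (logn p n <= n)%N by rewrite ltnW // ltn_logl.
rewrite -(@sum_ltn_cond n (logn p n) (ln p%:R)) // big_mkcond [RHS]big_mkcond.
apply: eq_bigr => k _; rewrite -pfactor_dvdn //; case: (boolP (p ^ k %| n)%N) => h.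
  by rewrite dvdn_leq // mulr1.
by rewrite mulr0; case: ifP.
Qed.

Lemma ln_fact_Lam (n : nat) :
  ln n`!%:R = \sum_(1 <= d < n.+1) Lam d * (n %/ d)%:R.
Proof.
rewrite ln_fact; transitivity
  (\sum_(1 <= k < n.+1) \sum_(1 <= d < n.+1 | (d %| k)%N) Lam d).
  apply: eq_big_nat => k /andP[k0 kn]; rewrite sum_divisors_widen ?k0 //.
  by rewrite sum_Lam_dvd.
rewrite (sum_hyperbola (fun d _ => Lam d)); apply: eq_bigr => d _.
by rewrite sumr_const_nat subSS subn0 mulr_natr.
Qed.

Definition psi (n : nat) : R := \sum_(1 <= d < n.+1) Lam d.

(** Chebyshev's argument: the logarithm of the central binomial coefficient is at most [2 n ln 2],
    and [ln_fact_Lam] writes it as the sum of [Lam d] times [n.*2 %/ d - 2 (n %/ d)]. *)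
Lemma psi_double (n : nat) : psi n.*2 - psi n <= n.*2%:R.
Proof.
have E : ln n.*2`!%:R - 2 * ln n`!%:R <= n.*2%:R :> R.
  have h : ('C(n.*2, n) <= 2 ^ n.*2)%N.
    rewrite -[2%N]/(1 + 1)%N expnDn (bigD1 (@Ordinal n.*2.+1 n _)) //=; first lia.
    by move=> ?; rewrite !exp1n !muln1 leq_addr.
  have e : (n.*2`! = 'C(n.*2, n) * (n`! * n`!))%N.
    by have := @bin_fact n.*2 n; rewrite -addnn addnK leq_addr => /(_ isT) ->.
  have b0 : (0 < 'C(n.*2, n))%N by rewrite bin_gt0 -addnn leq_addr.
  rewrite e !ln_natM ?muln_gt0 ?fact_gt0 //.
  have : ln 'C(n.*2, n)%:R <= ln (2 ^ n.*2)%:R :> R by rewrite ler_ln_nat // b0.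
  rewrite ln_natX // => h3.
  have h4 : ln 2 <= 1 :> R by apply: le_trans (@ln_le_subr1 _ _ _) _; lra.
  have : n.*2%:R * ln 2%:R <= n.*2%:R * 1 :> R by rewrite ler_wpM2l ?ler0n.
  lra.
apply: le_trans E; rewrite !ln_fact_Lam.
have -> : \sum_(1 <= d < n.+1) Lam d * (n %/ d)%:R =
   \sum_(1 <= d < n.*2.+1) Lam d * (n %/ d)%:R.
  rewrite [RHS](big_cat_nat _ (n := n.+1)) //=; last by lia.
  rewrite [X in _ = _ + X]big_nat_cond [X in _ = _ + X]big1 ?addr0 // => d.
  by move=> /andP[/andP[nd _] _]; rewrite divn_small // mulr0.
have -> : psi n = \sum_(1 <= d < n.*2.+1) if (d <= n)%N then Lam d else 0.
  rewrite /psi [RHS](big_cat_nat _ (n := n.+1)) //=; last by lia.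
  rewrite [X in _ = _ + X]big_nat_cond [X in _ = _ + X]big1 ?addr0.
    by apply: eq_big_nat => d /andP[_]; rewrite ltnS => ->.
  by move=> d /andP[/andP[nd _] _]; rewrite leqNgt nd.
rewrite mulr_sumr /psi -!sumrB big_nat_cond [X in _ <= X]big_nat_cond.
apply: ler_sum => d /andP[/andP[d0 dn] _].
have L0 := Lam_ge0 d.
(* The coefficient of [Lam d] is never negative, and it is at least 1 for [n < d <= 2 n], exactly
   the range of [psi n.*2 - psi n]. *)
have key : ((n %/ d).*2 + ~~ (d <= n) <= n.*2 %/ d)%N.
  rewrite leq_divRL //; case: (leqP d n) => h /=; last first.
    by rewrite divn_small //; lia.
  rewrite addn0; have := leq_trunc_div n d; lia.
rewrite mulrCA -mulrBr.
have : ((n %/ d).*2 + ~~ (d <= n)%N)%:R <= (n.*2 %/ d)%:R :> R by rewrite ler_nat.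
rewrite natrD -mul2n natrM; case: leqP => h /=; nra.
Qed.

(** Strong induction by halving: with [m] half of [n], rounded up,
    [psi n <= 2 m + 4 m <= 3 (n + 1)], which is at most [4 n] from [n = 3] on. *)
Lemma psi_le (n : nat) : psi n <= 4 * n%:R.
Proof.
have mono (a b : nat) : (a <= b)%N -> psi a <= psi b.
  move=> ab; rewrite /psi [X in _ <= X](big_cat_nat _ (n := a.+1)) //=.
  by rewrite lerDl; apply: sumr_ge0 => ? _; exact: Lam_ge0.
elim/ltn_ind: n => n IH; case: (leqP n 2) => [n2|n2].
  have p1 : psi 1 = 0.
    by rewrite /psi big_nat1 /Lam big_mkcond big_nat1.
  case: n n2 {IH} => [|[|[|n]]] // _; first by rewrite /psi big_geq // mulr0.
    by rewrite p1; lra.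
  by have := @psi_double 1; rewrite p1 -[1.*2]/2%N; lra.
pose m := (n.+1)./2.
have mn : (m < n)%N by rewrite /m; lia.
have nm : (n <= m.*2 <= n.+1)%N by rewrite /m; lia.
move: nm => /andP[nm mn2].
have h1 := mono _ _ nm; have h2 := psi_double m; have h3 := IH m mn.
have h4 : m.*2%:R <= n.+1%:R :> R by rewrite ler_nat.
have h5 : 3 <= n%:R :> R by rewrite (ler_nat _ 3).
have e : m.*2%:R = 2 * m%:R :> R by rewrite -mul2n natrM.
rewrite -natr1 in h4; lra.
Qed.

(** Mertens: removing the floor from [ln n! = sum Lam d (n %/ d)] can only increase it, and
    [n ln n - n] bounds the factorial from below. *)
Lemma sum_Lam_over_ge (n : nat) : (0 < n)%N ->
  ln n%:R - 1 <= \sum_(1 <= d < n.+1) Lam d / d%:R.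
Proof.
move=> n0; have n0R := natR_gt0 R n0.
rewrite -(ler_pM2l n0R) mulrBr mulr1; apply: le_trans (ln_fact_ge _ _) _.
rewrite ln_fact_Lam mulr_sumr big_nat_cond [X in _ <= X]big_nat_cond.
apply: ler_sum => d /andP[/andP[d0 _] _]; rewrite mulrCA ler_wpM2l ?Lam_ge0 //.
by rewrite ler_pdivlMr ?ltr0n // -natrM ler_nat leq_trunc_div.
Qed.

(** Here removing the floor costs at most 1 for each [d], hence [psi n] in total, which accounts for
    the 4. *)
Lemma sum_Lam_over_le (n : nat) : (0 < n)%N ->
  \sum_(1 <= d < n.+1) Lam d / d%:R <= ln n%:R + 4.
Proof.
move=> n0; have n0R := natR_gt0 R n0.
rewrite -(ler_pM2l n0R) mulrDr.
apply: (@le_trans _ _ (ln n`!%:R + psi n)); last first.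
  by apply: lerD; [exact: ln_fact_le | rewrite mulrC psi_le].
rewrite ln_fact_Lam /psi -big_split /= mulr_sumr.
apply: ler_sum_nat => d /andP[d0 _] /=.
rewrite mulrCA -{3}[Lam d]mulr1 -mulrDr ler_wpM2l ?Lam_ge0 //.
by rewrite ler_pdivrMr ?ltr0n // natr1 -natrM ler_nat ltnW // ltn_ceil.
Qed.

Lemma geom_tail (p N : nat) : (1 < p)%N ->
  \sum_(2 <= k < N) (p ^ k)%:R^-1 <= (p%:R * (p%:R - 1))^-1 :> R.
Proof.
move=> p1; have p1R : 1 < p%:R :> R by rewrite ltr1n.
have p0 : 0 < p%:R :> R by lra.
pose g (k : nat) : R := (p ^ k)%:R^-1 / (p%:R - 1).
have g0 k : 0 <= g k by rewrite divr_ge0 ?invr_ge0 ?ler0n //; lra.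
have -> : (p%:R * (p%:R - 1))^-1 = g 1%N by rewrite /g expn1 invfM.
case: (leqP N 2) => [N2|N2]; first by rewrite big_geq.
suff -> : \sum_(2 <= k < N) (p ^ k)%:R^-1 = g 1%N - g N.-1 by have := g0 N.-1; lra.
case: N N2 => [|[|N]] // _; elim: N => [|N IH]; first by rewrite big_geq // subrr.
rewrite big_nat_recr //= IH //; move: {IH} N.+1 => {}N.
rewrite /g (expnS p N) natrM.
have : (p ^ N)%:R != 0 :> R by rewrite pnatr_eq0 -lt0n expn_gt0 ltnW.
by move=> h; field; rewrite h !gt_eqF //; lra.
Qed.

(** Proper prime powers contribute at most the sum of [ln p / (p (p - 1))], whatever [P] is. The
    constant 2 is therefore uniform over all residue conditions. *)
Lemma sum_Lam_primes (P : pred nat) (x : nat) :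
  let A := \sum_(1 <= p < x.+1 | prime p && P p) ln p%:R / p%:R in
  A <= \sum_(1 <= d < x.+1 | P d) Lam d / d%:R /\
  \sum_(1 <= d < x.+1 | P d) Lam d / d%:R <= A + 2.
Proof.
move=> A; pose f d : R := if P d then d%:R^-1 else 0.
have f0 d : 0 <= f d by rewrite /f; case: ifP => // _; rewrite invr_ge0 ler0n.
have -> : \sum_(1 <= d < x.+1 | P d) Lam d / d%:R = \sum_(1 <= d < x.+1) Lam d * f d.
  by rewrite big_mkcond; apply: eq_bigr => d _; rewrite /f; case: ifP; rewrite ?mulr0.
have -> : A = \sum_(1 <= p < x.+1 | prime p) ln p%:R * f p.
  rewrite /A big_mkcondr; apply: eq_bigr => p pp; rewrite /f; case: ifP; rewrite ?mulr0 //.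
rewrite sum_Lam.
have E p : prime p -> (p < x.+1)%N ->
  \sum_(1 <= k < x.+1 | (p ^ k <= x)%N) ln p%:R * f (p ^ k)%N =
  ln p%:R * f p + \sum_(2 <= k < x.+1 | (p ^ k <= x)%N) ln p%:R * f (p ^ k)%N.
  move=> pp px; have x0 : (1 < x.+1)%N by have := prime_gt0 pp; lia.
  by rewrite big_ltn_cond // expn1 -ltnS px.
have -> : \sum_(1 <= p < x.+1 | prime p) \sum_(1 <= k < x.+1 | (p ^ k <= x)%N)
     ln p%:R * f (p ^ k)%N = \sum_(1 <= p < x.+1 | prime p) ln p%:R * f p +
  \sum_(1 <= p < x.+1 | prime p)
     \sum_(2 <= k < x.+1 | (p ^ k <= x)%N) ln p%:R * f (p ^ k)%N.
  rewrite -big_split /= big_nat_cond [RHS]big_nat_cond.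
  by apply: eq_bigr => p /andP[/andP[_ px] pp]; rewrite E.
split.
  rewrite lerDl; do 2 apply: sumr_ge0 => ? _; by rewrite mulr_ge0 ?ln_nat_ge0.
rewrite lerD2l.
apply: (@le_trans _ _ (\sum_(2 <= n < x.+1) ln n%:R / (n%:R * (n%:R - 1)))); last first.
  by have := @sum_ln_over_sq R 1 x.+1 isT; rewrite ln1; lra.
case: (leqP x 0) => x0; first by rewrite !big_geq //; lia.
rewrite big_ltn_cond //= big_mkcond big_nat_cond [X in _ <= X]big_nat_cond.
apply: ler_sum => p /andP[/andP[p1 px] _].
have p1R : 2 <= p%:R :> R by rewrite (ler_nat _ 2).
have c0 : 0 <= ln p%:R / (p%:R * (p%:R - 1)) :> R.
  by rewrite divr_ge0 ?ln_nat_ge0 // mulr_ge0; lra.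
case: ifP => // pp; rewrite -mulr_sumr ler_wpM2l ?ln_nat_ge0 //.
apply: le_trans (@geom_tail p x.+1 p1); rewrite big_mkcond; apply: ler_sum => k _.
by case: ifP => _; rewrite ?invr_ge0 ?ler0n // /f; case: ifP => // _; rewrite invr_ge0 ler0n.
Qed.

End VonMangoldt.

(** * The Selberg sieve *)

Section Moebius.
Variable R : realType.

Definition sqfree (n : nat) : bool :=
  (0 < n)%N && all (fun p => (logn p n <= 1)%N) (primes n).

Definition mu (n : nat) : R := if sqfree n then (-1) ^+ size (primes n) else 0.

Lemma mu1 : mu 1 = 1. Proof. by []. Qed.

Lemma mu_norm (n : nat) : `|mu n| <= 1.
Proof.
rewrite /mu; case: ifP => _; last by rewrite normr0 ler01.
by rewrite normrX normrN1 expr1n.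
Qed.

Lemma mu_sqr (n : nat) : mu n ^+ 2 = (sqfree n)%:R.
Proof.
by rewrite /mu; case: ifP => _; rewrite ?expr0n // -exprM mulnC exprM sqrrN !expr1n.
Qed.

Lemma mu_normE (n : nat) : `|mu n| = mu n ^+ 2.
Proof.
rewrite mu_sqr /mu; case: ifP => _; last by rewrite normr0.
by rewrite normrX normrN1 expr1n.
Qed.

Lemma mu_prime_mul (p n : nat) : prime p -> (0 < n)%N ->
  mu (p * n) = if (p %| n)%N then 0 else - mu n.
Proof.
move=> pp n0; have p0 := prime_gt0 pp; case: ifP => pn.
  rewrite /mu /sqfree muln_gt0 p0 n0 /=; case: ifP => // /allP /(_ p).
  rewrite mem_primes pp muln_gt0 p0 n0 dvdn_mulr //= => /(_ isT).
  rewrite lognM // logn_prime // eqxx /= add1n ltnS leqNgt.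
  by rewrite logn_gt0 mem_primes pp n0 pn.
have P : perm_eq (primes (p * n)) (p :: primes n).
  apply: uniq_perm; rewrite ?primes_uniq //=.
    by rewrite primes_uniq andbT mem_primes pn !andbF.
  move=> r; rewrite primesM // primes_prime // !inE; by [].
rewrite /mu /sqfree (perm_all _ P) (perm_size P) muln_gt0 p0 n0 /=.
have lp : (logn p (p * n) <= 1)%N.
  rewrite lognM // logn_prime // eqxx /=; suff -> : logn p n = 0%N by [].
  by apply/eqP; rewrite -leqn0 leqNgt logn_gt0 mem_primes pn !andbF.
rewrite lp /= (_ : all _ (primes n) = all (fun r => (logn r n <= 1)%N) (primes n)).
  by case: ifP => _; rewrite ?oppr0 // exprS mulN1r.
apply: eq_in_all => r; rewrite mem_primes => /and3P[rp _ rn].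
rewrite lognM // logn_prime //; case: eqP => // h; by rewrite h pn in rn.
Qed.

(** With [p] the least prime factor of [n], the divisors [e] and [p * e] with [p] not dividing [e]
    cancel, and [mu] vanishes on the others. *)
Lemma sum_mu (n : nat) : (0 < n)%N ->
  \sum_(1 <= d < n.+1 | (d %| n)%N) mu d = (n == 1%N)%:R.
Proof.
move=> n0; case: (eqVneq n 1%N) => [->|n1]; first by rewrite big_mkcond big_nat1 mu1.
have n2 : (1 < n)%N by lia.
pose p := pdiv n; have pp : prime p by exact: pdiv_prime.
have p0 := prime_gt0 pp; have pn : (p %| n)%N by exact: pdiv_dvd.
rewrite (bigID (fun d => (p %| d)%N)) /=.
have -> : \sum_(1 <= d < n.+1 | (d %| n)%N && (p %| d)%N) mu d =
   \sum_(1 <= e < (n %/ p).+1) if (e %| n)%N && ~~ (p %| e)%N then - mu e else 0.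
  under eq_bigl => d do rewrite andbC.
  rewrite big_mkcondr /= sum_multiples //; apply: eq_big_nat => e /andP[e0 _].
  rewrite mu_prime_mul //; case: (boolP (p %| e)%N) => pe.
    by rewrite andbF; case: ifP.
  by rewrite andbT Gauss_dvd ?pn // prime_coprime.
have -> : \sum_(1 <= d < n.+1 | (d %| n)%N && ~~ (p %| d)%N) mu d =
   \sum_(1 <= e < (n %/ p).+1) if (e %| n)%N && ~~ (p %| e)%N then mu e else 0.
  rewrite big_mkcond (big_cat_nat _ (n := (n %/ p).+1)) //=; last first.
    by rewrite ltnS leq_div.
  rewrite [X in _ + X]big_nat_cond [X in _ + X]big1 ?addr0 // => d.
  move=> /andP[/andP[nd _] _]; case: ifP => // /andP[dn pd]; exfalso.
  have : (p * d %| n)%N by rewrite Gauss_dvd ?pn // prime_coprime.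
  move=> /(dvdn_leq n0); rewrite mulnC -leq_divRL // => h; lia.
rewrite -big_split big1 // => e _ /=; case: ifP => _; lra.
Qed.

Lemma sum_mu_ln (k : nat) : (0 < k)%N ->
  \sum_(1 <= n < k.+1 | (n %| k)%N) mu n * ln (k %/ n)%:R = Lam R k.
Proof.
move=> k0; transitivity (\sum_(1 <= n < k.+1 | (n %| k)%N)
    \sum_(1 <= d < k.+1 | (d %| k %/ n)%N) mu n * Lam R d).
  rewrite big_nat_cond [RHS]big_nat_cond.
  apply: eq_bigr => n /andP[/andP[n0 nk] nd]; rewrite -mulr_sumr; congr (_ * _).
  rewrite sum_divisors_widen ?sum_Lam_dvd ?divn_gt0 ?leq_div // ?andbT;
    by rewrite ?divn_gt0 // ltnS in nk *.
rewrite sum_divisors_assoc //.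
transitivity (\sum_(1 <= e < k.+1 | (e %| k)%N) (if e == k then Lam R e else 0)).
  rewrite big_nat_cond [RHS]big_nat_cond.
  apply: eq_bigr => e /andP[/andP[e0 ek] ed]; rewrite -mulr_suml.
  have ke0 : (0 < k %/ e)%N by rewrite divn_gt0.
  rewrite sum_divisors_widen ?ke0 ?leq_div // sum_mu //.
  have -> : (k %/ e == 1)%N = (e == k).
    by rewrite eq_sym eqn_div // mul1n.
  by case: eqP => _; rewrite ?mul1r ?mul0r.
rewrite big_mkcond big_nat_recr //= dvdnn eqxx big_nat_cond big1 ?add0r // => e.
move=> /andP[/andP[_ ek] _]; case: ifP => // _; case: eqP => // h; lia.
Qed.

(** Split [l - ln n] into [l - ln k] and [ln (k / n)]: the first part survives only at [k = 1], the
    second is the inversion of [sum_Lam_dvd]. It is applied with [l = ln x], so that the weights are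
    nonnegative. *)
Lemma sum_mu_ln_sub (l : R) (k : nat) : (0 < k)%N ->
  \sum_(1 <= n < k.+1 | (n %| k)%N) mu n * (l - ln n%:R) =
  (k == 1%N)%:R * l + Lam R k.
Proof.
move=> k0; transitivity (\sum_(1 <= n < k.+1 | (n %| k)%N) mu n * (l - ln k%:R) +
    \sum_(1 <= n < k.+1 | (n %| k)%N) mu n * ln (k %/ n)%:R).
  rewrite -big_split /= big_nat_cond [RHS]big_nat_cond.
  apply: eq_bigr => n /andP[/andP[n0 nk] nd]; rewrite -mulrDr; congr (_ * _).
  rewrite -{1}(divnK nd) ln_natM ?divn_gt0 //; ring.
rewrite sum_mu_ln // -mulr_suml sum_mu //; congr (_ + _).
by case: eqP => [->|]; rewrite ?ln1 ?subr0 // !mul0r.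
Qed.

Lemma sqfree_decomp (n : nat) : (0 < n)%N ->
  exists b s, [/\ n = (b * s ^ 2)%N, sqfree b & (0 < s)%N].
Proof.
elim/ltn_ind: n => n IH n0; case: (boolP (sqfree n)) => h.
  by exists n, 1%N; rewrite exp1n muln1.
move: h; rewrite /sqfree n0 /= -has_predC => /hasP[p].
rewrite mem_primes /= => /and3P[pp _ _]; rewrite -ltnNge -pfactor_dvdn // => h.
have p1 := prime_gt1 pp; have p0 := prime_gt0 pp.
have e := divnK h; have m0 : (0 < n %/ p ^ 2)%N.
  by rewrite divn_gt0 ?expn_gt0 ?p0 // dvdn_leq.
have [|//|b [s [e2 hb s0]]] := IH (n %/ p ^ 2)%N.
  by rewrite ltn_Pdiv // -{1}(exp1n 2) ltn_exp2r.
exists b, (s * p)%N; split=> //; last by rewrite muln_gt0 s0 p0.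
by rewrite expnMn mulnA -e2 e.
Qed.

End Moebius.

(** * Selberg's weights and their quadratic form *)

Section Selberg.
Variables (R : realType) (q D : nat).
Hypotheses (q_prime : prime q) (D_gt0 : (0 < D)%N).

(** Selberg's diagonalisation: in the variables [y_s], the sum of [lambda_d / d] over the multiples
    [d] of [s], the form is the sum of [phi(s) y_s ^ 2]. Under [lambda_1 = 1] it is minimised by
    [sely], with minimum [1 / selG]; [sellam] converts back to the [lambda_d]. The support is kept
    coprime to [q] because [m] will be a power of [q] and only moduli coprime to [m] equidistribute
    over [m * k + 1]. *)
Definition selG : R :=
  \sum_(1 <= b < D.+1 | coprime b q) mu R b ^+ 2 / (totient b)%:R.

Definition sely (b : nat) : R :=
  if coprime b q then mu R b / ((totient b)%:R * selG) else 0.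

Definition sellam (d : nat) : R :=
  d%:R * \sum_(1 <= b < D.+1 | (d %| b)%N) mu R (b %/ d) * sely b.

Lemma totient_gt0R (b : nat) : (0 < b)%N -> 0 < (totient b)%:R :> R.
Proof. by move=> b0; rewrite ltr0n totient_gt0. Qed.

Lemma selG_gt0 : 0 < selG.
Proof.
rewrite /selG big_ltn_cond //= coprime1n mu1 expr1n /totient /= divr1.
rewrite ltr_wpDr // ?ltr01 //; apply: sumr_ge0 => b _.
by rewrite divr_ge0 ?sqr_ge0 ?ler0n.
Qed.

Lemma selG_neq0 : selG != 0.
Proof. exact: lt0r_neq0 selG_gt0. Qed.

(** One factor 2 comes from writing [n = b s ^ 2] with [b] squarefree, as the sum of [1 / s ^ 2] is
    at most 2; the other from discarding the multiples of [q], which carry at most [1 / q <= 1 / 2]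
    of the harmonic sum. *)
Lemma selG_ge : ln D.+1%:R / 4 <= selG.
Proof.
have H1 : \sum_(1 <= b < D.+1 | coprime b q) mu R b ^+ 2 / b%:R <= selG.
  rewrite /selG big_nat_cond [X in _ <= X]big_nat_cond.
  apply: ler_sum => b /andP[/andP[b0 _] _]; rewrite ler_wpM2l ?sqr_ge0 //.
  rewrite lef_pV2 ?posrE ?ltr0n ?totient_gt0 // ler_nat.
  rewrite totient_count_coprime; apply: leq_trans (_ : \sum_(0 <= d < b) 1 <= b)%N.
    by apply: leq_sum => i _; case: coprime.
  by rewrite sum_nat_const_nat muln1 subn0.
set A := \sum_(1 <= b < D.+1 | coprime b q) _ in H1.
have A0 : 0 <= A by apply: sumr_ge0 => b _; rewrite divr_ge0 ?sqr_ge0 ?ler0n.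
have S2 : \sum_(1 <= s < D.+1) (s%:R ^+ 2)^-1 <= 2 :> R.
  suff : forall N, \sum_(1 <= s < N.+2) (s%:R ^+ 2)^-1 <= 2 - N.+1%:R^-1 :> R.
    case: D D_gt0 => // N _ /(_ N) h; apply: le_trans h _.
    by rewrite gerBl invr_ge0 ler0n.
  elim=> [|N IH]; first by rewrite big_nat1 expr1n invr1; lra.
  rewrite big_nat_recr //=; apply: le_trans (lerD IH (lexx _)) _.
  have n0 : 0 < N.+1%:R :> R by rewrite ltr0n.
  rewrite -[N.+2%:R]natr1.
  move: (N.+1%:R) n0 => u u0.
  have -> : 2 - u^-1 + ((u + 1) ^+ 2)^-1 = 2 - (u + 1)^-1 - (u * (u + 1) ^+ 2)^-1.
    by field; rewrite !gt_eqF //; lra.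
  by rewrite gerBl invr_ge0 mulr_ge0 ?sqr_ge0 // ltW.
have H2 : \sum_(1 <= n < D.+1 | coprime n q) n%:R^-1 <= A * 2.
  apply: (@le_trans _ _ (A * \sum_(1 <= s < D.+1) (s%:R ^+ 2)^-1)); last first.
    by rewrite ler_wpM2l.
  apply: (@le_trans _ _ (\sum_(1 <= n < D.+1) \sum_(1 <= b < D.+1 | coprime b q)
     \sum_(1 <= s < D.+1) if (n == b * s ^ 2)%N then
        mu R b ^+ 2 / b%:R * (s%:R ^+ 2)^-1 else 0)).
    rewrite big_mkcond; apply: ler_sum_nat => n /andP[n0 nD].
    have t0 b s : 0 <= (if (n == b * s ^ 2)%N then
        mu R b ^+ 2 / b%:R * (s%:R ^+ 2)^-1 else 0).
      by case: ifP => // _; rewrite mulr_ge0 ?invr_ge0 ?sqr_ge0 ?divr_ge0 ?sqr_ge0.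
    case: ifP => nq; last by apply: sumr_ge0 => b _; apply: sumr_ge0.
    have [b [s [e hb s0]]] := sqfree_decomp n0.
    have b0 : (0 < b)%N by move: hb => /andP[].
    have bn : (b %| n)%N by rewrite e dvdn_mulr.
    have sn : (s %| n)%N by rewrite e expnS mulnA mulnAC dvdn_mull.
    have bq : coprime b q by apply: coprime_dvdl nq.
    have mb : b \in index_iota 1 D.+1.
      by rewrite mem_index_iota b0 ltnS; apply: leq_trans (dvdn_leq n0 bn) _.
    have ms : s \in index_iota 1 D.+1.
      by rewrite mem_index_iota s0 ltnS; apply: leq_trans (dvdn_leq n0 sn) _.
    rewrite (big_rem b) //= bq (big_rem s) //= -e eqxx -addrA ler_wpDr //.
      apply: addr_ge0; apply: sumr_ge0 => ? _; first exact: t0.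
      by apply: sumr_ge0 => ? _; exact: t0.
    by rewrite mu_sqr hb mul1r {1}e natrM natrX invfM.
  rewrite exchange_big /= mulr_suml; apply: ler_sum => b _.
  rewrite exchange_big /= mulr_sumr; apply: ler_sum => s _.
  set c := _ * _; have c0 : 0 <= c.
    by rewrite mulr_ge0 ?invr_ge0 ?sqr_ge0 ?divr_ge0 ?sqr_ge0.
  rewrite -big_mkcond /=; case: (boolP ((b * s ^ 2)%N \in index_iota 1 D.+1)) => h.
    rewrite (big_rem (b * s ^ 2)%N) //= eqxx big_seq_cond big1 ?addr0 // => i.
    by rewrite mem_rem_uniq ?iota_uniq // inE => /andP[/andP[/negPf -> _]].
  rewrite big_seq_cond big1 // => i /andP[hi /eqP ei]; by rewrite -ei hi in h.
have q1 := prime_gt1 q_prime; have q0 : 0 < q%:R :> R by rewrite ltr0n ltnW.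
have H3 : Hsum R D / 2 <= \sum_(1 <= n < D.+1 | coprime n q) n%:R^-1.
  have eH : Hsum R D = \sum_(1 <= n < D.+1 | coprime n q) n%:R^-1 +
     \sum_(1 <= n < D.+1 | ~~ coprime n q) n%:R^-1.
    by rewrite /Hsum (bigID (fun n => coprime n q)).
  have h : \sum_(1 <= n < D.+1 | ~~ coprime n q) n%:R^-1 <= Hsum R D / 2.
    rewrite (eq_bigl (fun n => (q %| n)%N)); last first.
      by move=> n; rewrite coprime_sym prime_coprime // negbK.
    rewrite (sum_multiples _ _ (prime_gt0 q_prime)).
    apply: (@le_trans _ _ (q%:R^-1 * Hsum R (D %/ q))).
      rewrite /Hsum mulr_sumr; apply: ler_sum => m _.
      by rewrite natrM invfM.
    have hh : Hsum R (D %/ q) <= Hsum R D.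
      rewrite /Hsum [X in _ <= X](big_cat_nat _ (n := (D %/ q).+1)) //=.
        by rewrite lerDl; apply: sumr_ge0 => ? _; rewrite invr_ge0.
      by rewrite ltnS leq_div.
    rewrite mulrC ler_pM ?invr_ge0 ?ler0n //.
      by apply: sumr_ge0 => ? _; rewrite invr_ge0.
    by rewrite lef_pV2 ?posrE // ler_nat.
  by move: eH h; move: (\sum_(1 <= n < _ | _) _) (\sum_(1 <= n < _ | _) _) => a b; lra.
have := Hsum_ge R D; lra.
Qed.

Lemma sellam1 : sellam 1 = 1.
Proof.
rewrite /sellam mul1r (eq_bigl xpredT); last by move=> b; rewrite dvd1n.
rewrite -(mulfV selG_neq0) {2}/selG mulr_suml.
rewrite [RHS]big_mkcond; apply: eq_big_nat => b /andP[b0 _].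
rewrite divn1 /sely; case: ifP => _; last by rewrite mulr0.
by rewrite invfM; ring.
Qed.

(** Normalisation behind [|sellam d| <= d]: the Moebius coefficients in front of the [sely b] have
    absolute value at most 1. *)
Lemma sum_sely : \sum_(1 <= b < D.+1) `|sely b| = 1.
Proof.
have G0 := selG_gt0.
rewrite -(mulfV selG_neq0) {2}/selG mulr_suml [RHS]big_mkcond.
apply: eq_big_nat => b /andP[b0 _]; rewrite /sely; case: ifP; rewrite ?normr0 //.
move=> _; have t0 := totient_gt0R b0.
rewrite normrM mu_normE ger0_norm ?invr_ge0 ?mulr_ge0 ?ltW // invfM.
by rewrite mulrA.
Qed.

Lemma sellam_norm (d : nat) : `|sellam d| <= d%:R.
Proof.
rewrite /sellam normrM normr_nat -[X in _ <= X]mulr1 ler_wpM2l ?ler0n //.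
rewrite -sum_sely big_mkcond; apply: le_trans (ler_norm_sum _ _ _) _.
apply: ler_sum => b _; case: ifP; rewrite ?normr0 // => _.
by rewrite normrM -[X in _ <= X]mul1r ler_wpM2r // mu_norm.
Qed.

Lemma sellam_coprime (d : nat) : ~~ coprime d q -> sellam d = 0.
Proof.
move=> dq; rewrite /sellam big1 ?mulr0 // => b db; rewrite /sely.
case: ifP => [bq|_]; last by rewrite mulr0.
by rewrite (coprime_dvdl db bq) in dq.
Qed.

Lemma sellam_inv (s : nat) : (0 < s <= D)%N ->
  \sum_(1 <= d < D.+1 | (s %| d)%N) sellam d / d%:R = sely s.
Proof.
move=> /andP[s0 sD].
transitivity (\sum_(1 <= d < D.+1 | (s %| d)%N)
   \sum_(1 <= b < D.+1 | (d %| b)%N) mu R (b %/ d) * sely b).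
  rewrite big_nat_cond [RHS]big_nat_cond; apply: eq_bigr => d /andP[/andP[d0 _] _].
  by rewrite /sellam mulrC mulKf // pnatr_eq0 -lt0n.
under eq_bigr => d _ do rewrite big_mkcond.
rewrite exchange_big_nat /=.
transitivity (\sum_(1 <= b < D.+1) if b == s then sely b else 0); last first.
  rewrite -big_mkcond /= (big_rem s) ?mem_index_iota ?s0 //= eqxx.
  rewrite big_seq_cond big1 ?addr0 // => i.
  by rewrite mem_rem_uniq ?iota_uniq // inE => /andP[/andP[/negPf -> _]].
apply: eq_big_nat => b /andP[b0 bD].
rewrite sum_multiples //; case: (boolP (s %| b)%N) => sb; last first.
  rewrite big1; first by case: eqP => // h; rewrite h dvdnn in sb.
  move=> e _; case: ifP => // h; exfalso; move/negP: sb; apply.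
  by apply: dvdn_trans h; rewrite dvdn_mulr.
have bs0 : (0 < b %/ s)%N by rewrite divn_gt0 // dvdn_leq.
transitivity ((\sum_(1 <= e < (b %/ s).+1 | (e %| b %/ s)%N)
    mu R ((b %/ s) %/ e)) * sely b).
  rewrite mulr_suml big_mkcond /= -big_mkcond /=.
  rewrite -(@sum_divisors_widen _ _ (b %/ s) (D %/ s)) ?bs0; last first.
    by rewrite leq_div2r.
  rewrite big_mkcond [RHS]big_mkcond; apply: eq_big_nat => e /andP[e0 _].
  rewrite -{1}(divnK sb) mulnC dvdn_pmul2r //; case: ifP => // _.
  by rewrite mulnC divnMA.
rewrite (sum_divisors_rev (fun _ m => mu R m)) // sum_mu //.
have -> : (b %/ s == 1)%N = (b == s) by rewrite eq_sym eqn_div // mul1n eq_sym.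
by case: eqP => _; rewrite ?mul1r ?mul0r.
Qed.

(** Write [1 / lcm = gcd / (d e)] and expand the gcd as the sum of [totient s] over its divisors;
    the double sum becomes a sum of squares of the [sely s]. *)
Lemma selberg_quadratic :
  \sum_(1 <= d < D.+1) \sum_(1 <= e < D.+1)
    sellam d * sellam e / (lcmn d e)%:R = selG^-1.
Proof.
have G0 := selG_gt0.
transitivity (\sum_(1 <= s < D.+1) (totient s)%:R * sely s ^+ 2); last first.
  have -> : selG^-1 = selG / selG ^+ 2.
    by rewrite expr2 invfM mulrA mulfV ?selG_neq0 // mul1r.
  rewrite {1}/selG mulr_suml.
  rewrite [RHS]big_mkcond; apply: eq_big_nat => b /andP[b0 _]; rewrite /sely.
  case: ifP => _; last by rewrite expr0n mulr0.
  have t0 := totient_gt0R b0; field; by rewrite !gt_eqF.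
transitivity (\sum_(1 <= d < D.+1) \sum_(1 <= e < D.+1) \sum_(1 <= s < D.+1)
   (totient s)%:R * ((if (s %| d)%N then sellam d / d%:R else 0) *
                     (if (s %| e)%N then sellam e / e%:R else 0))).
  apply: eq_big_nat => d /andP[d0 dD]; apply: eq_big_nat => e /andP[e0 eD].
  have g0 : (0 < gcdn d e)%N by rewrite gcdn_gt0 d0.
  transitivity (sellam d / d%:R * (sellam e / e%:R) * (gcdn d e)%:R).
    have := muln_lcm_gcd d e => /(congr1 (fun n => n%:R : R)); rewrite !natrM => h.
    have d0R := natR_gt0 R d0; have e0R := natR_gt0 R e0; have g0R := natR_gt0 R g0.
    have l0 : 0 < (lcmn d e)%:R :> R by rewrite ltr0n lcmn_gt0 d0.
    rewrite (_ : (lcmn d e)%:R = d%:R * e%:R / (gcdn d e)%:R); last first.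
      by rewrite -h mulfK // gt_eqF.
    by field; rewrite !gt_eqF.
  rewrite -{1}(sum_totient_dvd (gcdn d e)) natr_sum.
  have gD : (gcdn d e <= D)%N.
    by apply: leq_trans (dvdn_leq d0 (dvdn_gcdl d e)) _; rewrite -ltnS.
  rewrite (eq_bigl (fun s : 'I_(gcdn d e).+1 => true && (nat_of_ord s %| gcdn d e)%N)) //.
  rewrite -(big_mkord (fun s => (s %| gcdn d e)%N) (fun s => (totient s)%:R : R)).
  rewrite big_ltn_cond // dvd0n gtn_eqF //.
  rewrite -(@sum_divisors_widen _ _ (gcdn d e) D) ?g0 // big_mkcond mulr_sumr.
  apply: eq_bigr => s _; rewrite dvdn_gcd.
  by case: (s %| d)%N; case: (s %| e)%N => /=; ring.
under eq_bigr => d _ do rewrite exchange_big_nat /=.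
rewrite exchange_big_nat /=; apply: eq_big_nat => s /andP[s0 sD].
pose A d := if (s %| d)%N then sellam d / d%:R else 0.
have -> : sely s = \sum_(1 <= d < D.+1) A d.
  by rewrite -(@sellam_inv s) ?s0 // big_mkcond.
rewrite expr2 mulr_suml mulr_sumr; apply: eq_bigr => d _.
by rewrite !mulr_sumr.
Qed.

End Selberg.

(** * Sieve bound for the primes of the form [m * k + 1] *)

Section BrunTitchmarsh.
Variable R : realType.

Lemma count_dvd_shift (K d c : nat) : (0 < d)%N ->
  (\sum_(1 <= k < K.+1) nat_of_bool (d %| k + c) = (K + c) %/ d - c %/ d)%N.
Proof.
move=> d0; elim: K => [|K IH]; first by rewrite big_geq // add0n subnn.
rewrite big_nat_recr //= IH addSn divnS // addnC addnBA //.
by rewrite leq_div2r // leq_addl.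
Qed.

Lemma count_dvd_lin (K d m : nat) : (0 < d)%N -> coprime d m ->
  `|\sum_(1 <= k < K.+1) (d %| m * k + 1)%:R - K%:R / d%:R| <= 1 :> R.
Proof.
move=> d0 dm; have d0R := natR_gt0 R d0.
(* [c] inverts [m] modulo [d], so that [d] divides [m * k + 1] exactly when it divides [k + c]. If
   [m = 0], coprimality forces [d = 1]. *)
have [c hc] : exists c, (m * c = 1 %[mod d])%N.
  have [|m0] := posnP m.
    move=> m0; exists 0%N; move: dm; rewrite m0 /coprime gcdn0 => /eqP ->.
    by rewrite !modn1.
  case: (egcdnP d m0) => u v h _.
  exists u; rewrite mulnC h -[in RHS](modnMDl v 1 d).
  by move: dm; rewrite coprime_sym /coprime => /eqP ->.
have -> : \sum_(1 <= k < K.+1) (d %| m * k + 1)%:R =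
   (\sum_(1 <= k < K.+1) nat_of_bool (d %| k + c))%N%:R :> R.
  rewrite natr_sum; apply: eq_bigr => k _; congr (_%:R); congr nat_of_bool.
  rewrite -(@Gauss_dvdr d m (k + c)) // mulnDr /dvdn -modnDmr -hc modnDmr //.
rewrite count_dvd_shift // natrB; last by rewrite leq_div2r // leq_addl.
have fl n : (n%:R / d%:R - 1 : R) < (n %/ d)%:R <= (n%:R / d%:R : R).
  rewrite ltrBlDr natr1 ltr_pdivrMr // ler_pdivlMr // -!natrM ltr_nat ler_nat.
  by rewrite leq_trunc_div ltn_ceil.
have /andP[h1 h2] := fl (K + c)%N; have /andP[h3 h4] := fl c.
move: h1 h2; rewrite natrD mulrDl => h1 h2.
by rewrite ler_norml; apply/andP; split; lra.
Qed.

(** The indices [k <= D] are counted trivially. For the others [W k ^ 2] majorises the indicator of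
    primality; expanding it gives [K / selG] and, from at most [D ^ 2] pairs with weights up to
    [D ^ 2], the remainder [D ^ 4]. *)
Lemma sieve_bound (q m K D : nat) : prime q -> (0 < D)%N ->
  (forall d, coprime d q -> coprime d m) -> (0 < m)%N ->
  \sum_(1 <= k < K.+1) (prime (m * k + 1))%:R <=
   D%:R + K%:R / selG R q D + D%:R ^+ 4 :> R.
Proof.
move=> qp D0 cop m0; pose l d := sellam R q D d.
pose W k : R := \sum_(1 <= d < D.+1 | (d %| m * k + 1)%N) l d.
have H1 : \sum_(1 <= k < K.+1) (prime (m * k + 1))%:R <=
   \sum_(1 <= k < K.+1) (k <= D)%N%:R + \sum_(1 <= k < K.+1) W k ^+ 2 :> R.
  rewrite -big_split /=; apply: ler_sum_nat => k /andP[k0 _].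
  case: (boolP (prime _)) => pr; last by rewrite addr_ge0 ?sqr_ge0.
  case: (leqP k D) => kD; first by rewrite lerDl sqr_ge0.
  (* A prime [m * k + 1] with [k > D] exceeds [D], so only [d = 1] divides it in the range and
     [W k = sellam 1 = 1]. *)
  rewrite add0r /W big_ltn_cond // dvd1n /l sellam1 //.
  rewrite big_nat_cond big1 ?addr0 ?expr1n // => d.
  move=> /andP[/andP[d1 dD] dv]; exfalso.
  have /primeP[_ /(_ d dv)] := pr; have : (k <= m * k)%N by rewrite leq_pmull.
  by move=> h /orP[] /eqP; lia.
have H2 : \sum_(1 <= k < K.+1) (k <= D)%N%:R <= D%:R :> R.
  case: (leqP K D) => KD.
    apply: (@le_trans _ _ (\sum_(1 <= k < K.+1) 1)).
      by apply: ler_sum => k _; case: (k <= D)%N.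
    by rewrite sumr_const_nat subSS subn0 ler_nat.
  rewrite (big_cat_nat _ (n := D.+1)) //=; last by rewrite ltnS ltnW.
  rewrite [X in _ + X]big_nat_cond [X in _ + X]big1 ?addr0; last first.
    by move=> k /andP[/andP[dk _] _]; rewrite leqNgt dk.
  apply: (@le_trans _ _ (\sum_(1 <= k < D.+1) 1)).
    by apply: ler_sum => k _; case: (k <= D)%N.
  by rewrite sumr_const_nat subSS subn0.
have H3 : \sum_(1 <= k < K.+1) W k ^+ 2 =
  \sum_(1 <= d < D.+1) \sum_(1 <= e < D.+1) l d * l e *
    \sum_(1 <= k < K.+1) (lcmn d e %| m * k + 1)%:R.
  transitivity (\sum_(1 <= k < K.+1) \sum_(1 <= d < D.+1) \sum_(1 <= e < D.+1)
     l d * l e * (lcmn d e %| m * k + 1)%:R).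
    apply: eq_bigr => k _; rewrite expr2 {1}/W mulr_suml big_mkcond.
    apply: eq_bigr => d _; case: ifP => hd; last first.
      by rewrite big1 // => e _; rewrite dvdn_lcm hd mulr0.
    rewrite /W mulr_sumr big_mkcond; apply: eq_bigr => e _.
    by rewrite dvdn_lcm hd /=; case: ifP; rewrite ?mulr1 ?mulr0.
  rewrite exchange_big_nat /=; apply: eq_bigr => d _.
  rewrite exchange_big_nat /=; apply: eq_bigr => e _.
  by rewrite mulr_sumr.
have H4 : \sum_(1 <= k < K.+1) W k ^+ 2 <=
   \sum_(1 <= d < D.+1) \sum_(1 <= e < D.+1)
     (K%:R * (l d * l e / (lcmn d e)%:R) + D%:R * D%:R).
  rewrite H3; apply: ler_sum_nat => d /andP[d0 dD]; apply: ler_sum_nat => e /andP[e0 eD].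
  have DD : 0 <= D%:R * D%:R :> R by rewrite mulr_ge0.
  case: (boolP (coprime d q)) => dq; last first.
    by rewrite /l (@sellam_coprime R q D d) // !mul0r mulr0 add0r.
  case: (boolP (coprime e q)) => eq; last first.
    by rewrite /l (@sellam_coprime R q D e) // mulr0 !mul0r mulr0 add0r.
  have lq : coprime (lcmn d e) q.
    apply: (@coprime_dvdl _ (d * e)); last by rewrite coprimeMl dq eq.
    by rewrite dvdn_lcm dvdn_mulr // dvdn_mull.
  have l0 : (0 < lcmn d e)%N by rewrite lcmn_gt0 d0.
  have := @count_dvd_lin K _ m l0 (cop _ lq).
  set S := \sum_(1 <= k < K.+1) _ => hS.
  rewrite -lerBlDl (_ : _ - _ = l d * l e * (S - K%:R / (lcmn d e)%:R)); last by ring.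
  apply: le_trans (ler_norm _) _; rewrite normrM -[X in _ <= X]mulr1.
  apply: ler_pM; rewrite ?normr_ge0 // normrM.
  apply: ler_pM; rewrite ?normr_ge0 //.
    by apply: le_trans (@sellam_norm R q D D0 d) _; rewrite ler_nat.
  by apply: le_trans (@sellam_norm R q D D0 e) _; rewrite ler_nat.
apply: le_trans H1 _; rewrite -addrA; apply: lerD => //.
apply: le_trans H4 _; under eq_bigr => d _ do rewrite big_split /= -mulr_sumr.
rewrite big_split /= -mulr_sumr selberg_quadratic // lerD2l.
rewrite !sumr_const_nat !subn1 /= -natrM -!mulrnA -natrX ler_nat.
by rewrite !expnS expn0 muln1 !mulnA.
Qed.

Lemma ln_le_sqrt (x : R) : 0 < x -> ln x <= 2 * Num.sqrt x.
Proof.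
move=> x0; have s0 : 0 < Num.sqrt x by rewrite sqrtr_gt0.
rewrite -{1}(sqr_sqrtr (ltW x0)) lnXn // mulr2n.
have := ln_le_subr1 s0; lra.
Qed.

(* Sieving level: the largest [D] with [D ^ 8 <= K], so that the crude bound
   [|lambda_d| <= D] makes the remainder at most [K ^ (1/2)]. *)
Lemma prime_count_lin (q m K : nat) : prime q -> (0 < m)%N ->
  (forall d, coprime d q -> coprime d m) -> (0 < K)%N ->
  \sum_(1 <= k < K.+1) (prime (m * k + 1))%:R <= 100 * (K%:R / ln K.+1%:R) :> R.
Proof.
move=> qp m0 cop K0.
have ex : exists d, (d ^ 8 <= K)%N by exists 0%N.
have bd d : (d ^ 8 <= K)%N -> (d <= K)%N.
  case: d => // d; apply: leq_trans; exact: leq_pexp2l (isT : (0 < 8)%N).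
case: (ex_maxnP ex bd) => D hD maxD.
have D0 : (0 < D)%N by have := maxD 1%N; rewrite exp1n => /(_ K0).
have hD2 : (K.+1 <= D.+1 ^ 8)%N.
  by rewrite ltnNge; apply/negP => /maxD; rewrite ltnn.
apply: le_trans (sieve_bound _ qp D0 cop m0) _.
have l0 : 0 < ln K.+1%:R :> R by rewrite ln_gt0 // ltr1n.
have lD : ln K.+1%:R / 8 <= ln D.+1%:R :> R.
  have : ln K.+1%:R <= ln (D.+1 ^ 8)%:R :> R by rewrite ler_ln_nat.
  rewrite ln_natX // => h; rewrite ler_pdivrMr //; lra.
have G0 := selG_gt0 R q D0; have hG := selG_ge R qp D0.
have K0R := natR_gt0 R K0; have D0R := natR_gt0 R D0.
(* [32 = 4 * 8]: a quarter from [selG_ge], and an eighth because [K + 1] is at most the eighth power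
   of [D + 1]. *)
have A : K%:R / selG R q D <= 32 * (K%:R / ln K.+1%:R) :> R.
  rewrite mulrCA ler_wpM2l ?ler0n // -[X in X <= _]mul1r ler_pdivrMr //.
  rewrite mulrAC ler_pdivlMr // mul1r; lra.
set s := Num.sqrt K%:R : R.
have s0 : 0 < s by rewrite sqrtr_gt0.
have ss : s ^+ 2 = K%:R by rewrite sqr_sqrtr ?ler0n.
have D4 : D%:R ^+ 4 <= s.
  have h8 : (D%:R ^+ 4) ^+ 2 <= s ^+ 2 by rewrite ss -exprM -natrX ler_nat.
  by move: h8; rewrite ler_pXn2r // nnegrE ?exprn_ge0 // (ltW s0).
have D1 : D%:R <= s.
  apply: le_trans D4; rewrite -natrX ler_nat.
  exact: (@leq_pexp2l D 1 4 D0 isT).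
have B : s <= 4 * (K%:R / ln K.+1%:R).
  rewrite mulrA ler_pdivlMr // -ss.
  have h : ln K.+1%:R <= 2 * Num.sqrt K.+1%:R :> R by apply: ln_le_sqrt; rewrite ltr0n.
  have h2 : Num.sqrt K.+1%:R <= 2 * s :> R.
    have h8 : (Num.sqrt K.+1%:R) ^+ 2 <= (2 * s) ^+ 2.
      rewrite exprMn ss sqr_sqrtr ?ler0n // -natr1.
      have : 1 <= K%:R :> R by rewrite ler1n.
      lra.
    move: h8; rewrite ler_pXn2r // nnegrE ?sqrtr_ge0 // mulr_ge0 //.
    exact: (ltW s0).
  rewrite expr2; nra.
move: A B D1 D4; lra.
Qed.

End BrunTitchmarsh.

(** * Upper bounds for the sum of [1 / p] over primes [p = 1 mod q ^ a] *)

Section PrimeReciprocals.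
Variable R : realType.

Definition LL (x : nat) : R := ln (ln x%:R).

Definition Bsum (m x : nat) : R :=
  \sum_(1 <= p < x.+1 | prime p && (m %| p.-1)%N) p%:R^-1.

Lemma Bsum_ge0 m x : 0 <= Bsum m x.
Proof. by apply: sumr_ge0 => p _; rewrite invr_ge0. Qed.

Lemma ln2_ge : 1 / 2 <= ln 2 :> R.
Proof. by have := @ln_succ_ge R 1 isT; rewrite ln1; lra. Qed.

Lemma ln2_le : ln 2 <= 1 :> R.
Proof. by have := @ln_succ_le R 1 isT; rewrite ln1 invr1; lra. Qed.

Lemma LL_succ_ge (n : nat) : (1 < n)%N ->
  (n.+1%:R * ln n.+1%:R)^-1 <= LL n.+1 - LL n.
Proof.
move=> n1; have l0 : 0 < ln n%:R :> R by rewrite ln_gt0 // ltr1n.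
have l1 : 0 < ln n.+1%:R :> R by rewrite ln_gt0 // ltr1n; lia.
have h := @ln_le_subr1 R (ln n%:R / ln n.+1%:R); rewrite ln_div ?posrE // in h.
have {}h := h (divr_gt0 l0 l1).
have h2 : (n.+1%:R * ln n.+1%:R)^-1 <= 1 - ln n%:R / ln n.+1%:R :> R.
  have -> : 1 - ln n%:R / ln n.+1%:R = (ln n.+1%:R - ln n%:R) / ln n.+1%:R :> R.
    by rewrite mulrBl mulfV // gt_eqF.
  rewrite invfM ler_wpM2r ?invr_ge0 //; first exact: ltW.
  by apply: ln_succ_ge; lia.
rewrite /LL; move: h h2; move: (_^-1) (ln (ln _)) (ln (ln _)) (_ / _) => a b c d; lra.
Qed.

Lemma LL3_ge0 (x : nat) : (3 <= x)%N -> 0 <= LL x.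
Proof.
(* From [ln 2 = ln 8 - ln 4 >= 1/5 + 1/6 + 1/7 + 1/8] follows
   [2 ln 3 = ln 9 >= 3 ln 2 + 1/9 > 2]. *)
move=> x3; have h : 1 <= ln 3 :> R.
  have e1 := @ln_succ_ge R 1 isT; have e2 := @ln_succ_ge R 2 isT.
  have e3 := @ln_natM R 2 2 isT isT; have e4 := @ln_natM R 3 3 isT isT.
  have e5 := @ln_natM R 2 4 isT isT; have : ln (2 * 4)%:R <= ln (3 * 3)%:R :> R.
    by rewrite ler_ln_nat.
  have f1 := @ln_succ_ge R 5 isT; have f2 := @ln_succ_ge R 6 isT.
  have f3 := @ln_succ_ge R 7 isT; have f4 := @ln_succ_ge R 3 isT.
  have f5 := @ln_succ_ge R 4 isT; have f6 := @ln_succ_ge R 8 isT.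
  move: e1 e2 e3 e4 e5 f1 f2 f3 f4 f5 f6; rewrite ln1 /=.
  rewrite -[(2 * 2)%N]/4%N -[(3 * 3)%N]/9%N -[(2 * 4)%N]/8%N; lra.
apply: ln_ge0; apply: le_trans h _; exact: ler_ln_nat.
Qed.

Lemma sum_inv_nlogn (K x : nat) : (K <= x)%N -> (3 <= x)%N ->
  \sum_(1 <= k < K) (k.+1%:R * ln k.+1%:R)^-1 <= 2 + LL x.
Proof.
move=> Kx x3; have t0 k : 0 <= (k.+1%:R * ln k.+1%:R)^-1 :> R.
  by rewrite invr_ge0 mulr_ge0 ?ln_nat_ge0.
apply: (@le_trans _ _ (\sum_(1 <= k < x) (k.+1%:R * ln k.+1%:R)^-1)).
  case: (leqP K 1) => K1; first by rewrite big_geq // sumr_ge0.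
  by rewrite [X in _ <= X](big_cat_nat _ (n := K)) //= ?lerDl ?sumr_ge0 // ltnW.
case: x x3 {Kx} => [|[|[|x]]] // _.
have l2 := ln2_ge; have l2' := ln2_le.
rewrite big_ltn //.
have h1 : (2 * ln 2)^-1 <= 1 :> R by rewrite invf_le1 ?mulr_gt0 //; lra.
have h2 : \sum_(2 <= k < x.+3) (k.+1%:R * ln k.+1%:R)^-1 <= LL x.+3 - LL 2.
  rewrite -(telescope_sumr LL) //; apply: ler_sum_nat => k /andP[k1 _].
  exact: LL_succ_ge.
have h3 : - 1 <= LL 2.
  have p2 : 0 < ln 2 :> R by lra.
  rewrite /LL; have := @ln_le_subr1 R (ln 2)^-1; rewrite invr_gt0 lnV ?posrE //.
  have : (ln 2)^-1 <= 2 :> R by rewrite -[_^-1]mul1r ler_pdivrMr //; lra.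
  by move=> a /(_ p2); lra.
move: h1 h2 h3; move: (\sum_(2 <= k < _) _) (_^-1) (LL _) (LL _) => a b c d; lra.
Qed.

(** Since [1 / (m k + 1) <= 1 / (m k)], the factor [1 / m] comes out, and partial summation of the
    sieve bound leaves the sum of [1 / (k ln k)], which grows like log log. Powers of [q] are
    included because higher powers of [q] dividing [p - 1] have to be controlled later. *)
Lemma Bsum_le : exists2 C : R, 0 < C & forall q a x : nat, prime q -> (3 <= x)%N ->
  Bsum (q ^ a) x <= C * (1 + LL x) / (q ^ a)%:R.
Proof.
have [C C0 hC] : exists2 C : R, 0 < C & forall q m K : nat, prime q -> (0 < m)%N ->
    (forall d, coprime d q -> coprime d m) -> (0 < K)%N ->
    \sum_(1 <= k < K.+1) (prime (m * k + 1))%:R <= C * (K%:R / ln K.+1%:R).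
  by exists 100; [rewrite ltr0n | exact: prime_count_lin].
exists (4 * C) => [|q a x qp x3]; first by rewrite mulr_gt0.
set m := (q ^ a)%N.
have m0 : (0 < m)%N by rewrite expn_gt0 prime_gt0.
have m0R := natR_gt0 R m0.
have cop d : coprime d q -> coprime d m by move=> h; apply: coprimeXr.
have cop' : forall d, coprime d q -> coprime d m := cop.
case: x x3 => // x x3.
have E : Bsum m x.+1 = \sum_(1 <= k < (x %/ m).+1)
   (prime (m * k + 1))%:R / (m * k + 1)%:R.
  rewrite /Bsum big_add1 /= big_ltn_cond //=.
  rewrite (eq_bigl (fun j => (m %| j)%N && prime j.+1)); last by move=> j; rewrite andbC.
  rewrite big_mkcondr /= sum_multiples //; apply: eq_bigr => k _.
  by rewrite addn1; case: (prime _); rewrite ?mul1r ?mul0r.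
have LL0 := LL3_ge0 x3.
rewrite E; set K := (x %/ m)%N.
apply: (@le_trans _ _ (m%:R^-1 * \sum_(1 <= k < K.+1) (prime (m * k + 1))%:R / k%:R)).
  rewrite mulr_sumr; apply: ler_sum_nat => k /andP[k0 _].
  rewrite mulrCA -invfM ler_wpM2l ?ler0n // lef_pV2 ?posrE ?mulr_gt0 ?ltr0n ?addn1 //.
  by rewrite -natrM ler_nat.
rewrite mulrC ler_wpM2r ?invr_ge0 ?ler0n //.
case: (posnP K) => [->|K0].
  by rewrite big_geq // mulr_ge0 ?addr_ge0 // mulr_ge0 // (ltW C0).
pose c k : R := \sum_(1 <= j < k.+1) (prime (m * j + 1))%:R.
(* Partial summation, as an induction on [K]: passing from [c k / k] to [c k / (k + 1)] loses
   [c k / (k (k + 1))], which the sieve bounds by [C / ((k + 1) ln (k + 1))]. *)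
have A : \sum_(1 <= k < K.+1) (prime (m * k + 1))%:R / k%:R <=
   c K / K%:R + C * \sum_(1 <= k < K) (k.+1%:R * ln k.+1%:R)^-1.
  case: {+}K K0 => // n _; elim: n => [|n IH].
    by rewrite [X in _ + C * X]big_geq // mulr0 addr0 /c !big_nat1 !divr1.
  rewrite big_nat_recr //=; apply: le_trans (lerD IH (lexx _)) _.
  rewrite [X in _ <= _ + _ * X]big_nat_recr //= mulrDr addrA.
  have h := hC q m n.+1 qp m0 cop' isT; rewrite -/(c n.+1) in h.
  have -> : c n.+2 = c n.+1 + (prime (m * n.+2 + 1))%:R by rewrite {1}/c big_nat_recr.
  have n0 : 0 < n.+1%:R :> R by rewrite ltr0n.
  have l0 : 0 < ln n.+2%:R :> R by rewrite ln_gt0 // ltr1n.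
  have e : c n.+1 / n.+1%:R - c n.+1 / n.+2%:R <= C * (n.+2%:R * ln n.+2%:R)^-1.
    have -> : c n.+1 / n.+1%:R - c n.+1 / n.+2%:R = c n.+1 / (n.+1%:R * n.+2%:R).
      by rewrite -[n.+2%:R]natr1; field; rewrite !gt_eqF //; lra.
    rewrite ler_pdivrMr ?mulr_gt0 ?ltr0n //; apply: le_trans h _.
    rewrite le_eqVlt; apply/orP; left; apply/eqP; field; rewrite ?gt_eqF ?ltr0n //.
  rewrite [(c _ + _) / _]mulrDl -subr_ge0.
  set X := (X in 0 <= X).
  have -> : X = C * (n.+2%:R * ln n.+2%:R)^-1 -
     (c n.+1 / n.+1%:R - c n.+1 / n.+2%:R) by rewrite /X; ring.
  by rewrite subr_ge0.
apply: le_trans A _.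
have h := hC q m K qp m0 cop' K0; rewrite -/(c K) in h.
have K0R := natR_gt0 R K0.
have lK : 1 / 2 <= ln K.+1%:R :> R.
  by apply: le_trans ln2_ge _; apply: ler_ln_nat; lia.
have h1 : c K / K%:R <= 2 * C.
  rewrite ler_pdivrMr //; apply: le_trans h _.
  have : K%:R / ln K.+1%:R <= K%:R * 2 :> R.
    have p2 : 0 < ln K.+1%:R :> R by lra.
    by rewrite ler_wpM2l ?ler0n // -[_^-1]mul1r ler_pdivrMr //; lra.
  by move: C0; move: (_ / _) => v; nra.
have h2 := @sum_inv_nlogn K x.+1 (leq_trans (leq_div _ _) (leqnSn _)) x3.
by move: h1 h2 LL0 C0; move: (\sum_(1 <= k < K) _) (c K / _) (LL _) => u v w; nra.
Qed.

End PrimeReciprocals.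

(** * Primes congruent to 1 modulo a prime *)

Section ComplexNorm.
Variable R : realType.
Local Notation C := R[i].

(* The norm of the numeric structure on [R[i]] is [R[i]]-valued; [nc] is its
   [R]-valued version, to which the order on [R] applies. *)
Definition nc (z : C) : R := Normc.normc z.
Definition rc (x : R) : C := real_complex R x.

Lemma ncM z w : nc (z * w) = nc z * nc w.
Proof. exact: Normc.normcM. Qed.

Lemma ncD z w : nc (z + w) <= nc z + nc w.
Proof. exact: le_normcD. Qed.

Lemma nc0 : nc 0 = 0. Proof. exact: Normc.normc0. Qed.
Lemma nc1 : nc 1 = 1. Proof. exact: Normc.normc1. Qed.
Lemma ncN z : nc (- z) = nc z. Proof. exact: normcN. Qed.

Lemma nc_ge0 z : 0 <= nc z.
Proof. by case: z => a b; rewrite /nc /= sqrtr_ge0. Qed.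

Lemma nc_rc x : nc (rc x) = `|x|.
Proof. by rewrite /nc /rc /= expr0n addr0 sqrtr_sqr. Qed.

Lemma nc_sum (I : Type) (r : seq I) (P : pred I) (F : I -> C) :
  nc (\sum_(i <- r | P i) F i) <= \sum_(i <- r | P i) nc (F i).
Proof.
elim: r => [|i r IH]; first by rewrite !big_nil nc0.
rewrite !big_cons; case: ifP => // _; apply: le_trans (ncD _ _) _.
by rewrite lerD2l.
Qed.

Lemma Re_nc z : `|complex.Re z| <= nc z.
Proof.
case: z => a b; rewrite /nc /= -sqrtr_sqr ler_sqrt ?lerDl ?sqr_ge0 //.
by rewrite addr_ge0 ?sqr_ge0.
Qed.

Lemma rcD x y : rc (x + y) = rc x + rc y. Proof. exact: rmorphD. Qed.
Lemma rcB x y : rc (x - y) = rc x - rc y. Proof. exact: rmorphB. Qed.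
Lemma rcM x y : rc (x * y) = rc x * rc y. Proof. exact: rmorphM. Qed.
Lemma rc_sum (I : Type) (r : seq I) (P : pred I) (F : I -> R) :
  rc (\sum_(i <- r | P i) F i) = \sum_(i <- r | P i) rc (F i).
Proof. exact: rmorph_sum. Qed.

Lemma Re_sum (I : Type) (r : seq I) (P : pred I) (F : I -> C) :
  complex.Re (\sum_(i <- r | P i) F i) = \sum_(i <- r | P i) complex.Re (F i).
Proof.
elim: r => [|i r IH]; first by rewrite !big_nil.
by rewrite !big_cons; case: ifP => // _; rewrite -IH; case: (F i) (\sum_(_ <- _ | _) _) => a b [].
Qed.

Lemma Re_mul_rc z x : complex.Re (z * rc x) = complex.Re z * x.
Proof. by case: z => a b; rewrite /rc /= mulr0 subr0. Qed.

(** For [z = a + i b] with [b ^ 2 <= 1 - a ^ 2] the expression is at least [2 (1 + a) ^ 2]; this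
    also covers the value 0 of a character. *)
Lemma nc_le1_341 z : nc z <= 1 -> 0 <= 3 + 4 * complex.Re z + complex.Re (z ^+ 2).
Proof.
case: z => a b; rewrite /nc expr2 /= => h.
have : a ^+ 2 + b ^+ 2 <= 1.
  have := sqr_sqrtr (addr_ge0 (sqr_ge0 a) (sqr_ge0 b)).
  move: (Num.sqrt _) (sqrtr_ge0 (a ^+ 2 + b ^+ 2)) h => s s0 s1 <-.
  by rewrite expr_le1.
by move=> h2; nra.
Qed.

End ComplexNorm.

(** * Character sums weighted by [1 / n] and by von Mangoldt's function *)

Section Characters.
Variable R : realType.
Local Notation C := R[i].
Local Notation nc := (@nc R).
Local Notation rc := (@rc R).

(* A nonprincipal Dirichlet character, through the only properties used:
   [Q] bounds its sums over all intervals. *)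
Record quasichar (chi : nat -> C) (Q : R) : Prop := Quasichar {
  qc1 : chi 1%N = 1;
  qcM : forall m n : nat, chi (m * n)%N = chi m * chi n;
  qc_le1 : forall n, nc (chi n) <= 1;
  qc_sum : forall a b : nat, nc (\sum_(a <= n < b) chi n) <= Q;
  qc_Q : 1 <= Q }.

Section OneChar.
Variables (chi : nat -> C) (Q : R).
Hypothesis hchi : quasichar chi Q.

Let Q0 : 0 <= Q. Proof. exact: le_trans ler01 (qc_Q hchi). Qed.

(** Abel summation: the boundary term is at most [Q f b], and the increments of the monotone weight
    telescope to [Q (f a - f b)]. *)
Lemma abel_bound (f : nat -> R) (a b : nat) :
  (forall n, (a <= n)%N -> f n.+1 <= f n) -> (forall n, 0 <= f n) ->
  nc (\sum_(a <= n < b) chi n * rc (f n)) <= Q * f a.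
Proof.
move=> fd f0; case: (leqP b a) => [ba|ab].
  by rewrite big_geq // nc0 mulr_ge0.
pose P n := \sum_(a <= i < n) chi i.
have E k : \sum_(a <= n < a + k) chi n * rc (f n) =
   P (a + k)%N * rc (f (a + k)%N) +
   \sum_(a <= n < a + k) P n.+1 * rc (f n - f n.+1).
  elim: k => [|k IH]; first by rewrite addn0 /P !big_geq // mul0r addr0.
  rewrite addnS !big_nat_recr ?leq_addr //= IH.
  have -> : P (a + k).+1 = P (a + k)%N + chi (a + k)%N.
    by rewrite /P big_nat_recr // leq_addr.
  by rewrite rcB; ring.
have ek : b = (a + (b - a))%N by rewrite subnKC // ltnW.
rewrite ek E; set k := (b - a)%N.
apply: le_trans (ncD _ _) _; rewrite ncM nc_rc ger0_norm //.
have PQ n : nc (P n) <= Q by apply: (qc_sum hchi).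
have T : \sum_(a <= n < a + k) (f n - f n.+1) = f a - f (a + k)%N.
  rewrite -[RHS]opprB -(telescope_sumr f) ?leq_addr // -sumrN.
  by apply: eq_bigr => i _; rewrite opprB.
have -> : Q * f a = Q * f (a + k)%N + Q * (f a - f (a + k)%N) by ring.
apply: lerD; first by rewrite ler_wpM2r.
apply: le_trans (nc_sum _ _ _) _; rewrite -T mulr_sumr.
apply: ler_sum_nat => n /andP[an _]; rewrite ncM nc_rc ger0_norm ?subr_ge0 ?fd //.
by rewrite ler_wpM2r // subr_ge0 fd.
Qed.

Definition Lpart (t : nat) : C := \sum_(1 <= n < t.+1) chi n * rc n%:R^-1.

Lemma Lpart_diff (t N : nat) : (t <= N)%N -> nc (Lpart N - Lpart t) <= Q / t.+1%:R.
Proof.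
move=> tN; rewrite /Lpart (big_cat_nat _ (n := t.+1)) //= addrAC subrr add0r.
apply: (@abel_bound (fun n => n%:R^-1)) => [n tn|n]; last by rewrite invr_ge0.
by rewrite lef_pV2 ?posrE ?ltr0n ?ler_nat //; lia.
Qed.

Lemma Lpart_diff_div (x n N : nat) : (0 < n <= x)%N -> (x <= N)%N ->
  nc (Lpart (x %/ n) - Lpart N) <= Q * (n%:R / x%:R).
Proof.
move=> /andP[n0 nx] xN; rewrite -ncN opprB.
apply: le_trans (@Lpart_diff (x %/ n) N _) _.
  exact: leq_trans (leq_div _ _) xN.
have x0 : (0 < x)%N by exact: leq_trans nx.
rewrite ler_wpM2l // -[X in X <= _]mul1r ler_pdivrMr ?ltr0n // mulrAC.
rewrite ler_pdivlMr ?ltr0n // mul1r -natrM ler_nat mulnC.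
by rewrite ltnW // ltn_ceil.
Qed.

(** [ln n / n] is not monotone near 1, but [(ln n + 1) / n] and [1 / n] both decrease from [n = 1];
    each costs [Q]. *)
Lemma sum_chi_ln (x : nat) :
  nc (\sum_(1 <= n < x.+1) chi n * rc (ln n%:R / n%:R)) <= 2 * Q.
Proof.
have -> : \sum_(1 <= n < x.+1) chi n * rc (ln n%:R / n%:R) =
  \sum_(1 <= n < x.+1) chi n * rc ((ln n%:R + 1) / n%:R) -
  \sum_(1 <= n < x.+1) chi n * rc n%:R^-1.
  rewrite -sumrB; apply: eq_bigr => n _; rewrite -mulrBr -rcB; congr (_ * rc _).
  by rewrite mulrDl mul1r addrK.
apply: le_trans (ncD _ _) _; rewrite ncN.
have h1 : nc (\sum_(1 <= n < x.+1) chi n * rc ((ln n%:R + 1) / n%:R)) <=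
   Q * ((ln 1%:R + 1) / 1%:R).
  apply: (@abel_bound (fun n => (ln n%:R + 1) / n%:R)) => n.
    move=> n0; have n0R := natR_gt0 R n0.
    rewrite ler_pdivrMr ?ltr0n // mulrAC ler_pdivlMr //.
    have h := @ln_succ_le R n n0; have l0 := ln_nat_ge0 R n.
    have h2 : n%:R * (ln n.+1%:R - ln n%:R) <= 1 :> R.
      by rewrite -ler_pdivlMl // mulr1.
    rewrite -[n.+1%:R in X in _ <= X]natr1; move: h2; move: (ln n.+1%:R) => u; nra.
  by rewrite divr_ge0 // addr_ge0 ?ln_nat_ge0.
have h2 : nc (\sum_(1 <= n < x.+1) chi n * rc n%:R^-1) <= Q * 1%:R^-1.
  apply: (@abel_bound (fun n => n%:R^-1)) => n; last by rewrite invr_ge0.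
  by move=> n0; rewrite lef_pV2 ?posrE ?ltr0n ?ler_nat.
by move: h1 h2; rewrite ln1 add0r divr1 invr1 !mulr1; lra.
Qed.

Definition Spart (x : nat) : C := \sum_(1 <= d < x.+1) chi d * rc (Lam R d / d%:R).

(** [ln] is the convolution of [Lam] with 1, so the sum in [sum_chi_ln] equals that of
    [chi d Lam d / d * Lpart (x / d)]. Replacing every [Lpart (x / d)] by [Lpart N] costs
    [Q psi(x) / x <= 4 Q]. *)
Lemma LS_bound (x N : nat) : (0 < x <= N)%N -> nc (Lpart N) * nc (Spart x) <= 6 * Q.
Proof.
move=> /andP[x0 xN]; have x0R := natR_gt0 R x0.
have E : \sum_(1 <= n < x.+1) chi n * rc (ln n%:R / n%:R) =
   \sum_(1 <= d < x.+1) chi d * rc (Lam R d / d%:R) * Lpart (x %/ d).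
  transitivity (\sum_(1 <= n < x.+1) \sum_(1 <= d < x.+1 | (d %| n)%N)
     chi d * rc (Lam R d / d%:R) * (chi (n %/ d)%N * rc (n %/ d)%:R^-1)).
    apply: eq_big_nat => n /andP[n0 nx].
    rewrite -(sum_Lam_dvd R n0) -(@sum_divisors_widen _ _ n x) ?n0 //.
    rewrite mulr_suml rc_sum mulr_sumr big_nat_cond [RHS]big_nat_cond.
    apply: eq_bigr => d /andP[/andP[d0 _] dn].
    rewrite -{1 2}(divnK dn) (qcM hchi) natrM invfM.
    by rewrite !rcM; ring.
  rewrite (sum_hyperbola (fun d m => chi d * rc (Lam R d / d%:R) * (chi m * rc m%:R^-1))).
  by apply: eq_bigr => d _; rewrite /Lpart mulr_sumr.
have h := sum_chi_ln x; rewrite E in h.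
have -> : nc (Lpart N) * nc (Spart x) = nc (Spart x * Lpart N) by rewrite ncM mulrC.
have -> : Spart x * Lpart N =
  \sum_(1 <= d < x.+1) chi d * rc (Lam R d / d%:R) * Lpart (x %/ d) -
  \sum_(1 <= d < x.+1) chi d * rc (Lam R d / d%:R) * (Lpart (x %/ d) - Lpart N).
  by rewrite -sumrB /Spart mulr_suml; apply: eq_bigr => d _; ring.
apply: le_trans (ncD _ _) _; rewrite ncN.
suff h2 : nc (\sum_(1 <= d < x.+1) chi d * rc (Lam R d / d%:R) * (Lpart (x %/ d) - Lpart N))
   <= 4 * Q by move: (lerD h h2); lra.
apply: le_trans (nc_sum _ _ _) _.
apply: (@le_trans _ _ (\sum_(1 <= d < x.+1) Q / x%:R * Lam R d)).
  apply: ler_sum_nat => d /andP[d0 dx]; rewrite !ncM nc_rc.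
  have d0R := natR_gt0 R d0; have L0 := Lam_ge0 R d.
  rewrite ger0_norm ?divr_ge0 //.
  have -> : Q / x%:R * Lam R d = 1 * (Lam R d / d%:R) * (Q * (d%:R / x%:R)).
    by field; rewrite !gt_eqF.
  apply: ler_pM; rewrite ?nc_ge0 ?mulr_ge0 ?nc_ge0 ?divr_ge0 ?invr_ge0 //.
    by rewrite ler_wpM2r ?divr_ge0 // (qc_le1 hchi).
  by apply: Lpart_diff_div; rewrite ?d0.
rewrite -mulr_sumr -/(psi R x).
rewrite -(ler_pM2l x0R) mulrA mulrCA mulfV ?gt_eqF // mulr1.
rewrite (_ : x%:R * (4 * Q) = Q * (4 * x%:R)); last by ring.
by rewrite ler_wpM2l // psi_le.
Qed.

(* Moebius inversion: [ln x + Spart x] is the sum of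
   [mu n chi n / n * ln (x / n) * Lpart (x / n)] over [n <= x]. *)
Lemma lnS_bound (x N : nat) : (0 < x <= N)%N ->
  nc (rc (ln x%:R) + Spart x) <=
    nc (Lpart N) * (ln x%:R * (1 + ln x%:R)) + Q.
Proof.
move=> /andP[x0 xN]; have x0R := natR_gt0 R x0.
set l := ln x%:R.
have ln0 n : (0 < n < x.+1)%N -> 0 <= l - ln n%:R.
  by move=> /andP[n0 nx]; rewrite subr_ge0 ler_ln_nat // n0.
have E : rc l + Spart x = \sum_(1 <= n < x.+1)
   chi n * rc (mu R n * (l - ln n%:R) / n%:R) * Lpart (x %/ n).
  transitivity (\sum_(1 <= k < x.+1) chi k * rc (((k == 1%N)%:R * l + Lam R k) / k%:R)).
    rewrite [RHS]big_ltn // eqxx mul1r divr1 (qc1 hchi) !mul1r rcD -addrA.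
    congr (_ + _); rewrite /Spart [LHS]big_ltn // (qc1 hchi) mul1r divr1; congr (_ + _).
    rewrite big_nat_cond [RHS]big_nat_cond; apply: eq_bigr => k /andP[/andP[k1 _] _].
    by rewrite gtn_eqF // mul0r add0r.
  transitivity (\sum_(1 <= k < x.+1) \sum_(1 <= n < x.+1 | (n %| k)%N)
     chi n * rc (mu R n * (l - ln n%:R) / n%:R) * (chi (k %/ n)%N * rc (k %/ n)%:R^-1)).
    apply: eq_big_nat => k /andP[k0 kx].
    rewrite -sum_mu_ln_sub // -(@sum_divisors_widen _ _ k x) ?k0 //.
    rewrite mulr_suml rc_sum mulr_sumr big_nat_cond [RHS]big_nat_cond.
    apply: eq_bigr => n /andP[/andP[n0 _] nk].
    rewrite -{1 2}(divnK nk) (qcM hchi) natrM invfM.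
    by rewrite !rcM; ring.
  rewrite (sum_hyperbola (fun n m => chi n * rc (mu R n * (l - ln n%:R) / n%:R)
     * (chi m * rc m%:R^-1))).
  by apply: eq_bigr => d _; rewrite /Lpart mulr_sumr.
have -> : rc l + Spart x =
  \sum_(1 <= n < x.+1) chi n * rc (mu R n * (l - ln n%:R) / n%:R) * Lpart N +
  \sum_(1 <= n < x.+1) chi n * rc (mu R n * (l - ln n%:R) / n%:R)
     * (Lpart (x %/ n) - Lpart N).
  by rewrite E -big_split; apply: eq_bigr => d _ /=; ring.
have cb n : (0 < n < x.+1)%N ->
  nc (chi n * rc (mu R n * (l - ln n%:R) / n%:R)) <= (l - ln n%:R) / n%:R.
  move=> hn; have n0 : (0 < n)%N by case/andP: hn.
  have n0R := natR_gt0 R n0; rewrite ncM nc_rc !normrM normfV (gtr0_norm n0R).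
  rewrite (ger0_norm (ln0 n hn)) -mulrA.
  have h : 0 <= (l - ln n%:R) / n%:R by rewrite divr_ge0 ?ln0 // ltW.
  have h1 := qc_le1 hchi n; have h2 := mu_norm R n; have h3 := nc_ge0 (chi n).
  move: (_ / _) h (`|_|) (normr_ge0 (mu R n)) h2 => v v0 m m0 m1.
  apply: le_trans (_ : 1 * (1 * v) <= _); last by rewrite !mul1r.
  by apply: ler_pM => //; rewrite ?mulr_ge0 // ler_wpM2r.
apply: le_trans (ncD _ _) _; apply: lerD.
  rewrite -mulr_suml ncM mulrC ler_wpM2l ?nc_ge0 //.
  apply: le_trans (nc_sum _ _ _) _.
  apply: (@le_trans _ _ (\sum_(1 <= n < x.+1) l * n%:R^-1)).
    apply: ler_sum_nat => n hn; apply: le_trans (cb n hn) _.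
    by rewrite ler_wpM2r ?invr_ge0 // gerBl ln_nat_ge0.
  rewrite -mulr_sumr -/(Hsum R x) ler_wpM2l ?ln_nat_ge0 //; exact: Hsum_le.
apply: le_trans (nc_sum _ _ _) _.
apply: (@le_trans _ _ (\sum_(1 <= n < x.+1) Q / x%:R * (l - ln n%:R))).
  apply: ler_sum_nat => n hn; have n0 : (0 < n)%N by case/andP: hn.
  have n0R := natR_gt0 R n0.
  have -> : Q / x%:R * (l - ln n%:R) = (l - ln n%:R) / n%:R * (Q * (n%:R / x%:R)).
    by field; rewrite !gt_eqF.
  rewrite [nc (_ * (_ - _))]ncM; apply: ler_pM; rewrite ?nc_ge0 //; first exact: cb.
  by apply: Lpart_diff_div => //; case/andP: hn => _ ?; rewrite n0.
rewrite -mulr_sumr big_split /= sumr_const_nat subn1 /= sumrN -ln_fact.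
have := ln_fact_ge R x; rewrite -/l => h.
rewrite -[l *+ x]mulr_natl mulrAC ler_pdivrMr // ler_wpM2l //; lra.
Qed.

End OneChar.
End Characters.

(** * Lower bounds for the partial sums of [chi n / n] *)

Section NonVanishing.
Variable R : realType.
Local Notation C := R[i].
Local Notation nc := (@nc R).
Local Notation rc := (@rc R).

Lemma nat_of_ln (a : R) : 0 <= a ->
  exists x : nat, [/\ (0 < x)%N, a <= ln x%:R & ln x%:R <= a + 1].
Proof.
move=> a0; have e0 : 0 <= expR a by rewrite expR_ge0.
have /andP[h1 h2] := truncn_itv e0.
exists (Num.truncn (expR a)).+1; split => //.
  rewrite -{1}(expRK a) ler_ln ?posrE ?expR_gt0 ?ltr0n //; exact: ltW.
have h3 : (Num.truncn (expR a)).+1%:R <= expR (a + 1).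
  rewrite expRD -natr1; have := expR_ge1Dx (1 : R); have := expR_ge1Dx a.
  nra.
by rewrite -[X in _ <= X]expRK ler_ln ?posrE ?expR_gt0 ?ltr0n.
Qed.

Section Complex.
Variables (chi : nat -> C) (Q : R).
Hypothesis h1 : quasichar chi Q.
Hypothesis h2 : quasichar (fun n => chi n ^+ 2) Q.

(** The pointwise inequality weighted by [Lam d / d]; the constant term 3 meets Mertens' bound for
    the sum over all [d]. *)
Lemma positivity_341 (x : nat) : (0 < x)%N ->
  0 <= 3 * (ln x%:R + 4) + 4 * complex.Re (Spart chi x) +
       complex.Re (Spart (fun n => chi n ^+ 2) x).
Proof.
move=> x0; have h := sum_Lam_over_le R x0.
have E : 0 <= 3 * \sum_(1 <= d < x.+1) Lam R d / d%:R + 4 * complex.Re (Spart chi x) +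
       complex.Re (Spart (fun n => chi n ^+ 2) x).
  rewrite /Spart !Re_sum !mulr_sumr -!big_split /=; apply: sumr_ge0 => d _.
  rewrite !Re_mul_rc; set t := Lam R d / d%:R.
  have t0 : 0 <= t by rewrite divr_ge0 ?Lam_ge0.
  have := nc_le1_341 (qc_le1 h1 d).
  move: (complex.Re _) (complex.Re _) => u v huv; have := mulr_ge0 huv t0; lra.
move: E h; move: (\sum_(1 <= d < x.+1) _) => v; lra.
Qed.

(** If [Lpart chi N] were tiny, [lnS_bound] would make the real part of [Spart chi] about [- ln t],
    and positivity would push that of [Spart (chi ^ 2)] up to a positive multiple of [ln t]. At the
    small scale [z] this keeps [Lpart (chi ^ 2) N] away from 0, by [lnS_bound] for [chi ^ 2]; then
    [LS_bound] bounds [Spart (chi ^ 2)] at the larger scale [x], a contradiction. *)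
Lemma L_lower_complex : exists N0 : nat, forall N, (N0 <= N)%N ->
  1 <= 16 * (302 * Q ^+ 2) * nc (Lpart chi N).
Proof.
have Q1 := qc_Q h1.
(* At [z], [lz >= 40 Q] dominates the errors, which total [17 Q]. At [x], [lx >= 300 Q ^ 2] suffices
   because [5/4 (3/4 * 300 - 16) > 252], where [252 = 42 * 6]. *)
have [|x [x0 xl xu]] := @nat_of_ln (300 * Q ^+ 2); first by rewrite mulr_ge0 ?sqr_ge0 ?ler0n.
have [|z [z0 zl zu]] := @nat_of_ln (40 * Q); first by lra.
exists (maxn x z) => N; rewrite geq_max => /andP[xN zN].
set eta := nc (Lpart chi N); set eta2 := nc (Lpart (fun n => chi n ^+ 2) N).
have e0 : 0 <= eta by exact: nc_ge0.
have e20 : 0 <= eta2 by exact: nc_ge0.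
have ReB (w : C) (r : R) : nc w <= r -> - r <= complex.Re w <= r.
  by move=> hw; rewrite -ler_norml; apply: le_trans (Re_nc w) hw.
have ReD (l : R) (w : C) : complex.Re (rc l + w) = l + complex.Re w by case: w.
have key t : (0 < t <= N)%N -> let l := ln t%:R in
    [/\ 0 <= l,
        l - 4 * (eta * (l * (1 + l))) - 16 * Q <= complex.Re (Spart (fun n => chi n ^+ 2) t),
        complex.Re (Spart (fun n => chi n ^+ 2) t) + l <= eta2 * (l * (1 + l)) + Q
      & eta2 * complex.Re (Spart (fun n => chi n ^+ 2) t) <= 6 * Q].
  move=> tN l; have t0 : (0 < t)%N by case/andP: tN.
  have f1 := ReB _ _ (lnS_bound h1 tN); have f2 := ReB _ _ (lnS_bound h2 tN).
  have f3 := LS_bound h2 tN; have f4 := positivity_341 t0.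
  rewrite !ReD -/l -/eta -/eta2 in f1 f2 f3 f4.
  have l0 : 0 <= l by rewrite ln_nat_ge0.
  split=> //.
  - by move: f1 f4 => /andP[_]; move: (eta * _) => u; lra.
  - by move: f2 => /andP[_]; lra.
  apply: le_trans f3; rewrite ler_wpM2l //.
  by apply: le_trans (Re_nc _); rewrite ler_norm.
have [|lx0 a1 _ a3] := key x; first by rewrite x0.
have [|lz0 b1 b2 _] := key z; first by rewrite z0.
set lx := ln x%:R in xl xu lx0 a1 a3; set lz := ln z%:R in zl zu lz0 b1 b2.
case: (leP (eta * (1 + lx)) (1 / 16)) => he; last first.
  have : eta * (1 + lx) <= eta * (302 * Q ^+ 2).
    rewrite ler_wpM2l //; have : 1 <= Q ^+ 2 by rewrite exprn_ege1.
    lra.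
  rewrite -[X in 1 <= X]mulrA [_ * eta]mulrC.
  by move: he; move: (eta * (1 + lx)) (eta * _) => u v; lra.
exfalso.
have Q2 : Q <= Q ^+ 2 by rewrite expr2 ler_peMl //; lra.
have lzx : lz <= lx by lra.
have hz : eta * (lz * (1 + lz)) <= lz / 16.
  rewrite mulrCA ler_wpM2l // -[_^-1]mul1r; apply: le_trans he.
  by rewrite ler_wpM2l // lerD2l.
have hx : eta * (lx * (1 + lx)) <= lx / 16.
  by rewrite mulrCA ler_wpM2l // -[_^-1]mul1r.
set rx := complex.Re _ in a1 a3; set rz := complex.Re _ in b1 b2.
have c1 : (5 / 4) * lz <= lz * (eta2 * (1 + lz)).
  by rewrite [X in _ <= X]mulrCA; move: b1 b2 hz; move: (eta * _) (eta2 * _) => u v; lra.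
have lzp : 0 < lz by lra.
have c2 : 5 / 4 <= eta2 * (42 * Q).
  apply: (@le_trans _ _ (eta2 * (1 + lz))); last by rewrite ler_wpM2l //; lra.
  by rewrite -(ler_pM2l lzp) [lz * (5 / 4)]mulrC.
have c3 : 3 / 4 * lx - 16 * Q <= rx by move: a1 hx; move: (eta * _) => u; lra.
have c4 : 0 <= 3 / 4 * lx - 16 * Q by lra.
have c5 : eta2 * (3 / 4 * lx - 16 * Q) <= 6 * Q.
  by apply: le_trans a3; rewrite ler_wpM2l.
have c6 : (5 / 4) * (3 / 4 * lx - 16 * Q) <= 42 * Q * (6 * Q).
  apply: (@le_trans _ _ (eta2 * (42 * Q) * (3 / 4 * lx - 16 * Q))).
    by rewrite ler_wpM2r.
  rewrite (_ : _ * _ = 42 * Q * (eta2 * (3 / 4 * lx - 16 * Q))); last by ring.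
  by rewrite ler_wpM2l //; lra.
have c7 : 42 * Q * (6 * Q) = 252 * Q ^+ 2 by ring.
move: c6; rewrite c7; move: (Q ^+ 2) Q2 xl => q2; lra.
Qed.

End Complex.

Section Real.
Variables (c : nat -> R) (Q : R).
Hypothesis hc : quasichar (fun n => rc (c n)) Q.
Hypothesis c_val : forall n, [\/ c n = -1, c n = 0 | c n = 1].

Let cM m n : c (m * n)%N = c m * c n.
Proof. by have := qcM hc m n; rewrite -rcM => -[]. Qed.
Let c1 : c 1%N = 1. Proof. by have := qc1 hc => -[]. Qed.

Lemma abel_bound_real (f : nat -> R) (a b : nat) :
  (forall n, (a <= n)%N -> f n.+1 <= f n) -> (forall n, 0 <= f n) ->
  `|\sum_(a <= n < b) c n * f n| <= Q * f a.
Proof.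
move=> fd f0; have := @abel_bound R _ Q hc f a b fd f0.
rewrite (eq_bigr (fun n => rc (c n * f n))) => [|n _]; last by rewrite rcM.
by rewrite -rc_sum nc_rc.
Qed.

Definition rconv (n : nat) : R := \sum_(1 <= d < n.+1 | (d %| n)%N) c d.

(** Divisors divisible by [p] are [p] times a divisor of [p ^ a * m]; the remaining ones are the
    divisors of [m]. *)
Lemma rconv_prime (p a m : nat) : prime p -> (0 < m)%N -> ~~ (p %| m)%N ->
  rconv (p ^ a.+1 * m) = c p * rconv (p ^ a * m) + rconv m.
Proof.
move=> pp m0 pm; have p0 := prime_gt0 pp.
set n := (p ^ a.+1 * m)%N; have n0 : (0 < n)%N by rewrite muln_gt0 expn_gt0 p0.
have np : n = (p * (p ^ a * m))%N by rewrite /n expnS mulnA.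
have k0 : (0 < p ^ a * m)%N by rewrite muln_gt0 expn_gt0 p0.
rewrite {1}/rconv (bigID (fun d => (p %| d)%N)) /=; congr (_ + _).
  under eq_bigl => d do rewrite andbC.
  rewrite big_mkcondr /= sum_multiples // /rconv mulr_sumr np mulKn //.
  rewrite [RHS]big_mkcond; apply: eq_bigr => e _.
  by rewrite dvdn_pmul2l // cM.
have E d : (d %| n)%N && ~~ (p %| d)%N = (d %| m)%N.
  apply/andP/idP => [[dn pd]|dm]; last first.
    by split; [rewrite dvdn_mull | apply: contra pm => h; apply: dvdn_trans dm].
  by move: dn; rewrite Gauss_dvdr // coprime_sym coprimeXl // prime_coprime.
rewrite (eq_bigl _ _ E) (@sum_divisors_widen _ c m n) // m0 dvdn_leq //.
by rewrite dvdn_mull.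
Qed.

(** Multiplicativity, by splitting off the full power of one prime: its factor is the sum of
    [c p ^ i] for [i] up to the exponent. *)
Lemma rconv_ge (n : nat) : (0 < n)%N ->
  0 <= rconv n /\ (forall s, n = (s ^ 2)%N -> 1 <= rconv n).
Proof.
elim/ltn_ind: n => n IH n0; case: (eqVneq n 1%N) => [->|n1].
  by rewrite /rconv big_mkcond big_nat1 /= c1; split => //; rewrite ler01.
have n2 : (1 < n)%N by lia.
pose p := pdiv n; have pp : prime p by exact: pdiv_prime.
have p1 := prime_gt1 pp; have pn : (p %| n)%N by exact: pdiv_dvd.
have [m pm e] := pfactor_coprime pp n0; set a := logn p n in e.
have a0 : (0 < a)%N by rewrite /a logn_gt0 mem_primes pp n0.
have m0 : (0 < m)%N by case: m {pm} e => // e; rewrite e in n0.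
have pm' : ~~ (p %| m)%N by rewrite -prime_coprime.
have mn : (m < n)%N.
  by rewrite e -{1}[m]muln1 ltn_pmul2l // -[1%N](expn0 p) ltn_exp2l.
have [r0 rs] := IH m mn m0.
have e' : n = (p ^ a * m)%N by rewrite mulnC.
(* The local factor [g] at exponent [k]. When [c p = -1] it alternates between 1 and 0, so the
   parity has to be carried through the induction. *)
have G k : exists g : R, [/\ rconv (p ^ k * m) = g * rconv m, 0 <= g,
     ~~ odd k -> 1 <= g & (c p = -1 -> odd k -> g = 0) /\ (c p = -1 -> ~~ odd k -> g = 1)].
  elim: k => [|k [g [eg g0 g1 [ge go]]]].
    by exists 1; rewrite expn0 mul1n mul1r.
  exists (c p * g + 1); rewrite rconv_prime // eg; split; first by ring.
  - case: (c_val p) => hp; rewrite hp; [|lra|lra].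
    by case: (boolP (odd k)) => ok; [rewrite ge // | rewrite go //]; lra.
  - rewrite /= negbK => ok; case: (c_val p) => hp; rewrite hp; [|lra|lra].
    by rewrite ge //; lra.
  split=> hp /= ok; rewrite hp; first by rewrite go //; lra.
  by rewrite (ge hp (negbNE ok)); lra.
have [g [eg g0 g1 _]] := G a.
rewrite e' eg; split; first by rewrite mulr_ge0.
move=> s hs; have s0 : (0 < s)%N.
  by case: s hs => // hs; move: n0; rewrite e' hs.
have [s' ps' es] := pfactor_coprime pp s0; set b := logn p s in es.
have ab : a = (b * 2)%N by rewrite /a e' hs lognX mulnC.
have ms : m = (s' ^ 2)%N.
  apply/eqP; rewrite -(eqn_pmul2l (_ : 0 < p ^ a)%N) ?expn_gt0 ?prime_gt0 //.
  by rewrite hs {1}es expnMn -expnM -ab mulnC.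
have gg := g1 _; have {}gg : 1 <= g by apply: g1; rewrite ab oddM andbF.
have := rs _ ms; nra.
Qed.

Definition Asqrt (t : nat) : R := \sum_(1 <= e < t.+1) (Num.sqrt e%:R)^-1.
(** Decreasing in [t] and within [1 / sqrt t] of all its later values: a finite stand-in for
    zeta(1/2). *)
Definition Dsqrt (t : nat) : R := Asqrt t - 2 * Num.sqrt t%:R.

Lemma sqrt_nat_gt0 (t : nat) : (0 < t)%N -> 0 < Num.sqrt t%:R :> R.
Proof. by move=> t0; rewrite sqrtr_gt0 ltr0n. Qed.

Lemma Dsqrt_step (t : nat) : (0 < t)%N ->
  Dsqrt t.+1 <= Dsqrt t /\
  Dsqrt t + (Num.sqrt t.+1%:R)^-1 - (Num.sqrt t%:R)^-1 <= Dsqrt t.+1.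
Proof.
move=> t0; rewrite /Dsqrt /Asqrt big_nat_recr //=.
have s0 := sqrt_nat_gt0 t0; have s0' := sqrt_nat_gt0 (ltn0Sn t).
have e : Num.sqrt t.+1%:R ^+ 2 = Num.sqrt t%:R ^+ 2 + 1 :> R.
  by rewrite !sqr_sqrtr ?ler0n // natr1.
move: (Num.sqrt t%:R) (Num.sqrt t.+1%:R) s0 s0' e => s s' s0 s0' e.
have ss : s <= s' by nra.
have i1 : 2 * (s' - s) = 2 / (s' + s).
  have h : (s' - s) * (s' + s) = 1 by nra.
  have n0 : s' + s != 0 by rewrite gt_eqF // addr_gt0.
  by apply: (mulIf n0); rewrite divfK // -mulrA h mulr1.
have i2 : s'^-1 <= 2 / (s' + s).
  by rewrite -[s'^-1]mul1r ler_pdivrMr // mulrAC ler_pdivlMr ?addr_gt0 //; lra.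
have i3 : 2 / (s' + s) <= s^-1.
  by rewrite -[s^-1]mul1r ler_pdivrMr ?addr_gt0 // mulrAC ler_pdivlMr //; lra.
split; move: i1 i2 i3; move: (_^-1) (_^-1) (_ / _) => u v w; lra.
Qed.

Lemma Dsqrt_diff (t T : nat) : (0 < t <= T)%N ->
  Dsqrt T <= Dsqrt t /\ Dsqrt t - (Num.sqrt t%:R)^-1 <= Dsqrt T.
Proof.
move=> /andP[t0]; rewrite leq_eqVlt => /orP[/eqP <-|tT].
  by split => //; rewrite gerBl invr_ge0 sqrtr_ge0.
suff [h1 h2] : Dsqrt T <= Dsqrt t /\
  Dsqrt t + (Num.sqrt T%:R)^-1 - (Num.sqrt t%:R)^-1 <= Dsqrt T.
  split=> //; apply: le_trans h2; have : 0 <= (Num.sqrt T%:R)^-1 :> R.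
    by rewrite invr_ge0 sqrtr_ge0.
  by move: (_^-1) (_^-1) => u v; lra.
elim: T tT => // T IH; rewrite ltnS leq_eqVlt => /orP[/eqP <-|tT].
  exact: Dsqrt_step.
have [h1 h2] := IH tT; have [g1 g2] := @Dsqrt_step T (ltn_trans t0 tT).
split; first exact: le_trans h1.
by move: h2 g2; move: (_^-1) (_^-1) (_^-1) => u v w; lra.
Qed.

Lemma Asqrt_le (t : nat) : Asqrt t <= 2 * Num.sqrt t%:R.
Proof.
case: t => [|t]; first by rewrite /Asqrt big_geq // mulr_ge0 ?sqrtr_ge0.
have [|h _] := @Dsqrt_diff 1 t.+1 _ => //.
move: h; rewrite /Dsqrt {2}/Asqrt big_nat1 sqrtr1 invr1; lra.
Qed.

(** What matters is that [Dsqrt (X ^ 2)] does not depend on [d]: summed against [c d / sqrt d] it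
    multiplies a bounded character sum. Its replacement of [Dsqrt (X ^ 2 %/ d)] costs one
    [sqrt d / X] up to a constant, as does the floor. *)
Lemma Asqrt_approx (X d : nat) : (0 < d <= X)%N ->
  `|Asqrt (X ^ 2 %/ d) - 2 * (X%:R / Num.sqrt d%:R) - Dsqrt (X ^ 2)| <=
  2 * (Num.sqrt d%:R / X%:R).
Proof.
move=> /andP[d0 dX]; have X0 : (0 < X)%N by exact: leq_trans dX.
set t := (X ^ 2 %/ d)%N.
have t0 : (0 < t)%N by rewrite divn_gt0 // expnS expn1; nia.
have tX : (t <= X ^ 2)%N by exact: leq_div.
have [|g1 g2] := @Dsqrt_diff t (X ^ 2); first by rewrite t0.
have X0R := natR_gt0 R X0; have sd := sqrt_nat_gt0 d0; have st := sqrt_nat_gt0 t0.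
set u := X%:R / Num.sqrt d%:R; have u0 : 0 < u by rewrite divr_gt0.
have uu : u ^+ 2 * d%:R = X%:R ^+ 2.
  by rewrite /u expr_div_n sqr_sqrtr ?ler0n // divfK // gt_eqF // ltr0n.
have d0R := natR_gt0 R d0.
have tt : Num.sqrt t%:R ^+ 2 = t%:R :> R by rewrite sqr_sqrtr ?ler0n.
have b1 : t%:R <= u ^+ 2.
  by rewrite -(ler_pM2r d0R) uu -natrX -natrM ler_nat leq_trunc_div.
have b2 : u ^+ 2 <= t%:R + 1.
  by rewrite -(ler_pM2r d0R) uu natr1 -natrX -natrM ler_nat ltnW // ltn_ceil.
have b3 : 1 <= t%:R :> R by rewrite ler1n.
have -> : Num.sqrt d%:R / X%:R = u^-1 by rewrite /u invf_div.
rewrite /Dsqrt in g1 g2 *.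
move: (Num.sqrt t%:R) tt st g1 g2 => s ss s0 g1 g2.
rewrite -ss in b1 b2 b3.
have su : s <= u by nra.
have k1 : u - s <= u^-1.
  rewrite -[X in _ <= X]mul1r ler_pdivlMr //; nra.
have k2 : s^-1 <= 2 * u^-1.
  by rewrite -[s^-1]mul1r ler_pdivrMr // mulrAC ler_pdivlMr //; nra.
rewrite ler_norml; move: k1 k2 g1 g2; move: (u^-1) (s^-1) (Asqrt t) => a b A.
move: (Asqrt (X ^ 2)) (Num.sqrt _) => B v *; apply/andP; split; lra.
Qed.

(** Two evaluations of the sum of [rconv n / sqrt n] up to [X ^ 2]: the squares alone give [ln X],
    and the hyperbola method cut at [d = X] gives [2 X] times the partial sum up to [X], plus
    [4 Q + 2]. Passing from [X] to [N] costs another [2 Q], and [6 Q + 2 <= 8 Q]. *)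
Lemma L_lower_real (N X : nat) : (0 < X <= N)%N ->
  ln X%:R <= 2 * X%:R * \sum_(1 <= n < N.+1) c n / n%:R + 8 * Q.
Proof.
move=> /andP[X0 XN]; have X0R := natR_gt0 R X0.
have Q1 := qc_Q hc; have Q0 : 0 <= Q by lra.
have mono a n : (0 < a)%N -> (a <= n)%N ->
   (Num.sqrt n.+1%:R)^-1 <= (Num.sqrt n%:R)^-1 :> R.
  move=> a0 an; have n0 : (0 < n)%N by exact: leq_trans an.
  by rewrite lef_pV2 ?posrE ?sqrt_nat_gt0 // ler_sqrt ?ltr0n // ler_nat.
have pos n : 0 <= (Num.sqrt n%:R)^-1 :> R by rewrite invr_ge0 sqrtr_ge0.
pose W := \sum_(1 <= n < (X ^ 2).+1) rconv n / Num.sqrt n%:R.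
have W1 : ln X%:R <= W.
  (* Only squares are kept: [n = m ^ 2] contributes at least [1 / m]. *)
  apply: (@le_trans _ _ (Hsum R X)).
    by apply: le_trans (Hsum_ge R X); rewrite ler_ln_nat // X0 leqnSn.
  apply: (@le_trans _ _ (\sum_(1 <= n < (X ^ 2).+1) \sum_(1 <= m < X.+1)
     if n == (m ^ 2)%N then m%:R^-1 else 0)).
    rewrite exchange_big_nat /=; apply: ler_sum_nat => m /andP[m0 mX].
    rewrite (big_rem (m ^ 2)%N) /=; last first.
      rewrite mem_index_iota expn_gt0 m0 /= ltnS leq_exp2r //.
    by rewrite eqxx lerDl; apply: sumr_ge0 => i _; case: ifP.
  apply: ler_sum_nat => n /andP[n0 nX].
  have [r0 r1] := rconv_ge n0.
  case: (boolP (has (fun m => n == (m ^ 2)%N) (index_iota 1 X.+1))) => h.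
    have /hasP[m mi /eqP em] := h.
    rewrite (big_rem m) //= -em eqxx big_seq big1 ?addr0.
      rewrite em natrX sqrtr_sqr normr_nat ler_peMl ?invr_ge0 //.
      by rewrite -em; apply: r1 em.
    move=> i; rewrite mem_rem_uniq ?iota_uniq // inE => /andP[im _].
    case: eqP => // ei; move: im; have : (m ^ 2 == i ^ 2)%N by rewrite -em ei.
    by rewrite eqn_exp2r // => /eqP ->; rewrite eqxx.
  rewrite big_seq big1; first by rewrite divr_ge0 ?sqrtr_ge0.
  move=> i hi; case: eqP => // ei; case/negP: h; apply/hasP; exists i => //.
  by apply/eqP.
have W2 : W = \sum_(1 <= d < (X ^ 2).+1) \sum_(1 <= e < (X ^ 2 %/ d).+1)
    c d / Num.sqrt d%:R * (Num.sqrt e%:R)^-1.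
  rewrite -(sum_hyperbola (fun d e => c d / Num.sqrt d%:R * (Num.sqrt e%:R)^-1)).
  apply: eq_big_nat => n /andP[n0 nX]; rewrite /rconv.
  rewrite -(@sum_divisors_widen _ _ n (X ^ 2)) ?n0 // mulr_suml.
  rewrite big_nat_cond [RHS]big_nat_cond; apply: eq_bigr => d /andP[/andP[d0 _] dn].
  by rewrite -{1}(divnK dn) natrM sqrtrM ?ler0n // invfM; ring.
have XX : (X <= X ^ 2)%N by rewrite expnS expn1 leq_pmull.
rewrite (big_cat_nat _ (n := X.+1)) //= in W2.
set P1 := \sum_(1 <= d < X.+1) _ in W2; set P2 := \sum_(X.+1 <= d < _) _ in W2.
have hP2 : P2 <= 2 * Q.
  (* Summing over [d] first: for fixed [e] it runs through an interval starting above [X], empty if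
     [e > X], where Abel summation gives [Q / sqrt X]. Summing [1 / sqrt e] up to [X] then restores
     [2 sqrt X]. *)
  have E : P2 = \sum_(1 <= e < (X ^ 2).+1) \sum_(X.+1 <= d < (X ^ 2).+1)
      if (d * e <= X ^ 2)%N then c d / Num.sqrt d%:R * (Num.sqrt e%:R)^-1 else 0.
    rewrite exchange_big_nat /=; apply: eq_big_nat => d /andP[Xd dX].
    have d0 : (0 < d)%N by exact: leq_trans Xd.
    rewrite [RHS](big_cat_nat _ (n := (X ^ 2 %/ d).+1)) //=; last by rewrite ltnS leq_div.
    rewrite [X in _ = _ + X]big_nat_cond [X in _ = _ + X]big1 ?addr0; last first.
      move=> e /andP[/andP[he _] _]; case: ifP => //; rewrite mulnC -leq_divRL //.
      by rewrite leqNgt he.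
    by apply: eq_big_nat => e /andP[_ he]; rewrite mulnC -leq_divRL // -ltnS he.
  have B e : (0 < e)%N -> \sum_(X.+1 <= d < (X ^ 2).+1)
      (if (d * e <= X ^ 2)%N then c d / Num.sqrt d%:R * (Num.sqrt e%:R)^-1 else 0) <=
      (if (e <= X)%N then Q / Num.sqrt X%:R * (Num.sqrt e%:R)^-1 else 0).
    move=> e0; case: (leqP e X) => eX; last first.
      rewrite big_nat_cond big1 // => d /andP[/andP[Xd _] _].
      by rewrite ifF //; apply/negbTE; rewrite -ltnNge expnS expn1; nia.
    have XeX : (X <= X ^ 2 %/ e)%N by rewrite leq_divRL // expnS expn1 leq_mul2l eX orbT.
    rewrite (big_cat_nat _ (n := (X ^ 2 %/ e).+1)) //=; last by rewrite ltnS leq_div.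
    rewrite [X in _ + X]big_nat_cond [X in _ + X]big1 ?addr0; last first.
      move=> d /andP[/andP[he _] _]; case: ifP => //; rewrite -leq_divRL //.
      by rewrite leqNgt he.
    rewrite (eq_big_nat _ _ (F2 := fun d => c d * (Num.sqrt d%:R)^-1 * (Num.sqrt e%:R)^-1)).
      rewrite -mulr_suml ler_wpM2r //; apply: le_trans (ler_norm _) _.
      apply: le_trans (@abel_bound_real (fun n => (Num.sqrt n%:R)^-1) X.+1 _ _ _) _.
      - by move=> n Xn; apply: (mono X.+1).
      - by move=> n; exact: pos.
      by rewrite ler_wpM2l // (mono X).
    by move=> d /andP[_ he]; rewrite -leq_divRL // -ltnS he.
  rewrite E; apply: le_trans (ler_sum_nat _ (G := fun e =>
     if (e <= X)%N then Q / Num.sqrt X%:R * (Num.sqrt e%:R)^-1 else 0)) _.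
    by move=> e /andP[e0 _]; exact: B.
  rewrite (big_cat_nat _ (n := X.+1)) //=.
  rewrite [X in _ + X]big_nat_cond [X in _ + X]big1 ?addr0; last first.
    by move=> e /andP[/andP[he _] _]; rewrite leqNgt he.
  rewrite (eq_big_nat _ _ (F2 := fun e => Q / Num.sqrt X%:R * (Num.sqrt e%:R)^-1)).
    rewrite -mulr_sumr -/(Asqrt X).
    have sX := sqrt_nat_gt0 X0.
    rewrite mulrAC ler_pdivrMr // [2 * Q]mulrC -mulrA ler_wpM2l //; exact: Asqrt_le.
  by move=> e /andP[_ he]; rewrite -ltnS he.
pose LX := \sum_(1 <= n < X.+1) c n / n%:R.
have hP1 : P1 <= 2 * X%:R * LX + 2 * Q + 2.
  (* Main term, a constant between -2 and -1 times a sum bounded by [Q], and [X] error terms of size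
     at most [2 / X]. *)
  have E : P1 = 2 * X%:R * LX + Dsqrt (X ^ 2) * \sum_(1 <= d < X.+1) c d * (Num.sqrt d%:R)^-1
     + \sum_(1 <= d < X.+1) c d / Num.sqrt d%:R *
        (Asqrt (X ^ 2 %/ d) - 2 * (X%:R / Num.sqrt d%:R) - Dsqrt (X ^ 2)).
    rewrite /LX !mulr_sumr -!big_split /=; apply: eq_big_nat => d /andP[d0 _].
    rewrite -mulr_sumr -/(Asqrt _); have sd := sqrt_nat_gt0 d0.
    have dd : d%:R = Num.sqrt d%:R ^+ 2 :> R by rewrite sqr_sqrtr ?ler0n.
    rewrite [in c d / d%:R]dd; field; rewrite gt_eqF //.
  have [|g1 g2] := @Dsqrt_diff 1 (X ^ 2); first by rewrite expn_gt0 X0.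
  have D1 : Dsqrt 1 = - 1 by rewrite /Dsqrt /Asqrt big_nat1 sqrtr1 invr1; lra.
  rewrite D1 sqrtr1 invr1 in g1 g2.
  have a1 : `|\sum_(1 <= d < X.+1) c d * (Num.sqrt d%:R)^-1| <= Q.
    apply: le_trans (@abel_bound_real (fun n => (Num.sqrt n%:R)^-1) 1 _ _ _) _.
    - by move=> n Xn; apply: (mono 1%N).
    - by move=> n; exact: pos.
    by rewrite sqrtr1 invr1 mulr1.
  have a2 : `|\sum_(1 <= d < X.+1) c d / Num.sqrt d%:R *
        (Asqrt (X ^ 2 %/ d) - 2 * (X%:R / Num.sqrt d%:R) - Dsqrt (X ^ 2))| <= 2.
    apply: le_trans (ler_norm_sum _ _ _) _.
    apply: (@le_trans _ _ (\sum_(1 <= d < X.+1) 2 / X%:R)).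
      apply: ler_sum_nat => d /andP[d0 dX]; have sd := sqrt_nat_gt0 d0.
      rewrite normrM normrM normfV (gtr0_norm sd).
      have -> : 2 / X%:R = (1 / Num.sqrt d%:R) * (2 * (Num.sqrt d%:R / X%:R)) :> R.
        by field; rewrite !gt_eqF.
      apply: ler_pM; rewrite ?normr_ge0 ?mulr_ge0 //.
        by rewrite ler_wpM2r //; case: (c_val d) => ->; rewrite ?normrN1 ?normr0 ?normr1.
      by apply: Asqrt_approx; rewrite d0.
    by rewrite sumr_const_nat subn1 /= -[leLHS]mulr_natr divfK // gt_eqF.
  rewrite E -!addrA lerD2l; apply: lerD; last by apply: le_trans (ler_norm _) a2.
  apply: le_trans (ler_norm _) _; rewrite normrM ler_pM ?normr_ge0 //.
  by rewrite ler_norml; apply/andP; split; lra.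
have hL : LX <= \sum_(1 <= n < N.+1) c n / n%:R + Q / X%:R.
  rewrite [X in _ <= X + _](big_cat_nat _ (n := X.+1)) //= -addrA lerDl.
  have := @abel_bound_real (fun n => n%:R^-1) X.+1 N.+1.
  have h1 : forall n, (X < n)%N -> n.+1%:R^-1 <= n%:R^-1 :> R.
    by move=> n Xn; rewrite lef_pV2 ?posrE ?ltr0n ?ler_nat //; lia.
  move=> /(_ h1 (fun n => _)) h; have {}h := h (fun n => eqbRL (invr_ge0 _) (ler0n _ _)).
  have h2 : Q * X.+1%:R^-1 <= Q * X%:R^-1.
    by rewrite ler_wpM2l // lef_pV2 ?posrE ?ltr0n // ler_nat.
  move: h; rewrite ler_norml => /andP[h _].
  by move: h h2; move: (_ * _^-1) (_ / _) (\sum_(_ <= _ < _) _) => u v w; lra.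
have hL2 : 2 * X%:R * LX <= 2 * X%:R * \sum_(1 <= n < N.+1) c n / n%:R + 2 * Q.
  apply: le_trans (ler_wpM2l _ hL) _; first by rewrite mulr_ge0 // ltW.
  rewrite mulrDr lerD2l le_eqVlt; apply/orP; left; apply/eqP; field.
  by rewrite gt_eqF.
by move: W1; rewrite W2; move: hP1 hP2 hL2; move: (2 * _ * _) (2 * _ * _) => u v; lra.
Qed.

End Real.
End NonVanishing.

(** * Characters modulo a prime and Dirichlet's theorem with explicit error *)

Section DirichletCharacters.
Variables (R : realType) (q : nat).
Hypothesis q_prime : prime q.
Local Notation C := R[i].
Local Notation nc := (@nc R).
Local Notation rc := (@rc R).

Lemma Fp_prim_root : exists z : 'F_q, q.-1.-primitive_root z.
Proof.
have q1 : (0 < q.-1)%N by have := prime_gt1 q_prime; lia.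
pose rs := [seq x <- enum 'F_q | x != 0].
have /hasP[z _ hz] : has q.-1.-primitive_root rs; last by exists z.
apply: has_prim_root => //.
- apply/allP => x; rewrite mem_filter => /andP[x0 _]; apply/unity_rootP.
  apply: (mulfI x0); rewrite mulr1 -exprS prednK ?prime_gt0 //.
  by rewrite -{2}(expf_card x) card_Fp.
- by rewrite filter_uniq // enum_uniq.
rewrite size_filter; have := count_predC (fun x : 'F_q => x != 0) (enum 'F_q).
rewrite -cardE card_Fp // (_ : count (predC _) _ = 1%N); last first.
  rewrite (eq_count (a2 := pred1 0)); last by move=> x; rewrite /= negbK.
  by rewrite count_uniq_mem ?enum_uniq // mem_enum.
by move=> /(congr1 predn); rewrite addn1 /= => <-.
Qed.

Lemma C_prim_root (n : nat) : (0 < n)%N -> exists w : C, n.-primitive_root w.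
Proof.
move=> n0; have [r er] := closed_field_poly_normal ('X^n - 1 : {poly C}).
have mon : lead_coef ('X^n - 1 : {poly C}) = 1 by apply/monicP; exact: monicXnsubC.
rewrite mon scale1r in er.
have /hasP[w _ hw] : has n.-primitive_root r; last by exists w.
apply: has_prim_root => //.
- by apply/allP => w wr; rewrite /root_of_unity er root_prod_XsubC.
- rewrite -separable_prod_XsubC -er separable_Xn_sub_1 //.
  by rewrite pnatr_eq0 -lt0n.
by rewrite -ltnS -(size_prod_XsubC r id) -er size_XnsubC.
Qed.

Definition zgen : 'F_q := xchoose Fp_prim_root.
Lemma zgen_prim : q.-1.-primitive_root zgen. Proof. exact: xchooseP. Qed.

Lemma q1_gt0 : (0 < q.-1)%N. Proof. by have := prime_gt1 q_prime; lia. Qed.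

Definition wgen : C := xchoose (C_prim_root q1_gt0).
Lemma wgen_prim : q.-1.-primitive_root wgen. Proof. exact: xchooseP. Qed.

Lemma zgen_neq0 : zgen != 0.
Proof.
apply/eqP => h; have := prim_expr_order zgen_prim.
by rewrite h expr0n gtn_eqF ?q1_gt0 // => /eqP; rewrite eq_sym oner_eq0.
Qed.

Lemma zgen_log (x : 'F_q) : x != 0 -> exists k : nat, x = zgen ^+ k.
Proof.
move=> x0; have [|i ->] := prim_rootP zgen_prim (x := x); last by exists i.
apply: (mulfI x0); rewrite mulr1 -exprS prednK ?prime_gt0 //.
by rewrite -{2}(expf_card x) card_Fp.
Qed.

Definition dlog (x : 'F_q) : nat :=
  if pselect (exists k : nat, x = zgen ^+ k) is left h then projT1 (cid h) else 0%N.

Lemma dlogK (x : 'F_q) : x != 0 -> zgen ^+ dlog x = x.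
Proof.
move=> /zgen_log h; rewrite /dlog; case: pselect => // h'.
by case: (cid h').
Qed.

Definition chiF (j : nat) (x : 'F_q) : C :=
  if x == 0 then 0 else wgen ^+ (j * dlog x).

(** The chosen logarithm is determined only modulo [q - 1], which is also the order of [wgen]; hence
    any exponent may be used. *)
Lemma chiF_log (j k : nat) : chiF j (zgen ^+ k) = wgen ^+ (j * k).
Proof.
have x0 : zgen ^+ k != 0 by rewrite expf_neq0 // zgen_neq0.
rewrite /chiF (negbTE x0); apply/eqP; rewrite (eq_prim_root_expr wgen_prim).
have := dlogK x0; move/eqP; rewrite (eq_prim_root_expr zgen_prim) => /eqP h.
by rewrite -modnMmr h modnMmr.
Qed.

Definition chi (j n : nat) : C := chiF j n%:R.

Lemma chiF1 j : chiF j 1 = 1.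
Proof. by rewrite -(expr0 zgen) chiF_log muln0 expr0. Qed.

Lemma chiFM j x y : chiF j (x * y) = chiF j x * chiF j y.
Proof.
case: (eqVneq x 0) => [->|x0]; first by rewrite mul0r /chiF eqxx mul0r.
case: (eqVneq y 0) => [->|y0]; first by rewrite mulr0 /chiF eqxx mulr0.
by rewrite -(dlogK x0) -(dlogK y0) -exprD !chiF_log mulnDr exprD.
Qed.

Lemma ncX (w : C) k : nc (w ^+ k) = nc w ^+ k.
Proof. by elim: k => [|k IH]; rewrite ?expr0 ?nc1 // !exprS ncM IH. Qed.

Lemma nc_wgen : nc wgen = 1.
Proof.
have := prim_expr_order wgen_prim => /(congr1 nc); rewrite nc1 ncX => /eqP.
by rewrite pexpr_eq1 ?nc_ge0 ?q1_gt0 // => /eqP.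
Qed.

Lemma chi_le1 j n : nc (chi j n) <= 1.
Proof.
rewrite /chi /chiF; case: ifP => _; first by rewrite nc0 ler01.
by rewrite ncX nc_wgen expr1n.
Qed.

Lemma natF0 n : (n%:R == 0 :> 'F_q) = (q %| n)%N.
Proof. by rewrite (dvdn_pcharf (pchar_Fp q_prime)). Qed.

Lemma chi_period j n : chi j (n + q) = chi j n.
Proof.
rewrite /chi natrD; suff -> : q%:R = 0 :> 'F_q by rewrite addr0.
by apply/eqP; rewrite natF0.
Qed.

(** Over a complete residue system, multiplication by the generator permutes the terms and scales
    the sum by [wgen ^ j], which differs from 1. Periodicity moves the window. *)
Lemma chi_full j a : ~~ (q.-1 %| j)%N -> \sum_(a <= n < a + q) chi j n = 0.
Proof.
move=> hj.
have base : \sum_(0 <= n < q) chi j n = 0.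
  have -> : \sum_(0 <= n < q) chi j n = \sum_(x : 'F_q) chiF j x.
    rewrite -{1}(Fp_cast q_prime) big_mkord; apply: eq_bigr => i _.
    by rewrite /chi natr_Zp.
  set T := \sum_(x : 'F_q) _.
  have h : T = wgen ^+ j * T.
    rewrite {1}/T (reindex_inj (mulfI zgen_neq0)) /= /T mulr_sumr.
    by apply: eq_bigr => x _; rewrite chiFM -{1}(expr1 zgen) chiF_log muln1.
  have : (1 - wgen ^+ j) * T = 0 by rewrite mulrBl mul1r -h subrr.
  move=> /eqP; rewrite mulf_eq0 subr_eq0 eq_sym => /orP[|/eqP //].
  by rewrite -(prim_order_dvd wgen_prim) (negbTE hj).
elim: a => [|a IH]; first by rewrite add0n.
have h : \sum_(a <= n < (a + q).+1) chi j n = chi j a + \sum_(a.+1 <= n < a.+1 + q) chi j n.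
  by rewrite [LHS]big_ltn ?addSn // ltnS leq_addr.
move: h; rewrite big_nat_recr ?leq_addr //= IH add0r chi_period => /eqP.
by rewrite -subr_eq0 opprD addrA subrr sub0r oppr_eq0 => /eqP.
Qed.

Lemma chi_sum_le j a b : ~~ (q.-1 %| j)%N -> nc (\sum_(a <= n < b) chi j n) <= q%:R.
Proof.
move=> hj; case: (leqP b a) => [ba|ab]; first by rewrite big_geq // nc0 ler0n.
rewrite -(subnKC (ltnW ab)); move: (b - a)%N => k {b ab}.
elim/ltn_ind: k a => k IH a; case: (ltnP k q) => kq.
  apply: le_trans (nc_sum _ _ _) _; apply: (@le_trans _ _ (\sum_(a <= n < a + k) 1)).
    by apply: ler_sum => n _; exact: chi_le1.
  by rewrite sumr_const_nat addKn ler_nat ltnW.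
rewrite (big_cat_nat _ (n := a + q)) /=; [|exact: leq_addr|by rewrite leq_add2l].
rewrite chi_full // add0r -{1}(subnKC kq) addnA; apply: IH.
by have := prime_gt0 q_prime; lia.
Qed.

Lemma chi_quasichar j : ~~ (q.-1 %| j)%N -> quasichar (chi j) q%:R.
Proof.
move=> hj; split.
- exact: chiF1.
- by move=> m n; rewrite /chi natrM chiFM.
- exact: chi_le1.
- by move=> a b; exact: chi_sum_le.
by rewrite ler1n prime_gt0.
Qed.

Lemma chi_sqr j n : chi j n ^+ 2 = chi (j * 2) n.
Proof.
rewrite /chi /chiF; case: ifP => _; first by rewrite expr0n.
by rewrite -exprM; congr (_ ^+ _); rewrite mulnAC.
Qed.

Lemma chi_orth n : \sum_(j < q.-1) chi j n = if (n%:R == 1 :> 'F_q) then q.-1%:R else 0.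
Proof.
case: (eqVneq (n%:R : 'F_q) 0) => [e0|n0].
  rewrite e0 eq_sym oner_eq0 big1 // => j _; by rewrite /chi /chiF e0 eqxx.
rewrite (eq_bigr (fun j : 'I_q.-1 => (wgen ^+ dlog n%:R) ^+ j)); last first.
  by move=> j _; rewrite /chi /chiF (negbTE n0) -exprM mulnC.
case: ifP => h.
  have -> : wgen ^+ dlog n%:R = 1.
    apply/eqP; rewrite -(prim_order_dvd wgen_prim) (prim_order_dvd zgen_prim).
    by rewrite dlogK.
  rewrite (eq_bigr (fun=> 1)) => [|j _]; last by rewrite expr1n.
  by rewrite sumr_const card_ord.
have := subrX1 (wgen ^+ dlog n%:R) q.-1.
rewrite -exprM mulnC exprM (prim_expr_order wgen_prim) expr1n subrr => /esym/eqP.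
rewrite mulf_eq0 subr_eq0 => /orP[|/eqP //].
by rewrite -(prim_order_dvd wgen_prim) (prim_order_dvd zgen_prim) dlogK // h.
Qed.

Lemma expR1_ge2 : 2 <= expR 1 :> R.
Proof. by have := expR_ge1Dx (1 : R); lra. Qed.

Lemma nat_le_expR (n : nat) : n%:R <= expR n%:R :> R.
Proof. by have := expR_ge1Dx (n%:R : R); lra. Qed.

Lemma pow2_le_expR (n : nat) : 2 ^+ n <= expR n%:R :> R.
Proof. by rewrite -[n%:R]mulr1 expRM_natl lerXn2r ?nnegrE ?expR1_ge2 ?expR_ge0. Qed.

(** An upper bound for [Lpart * Spart] divided by a lower bound for [Lpart]. If the square of the
    character is nonprincipal the lower bound is polynomial in [1 / q]; for the quadratic character
    it is exponentially small, and this dictates the shape of the estimate. *)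
Lemma S_bound_char (j x : nat) : ~~ (q.-1 %| j)%N -> (0 < x)%N ->
  nc (Spart (chi j) x) <= expR (18 * q%:R).
Proof.
move=> hj x0; have hq := chi_quasichar hj.
have q0 : 0 < q%:R :> R by rewrite ltr0n prime_gt0.
have q1 : 1 <= q%:R :> R by rewrite ler1n prime_gt0.
have qe := nat_le_expR q.
case: (boolP (q.-1 %| j * 2)%N) => hj2; last first.
  have hq2 : quasichar (fun n => chi j n ^+ 2) q%:R.
    have := chi_quasichar hj2.
    by rewrite (_ : chi (j * 2) = fun n => chi j n ^+ 2) //; apply: funext => n; rewrite chi_sqr.
  have [N0 hN0] := L_lower_complex hq hq2.
  have hx : (0 < x <= maxn x N0)%N by rewrite x0 leq_maxl.
  have h1 := hN0 _ (leq_maxr x N0); have h2 := LS_bound hq hx.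
  set L := nc (Lpart _ _) in h1 h2; set S := nc _ in h2 *.
  have S0 : 0 <= S by exact: nc_ge0.
  have e4 : 16 <= expR 4 :> R.
    by apply: le_trans (pow2_le_expR 4); rewrite -natrX ler_nat.
  have e9 : 302 <= expR 9 :> R.
    by apply: le_trans (pow2_le_expR 9); rewrite -natrX ler_nat.
  have e3 : 6 <= expR 3 :> R.
    by apply: le_trans (pow2_le_expR 3); rewrite -natrX ler_nat.
  have p4 : 0 <= 16 :> R by rewrite ler0n.
  have p9 : 0 <= 302 :> R by rewrite ler0n.
  have p3 : 0 <= 6 :> R by rewrite ler0n.
  move: (16 : R) (302 : R) (6 : R) e4 e9 e3 p4 p9 p3 h1 h2 => c4 c9 c3 e4 e9 e3 p4 p9 p3 h1 h2.
  have c0 : 0 <= c4 * (c9 * q%:R ^+ 2) by rewrite !mulr_ge0 ?sqr_ge0.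
  have h3 : S <= c4 * (c9 * q%:R ^+ 2) * (c3 * q%:R).
    apply: (@le_trans _ _ (c4 * (c9 * q%:R ^+ 2) * L * S)); first by rewrite ler_peMl.
    by rewrite -[leLHS]mulrA ler_wpM2l.
  apply: le_trans h3 _.
  have e18 : expR 4 * (expR 9 * expR q%:R ^+ 2) * (expR 3 * expR q%:R) <=
      expR (18 * q%:R) :> R.
    rewrite -expRM_natl -!expRD ler_expR.
    have : 2 <= q%:R :> R by rewrite (ler_nat _ 2) prime_gt1.
    lra.
  apply: le_trans e18; have q0' := ltW q0.
  apply: ler_pM => //; first by rewrite mulr_ge0.
    apply: ler_pM => //; first by rewrite mulr_ge0 ?sqr_ge0.
    by apply: ler_pM => //; rewrite ?sqr_ge0 // lerXn2r ?nnegrE ?expR_ge0.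
  by apply: ler_pM.
have w1 : wgen ^+ j = -1.
  have : (wgen ^+ j) ^+ 2 == 1 by rewrite -exprM -(prim_order_dvd wgen_prim).
  rewrite sqrf_eq1 => /orP[|/eqP //].
  by rewrite -(prim_order_dvd wgen_prim) (negbTE hj).
pose c n : R := if (n%:R == 0 :> 'F_q) then 0 else (-1) ^+ dlog n%:R.
have ec n : chi j n = rc (c n).
  rewrite /chi /chiF /c; case: ifP => // _.
  rewrite exprM w1; elim: (dlog _) => [|k IH]; first by rewrite !expr0.
  rewrite !exprS IH rcM; congr (_ * _); rewrite /rc /= -[LHS]/(- (1 : C)).
  by apply/eqP; rewrite eq_complex /= oppr0 !eqxx.
have hc : quasichar (fun n => rc (c n)) q%:R.
  by rewrite (_ : (fun n => rc (c n)) = chi j) //; apply: funext => n; rewrite ec.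
have cv n : [\/ c n = -1, c n = 0 | c n = 1].
  rewrite /c; case: ifP => _; first by constructor 2.
  by rewrite -signr_odd; case: odd; rewrite ?expr1 ?expr0; [constructor 1|constructor 3].
(* Large enough for [L_lower_real] with [Q = q] to give [1 <= 2 X * L]; the price is [X] as large as
   [exp (8 q + 2)]. *)
have [|X [X0 Xl Xu]] := @nat_of_ln R (8 * q%:R + 1); first by lra.
set N := maxn x X.
have hX : (0 < X <= N)%N by rewrite X0 leq_maxr.
have hx : (0 < x <= N)%N by rewrite x0 leq_maxl.
have h1 := L_lower_real hc cv hX; have h2 := LS_bound hq hx.
have eL : Lpart (chi j) N = rc (\sum_(1 <= n < N.+1) c n / n%:R).
  by rewrite rc_sum; apply: eq_bigr => n _; rewrite rcM ec.
rewrite eL nc_rc in h2; set L := \sum_(1 <= n < N.+1) _ in h1 h2.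
set S := nc _ in h2 *; have S0 : 0 <= S by exact: nc_ge0.
have XR := natR_gt0 R X0.
have h3 : 1 <= 2 * X%:R * L by move: h1 Xl; move: (2 * _ * L) => u; lra.
have L0 : 0 <= L.
  have p : 0 < 2 * X%:R :> R by rewrite mulr_gt0.
  by rewrite -(pmulr_rge0 _ p); lra.
rewrite (ger0_norm L0) in h2.
have h4 : S <= 2 * X%:R * (6 * q%:R).
  apply: (@le_trans _ _ (2 * X%:R * L * S)); first by rewrite ler_peMl.
  by rewrite -[leLHS]mulrA ler_wpM2l // mulr_ge0 // ltW.
apply: le_trans h4 _.
have hX2 : X%:R <= expR (8 * q%:R + 2) :> R.
  rewrite -(@ler_ln R) ?posrE ?expR_gt0 // expRK; lra.
have e4 : 12 <= expR 4 :> R.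
  apply: le_trans (pow2_le_expR 4); rewrite -natrX ler_nat; by [].
have -> : 2 * X%:R * (6 * q%:R) = 12 * q%:R * X%:R :> R by ring.
apply: (@le_trans _ _ (expR 4 * expR q%:R * expR (8 * q%:R + 2))); last first.
  by rewrite -!expRD ler_expR; lra.
apply: ler_pM; rewrite ?mulr_ge0 ?(ltW XR) ?(ltW q0) //.
by apply: ler_pM; rewrite ?(ltW q0).
Qed.

Lemma natF1 n : (0 < n)%N -> (n%:R == 1 :> 'F_q) = (q %| n.-1)%N.
Proof. by case: n => // n _; rewrite -natr1 -subr_eq0 addrK natF0. Qed.

Lemma chi_principal n : chi 0 n = rc (if (q %| n)%N then 0 else 1).
Proof. by rewrite /chi /chiF natF0; case: ifP. Qed.

(** Orthogonality turns the progression into an average of [Spart] over all characters: the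
    principal one gives [ln x], the other [q - 2] are bounded by [S_bound_char]. *)
Lemma dirichlet_Lam (x : nat) : (0 < x)%N ->
  `|\sum_(1 <= n < x.+1 | (q %| n.-1)%N) Lam R n / n%:R - ln x%:R / q.-1%:R|
    <= expR (18 * q%:R) + 4.
Proof.
move=> x0; set D := \sum_(1 <= n < x.+1 | _) _.
have q1 := q1_gt0; have q1R := natR_gt0 R q1.
have E : rc (q.-1%:R * D) = \sum_(j < q.-1) Spart (chi j) x.
  rewrite /Spart exchange_big /= /D mulr_sumr rc_sum big_mkcond.
  apply: eq_big_nat => n /andP[n0 _]; rewrite -mulr_suml chi_orth natF1 //.
  by case: ifP => _; rewrite ?mul0r // rcM /rc rmorph_nat.
have [q' eq'] : exists q', q.-1 = q'.+1 by exists q.-1.-1; lia.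
(* The principal character omits the multiples of [q], whose contribution is at most
   [ln q / q + 2 <= 3]. *)
have h0 : `|complex.Re (Spart (chi 0) x) - ln x%:R| <= 4.
  have -> : complex.Re (Spart (chi 0) x) =
     \sum_(1 <= n < x.+1) Lam R n / n%:R - \sum_(1 <= n < x.+1 | (q %| n)%N) Lam R n / n%:R.
    rewrite /Spart Re_sum [X in _ = _ - X]big_mkcond -sumrB; apply: eq_bigr => n _.
    rewrite Re_mul_rc chi_principal; case: ifP => _ /=; lra.
  have b1 := sum_Lam_over_ge R x0; have b2 := sum_Lam_over_le R x0.
  have [_ b3] := sum_Lam_primes R (fun n => (q %| n)%N) x.
  have b4 : 0 <= \sum_(1 <= n < x.+1 | (q %| n)%N) Lam R n / n%:R.
    by apply: sumr_ge0 => n _; rewrite divr_ge0 ?Lam_ge0.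
  have b5 : \sum_(1 <= p < x.+1 | prime p && (q %| p)%N) ln p%:R / p%:R <= 1 :> R.
    have Eq p : prime p && (q %| p)%N = (p == q).
      apply/andP/eqP => [[pp qp]|->]; last by rewrite q_prime dvdnn.
      by apply/eqP; rewrite eq_sym -dvdn_prime2.
    rewrite (eq_bigl _ _ Eq).
    case: (boolP (q \in index_iota 1 x.+1)) => hqx; last first.
      rewrite big_seq_cond big1 ?ler01 // => i /andP[hi /eqP ei].
      by rewrite -ei hi in hqx.
    rewrite (big_rem q) //= eqxx big_seq_cond big1 ?addr0.
      rewrite ler_pdivrMr ?ltr0n ?prime_gt0 // mul1r.
      have := @ln_le_subr1 R q%:R; rewrite ltr0n prime_gt0 // => /(_ isT); lra.
    move=> i; rewrite mem_rem_uniq ?iota_uniq // inE => /andP[/andP[h _] h'].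
    by rewrite h' in h.
  by rewrite ler_norml; apply/andP; split; lra.
have h1 : `|q.-1%:R * D - ln x%:R| <= q.-1%:R * (expR (18 * q%:R) + 4).
  have e : q.-1%:R * D = complex.Re (\sum_(j < q.-1) Spart (chi j) x) by rewrite -E.
  rewrite e Re_sum -(big_mkord xpredT (fun j => complex.Re (Spart (chi j) x))).
  rewrite big_ltn // addrAC; apply: le_trans (ler_normD _ _) _.
  have e0 := expR_ge0 (18 * q%:R : R).
  have hS : `|\sum_(1 <= j < q.-1) complex.Re (Spart (chi j) x)| <=
     q.-1.-1%:R * expR (18 * q%:R).
    apply: le_trans (ler_norm_sum _ _ _) _.
    apply: (@le_trans _ _ (\sum_(1 <= j < q.-1) expR (18 * q%:R))).
      apply: ler_sum_nat => j /andP[j0 jq]; apply: le_trans (Re_nc _) _.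
      apply: S_bound_char => //; apply/negP => /(dvdn_leq j0); lia.
    by rewrite sumr_const_nat subn1 [leRHS]mulr_natl.
  apply: le_trans (lerD h0 hS) _.
  rewrite eq' /= -[q'.+1%:R]natr1; move: (expR _) e0 => v v0.
  have : 0 <= q'%:R :> R by rewrite ler0n.
  by move: (q'%:R) => u u0; nra.
rewrite -(ler_pM2l q1R); apply: le_trans h1.
rewrite -{1}(gtr0_norm q1R) -normrM mulrBr mulrCA mulfV ?gt_eqF // mulr1.
by [].
Qed.

Lemma dirichlet_mertens (x : nat) : (0 < x)%N ->
  `|\sum_(1 <= p < x.+1 | prime p && (q %| p.-1)%N) ln p%:R / p%:R - ln x%:R / q.-1%:R|
    <= expR (19 * q%:R) :> R.
Proof.
move=> x0; have := dirichlet_Lam x0.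
have [b1 b2] := sum_Lam_primes R (fun n => (q %| n.-1)%N) x.
have q2 : 2 <= q%:R :> R by rewrite (ler_nat _ 2) prime_gt1.
have e1 : expR (18 * q%:R) + 6 <= expR (19 * q%:R) :> R.
  have -> : 19 * q%:R = 18 * q%:R + q%:R :> R by ring.
  rewrite expRD.
  have a1 := expR_ge1Dx (18 * q%:R : R); have a2 := expR_ge1Dx (q%:R : R).
  by move: (expR _) (expR _) a1 a2 => u v *; nra.
rewrite !ler_norml => /andP[h1 h2]; apply/andP.
move: b1 b2 h1 h2; move: (\sum_(1 <= n < _ | _) _) (\sum_(1 <= p < _ | _) _) (_ / _) => u v w.
by move=> *; split; lra.
Qed.

End DirichletCharacters.

(** * The sum of [1 / p] over [p = 1 mod q], uniformly in [q] *)

Section PrimeReciprocalsAP.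
Variable R : realType.

Lemma LL_succ_bounds (n : nat) : (1 < n)%N ->
  let d := ln n.+1%:R - ln n%:R in
  d / ln n.+1%:R <= LL R n.+1 - LL R n /\ LL R n.+1 - LL R n <= d / ln n%:R.
Proof.
move=> n1 d; have l0 : 0 < ln n%:R :> R by rewrite ln_gt0 // ltr1n.
have l1 : 0 < ln n.+1%:R :> R by rewrite ln_gt0 // ltr1n; lia.
rewrite /LL; split.
  have := @ln_le_subr1 R (ln n%:R / ln n.+1%:R) (divr_gt0 l0 l1).
  rewrite ln_div ?posrE // /d mulrBl mulfV ?gt_eqF //.
  by move: (ln (ln _)) (ln (ln _)) (_ / _) => a b c; lra.
have := @ln_le_subr1 R (ln n.+1%:R / ln n%:R) (divr_gt0 l1 l0).
by rewrite ln_div ?posrE // /d mulrBl mulfV ?gt_eqF.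
Qed.

Lemma LL_le (a b : nat) : (2 <= a <= b)%N -> LL R a <= LL R b.
Proof.
move=> /andP[a2 ab]; rewrite /LL ler_ln ?posrE ?ln_gt0 ?ltr1n //; last lia.
by apply: ler_ln_nat; lia.
Qed.

(** Up to [X0], where [ln X0] is about the Dirichlet error [E], both terms are bounded by the sieve
    and by the size of [LL]. From [X0] on, partial summation of [dirichlet_mertens] with weight
    [1 / ln] gives an error of order [E / ln X0 <= 1]. *)
Lemma Bsum_asymp : exists2 C : R, 0 < C & forall q x : nat, prime q -> (3 <= x)%N ->
  `|Bsum R q x - LL R x / q.-1%:R| <= C.
Proof.
have [C C0 hB] := Bsum_le R.
exists (40 + 40 * C + 3 + 40) => [|q x qp x3]; first by lra.
have q1 := prime_gt1 qp.
have q1R : 1 <= q.-1%:R :> R by rewrite ler1n; lia.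
have qR : q%:R = q.-1%:R + 1 :> R by rewrite natr1 prednK // ltnW.
set E := expR (19 * q%:R) : R.
have E1 : 1 <= E by rewrite /E -[X in X <= _]expR0 ler_expR mulr_ge0 ?ler0n.
have [|X0 [X0p Xl Xu]] := @nat_of_ln R E; first lra.
have X3 : (3 <= X0)%N.
  have : 19 * q%:R + 1 <= E by rewrite addrC; exact: expR_ge1Dx.
  move=> hE; have h := @ln_le_subr1 R X0%:R (natR_gt0 R X0p).
  have : 3 <= X0%:R :> R by lra.
  by rewrite (ler_nat _ 3).
have LX : LL R X0 <= 19 * q%:R + 1.
  have h0 : 0 < ln X0%:R :> R by lra.
  rewrite /LL -[X in _ <= X]expRK ler_ln ?posrE ?expR_gt0 //.
  apply: le_trans Xu _; rewrite expRD -/E.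
  have := @expR1_ge2 R; nra.
have LX0 := LL3_ge0 R X3.
(* Below the threshold [LL <= 19 q + 1], so dividing by [q] or [q - 1] leaves an absolute
   constant. *)
have small t : (3 <= t)%N -> (t <= X0)%N -> Bsum R q t <= 40 * C /\ LL R t / q.-1%:R <= 40.
  move=> t3 tX; have Lt : LL R t <= 19 * q%:R + 1.
    by apply: le_trans (LL_le _) LX; rewrite tX andbT; lia.
  have Lt0 := LL3_ge0 R t3.
  split; last by rewrite ler_pdivrMr; lra.
  have := hB q 1%N t qp t3; rewrite expn1 => h; apply: le_trans h _.
  rewrite -mulrA [40 * C]mulrC ler_wpM2l ?(ltW C0) // ler_pdivrMr; lra.
case: (leqP x X0) => xX.
  have [s1 s2] := small x x3 xX; have B0 := Bsum_ge0 R q x.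
  have L0 : 0 <= LL R x / q.-1%:R by rewrite divr_ge0 ?LL3_ge0.
  by rewrite ler_norml; apply/andP; split; lra.
pose T n : R := \sum_(1 <= p < n.+1 | prime p && (q %| p.-1)%N) ln p%:R / p%:R.
pose W n : R := T n - ln n%:R / q.-1%:R.
have hW n : (0 < n)%N -> `|W n| <= E by move=> n0; exact: dirichlet_mertens.
pose u (n : nat) : R := (ln n%:R)^-1.
(* Remainder of the partial summation with the boundary term [W n * u n] taken out, so that each
   step changes it by at most a telescoping quantity. *)
pose V n : R := Bsum R q n - Bsum R q X0 - (LL R n - LL R X0) / q.-1%:R - W n * u n.
have hV k : `|V (X0 + k)%N| <= E * (2 * u X0 - u (X0 + k)%N) + (u X0 - u (X0 + k)%N).
  elim: k => [|k IH].
    rewrite addn0 /V !subrr mul0r subr0 sub0r normrN normrM addr0.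
    have u0 : 0 <= u X0 by rewrite invr_ge0 ln_nat_ge0.
    have -> : 2 * u X0 - u X0 = u X0 by ring.
    by rewrite (ger0_norm u0) ler_wpM2r // hW.
  rewrite addnS; move: IH; set n := (X0 + k)%N => IH.
  have n3 : (3 <= n)%N by apply: leq_trans X3 _; exact: leq_addr.
  have n1 : (1 < n)%N := ltnW n3; have n0 : (0 < n)%N := ltnW n1.
  have l0 : 0 < ln n%:R :> R by rewrite ln_gt0 // ltr1n.
  have l1 : 0 < ln n.+1%:R :> R by rewrite ln_gt0 // ltr1n ltnS.
  have ll : ln n%:R <= ln n.+1%:R :> R by apply: ler_ln_nat; rewrite n0 leqnSn.
  have uu : u n.+1 <= u n by rewrite /u lef_pV2 ?posrE.
  have eB : Bsum R q n.+1 - Bsum R q n = (T n.+1 - T n) * u n.+1.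
    rewrite /Bsum /T [in X in X - _ = _]big_mkcond big_nat_recr //= -big_mkcond /=.
    rewrite addrAC subrr add0r [in X in _ = (X - _) * _]big_mkcond [in RHS]big_nat_recr //=.
    rewrite -big_mkcond /= [in RHS]addrAC subrr add0r.
    case: ifP => _; last by rewrite mul0r.
    by rewrite mulrAC mulfV ?mul1r // gt_eqF.
  have eT : T n.+1 - T n = W n.+1 - W n + (ln n.+1%:R - ln n%:R) / q.-1%:R.
    by rewrite /W; ring.
  have [b1 b2] : (ln n.+1%:R - ln n%:R) * u n.+1 <= LL R n.+1 - LL R n /\
    LL R n.+1 - LL R n <= (ln n.+1%:R - ln n%:R) * u n := LL_succ_bounds n1.
  set d := ln n.+1%:R - ln n%:R in eT b1 b2.
  have d0 : 0 <= d by rewrite subr_ge0.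
  have d1 : d <= 1.
    apply: le_trans (ln_succ_le R n0) _.
    by rewrite invf_le1 ?ler1n ?ltr0n.
  have eV : V n.+1 = V n + (W n * (u n - u n.+1) +
      (d * u n.+1 - (LL R n.+1 - LL R n)) / q.-1%:R).
    have -> : V n.+1 = V n + ((Bsum R q n.+1 - Bsum R q n) -
       (LL R n.+1 - LL R n) / q.-1%:R - W n.+1 * u n.+1 + W n * u n).
      by rewrite /V; ring.
    by rewrite eB eT; ring.
  rewrite eV; apply: le_trans (ler_normD _ _) _.
  have -> : E * (2 * u X0 - u n.+1) + (u X0 - u n.+1) =
     E * (2 * u X0 - u n) + (u X0 - u n) + (E * (u n - u n.+1) + (u n - u n.+1)) by ring.
  apply: lerD => //; apply: le_trans (ler_normD _ _) _; apply: lerD.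
    rewrite normrM (ger0_norm (_ : 0 <= u n - u n.+1)) ?subr_ge0 //.
    by rewrite ler_wpM2r ?subr_ge0 // hW.
  rewrite normrM normfV [`|q.-1%:R|]ger0_norm ?ler0n //.
  apply: (@le_trans _ _ `|d * u n.+1 - (LL R n.+1 - LL R n)|).
    by rewrite ler_piMr ?normr_ge0 // invf_le1 //; lra.
  rewrite ler_norml; apply/andP; split.
    have : d * (u n - u n.+1) <= 1 * (u n - u n.+1) by rewrite ler_wpM2r // subr_ge0.
    lra.
  have : 0 <= u n - u n.+1 by rewrite subr_ge0.
  lra.
have := hV (x - X0)%N; rewrite subnKC; last exact: ltnW.
have ux : 0 <= u x by rewrite invr_ge0 ln_nat_ge0.
have u0 : u X0 <= 1 by rewrite invf_le1; lra.
have Eu : E * u X0 <= 1 by rewrite /u ler_pdivrMr; lra.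
have hWx : `|W x * u x| <= E * u x.
  by rewrite normrM (ger0_norm ux) ler_wpM2r // hW // (leq_trans _ x3).
have [s1 s2] := small X0 X3 (leqnn _); have B0 := Bsum_ge0 R q X0.
have L0 : 0 <= LL R X0 / q.-1%:R by rewrite divr_ge0.
move=> h; have h' : `|V x + W x * u x| <= 2 * (E * u X0) + u X0.
  apply: le_trans (ler_normD _ _) _; move: (lerD h hWx).
  move: (`|V x|) (`|W x * u x|) => a b; lra.
have -> : Bsum R q x - LL R x / q.-1%:R =
  (V x + W x * u x) + Bsum R q X0 - LL R X0 / q.-1%:R by rewrite /V; ring.
move: h'; rewrite !ler_norml => /andP[h1 h2]; apply/andP; split; lra.
Qed.

End PrimeReciprocalsAP.

(** * The Carmichael function *)

Section Carmichael.

Lemma carmichaelP (n : nat) : universal_exponent n (carmichael n).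
Proof. by rewrite /carmichael; case: ex_minnP => m /asboolP. Qed.

Lemma carmichael_min (n m : nat) : universal_exponent n m -> (carmichael n <= m)%N.
Proof. by rewrite /carmichael; case: ex_minnP => c _ h hm; apply: h; apply/asboolP. Qed.

Lemma carmichael_gt0 (n : nat) : (0 < carmichael n)%N.
Proof. by case: (carmichaelP n). Qed.

Lemma universal_exponentE (n m : nat) : (0 < n)%N ->
  universal_exponent n m <->
  (0 < m)%N /\ forall a : nat, coprime a n -> (a ^ m = 1 %[mod n])%N.
Proof.
move=> n0; split=> -[m0 h]; split=> // a ca.
  have := h a%:Z; rewrite coprimezE /= => /(_ ca).
  by rewrite -rmorphXn /= natrXE -[1]/(1%:Z) !modz_nat => -[].
rewrite -modzXm; move: ca; rewrite /coprimez -gcdz_modl.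
have n0' : n%:Z != 0 by rewrite eqz_nat -lt0n.
have : 0 <= (a %% n%:Z)%Z by exact: modz_ge0.
case: (a %% n%:Z)%Z => // b _ cb.
rewrite -rmorphXn natrXE -[1]/(1%:Z) !modz_nat; congr Posz.
by apply: h; exact: cb.
Qed.

Lemma carmichael_exp (n a : nat) : (0 < n)%N -> coprime a n ->
  (a ^ carmichael n = 1 %[mod n])%N.
Proof.
move=> n0; have [h _] := universal_exponentE (carmichael n) n0.
by case: (h (carmichaelP n)) => _; apply.
Qed.

(** Otherwise the remainder of [m] modulo the minimal exponent would be a smaller universal
    exponent. *)
Lemma carmichael_dvd (n m : nat) : (0 < n)%N -> (0 < m)%N ->
  (forall a : nat, coprime a n -> (a ^ m = 1 %[mod n])%N) -> (carmichael n %| m)%N.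
Proof.
move=> n0 m0 h; set c := carmichael n; have c0 : (0 < c)%N := carmichael_gt0 n.
have [r0|r0] := posnP (m %% c)%N; first by rewrite /dvdn r0.
exfalso.
have : universal_exponent n (m %% c)%N.
  apply/universal_exponentE => //; split=> // a ca.
  have e : (a ^ m = (a ^ c) ^ (m %/ c) * a ^ (m %% c))%N.
    by rewrite -expnM [(c * _)%N]mulnC -expnD -divn_eq.
  have := h a ca; rewrite e -modnMml -modnXm (carmichael_exp n0 ca).
  by rewrite modnXm exp1n modnMml mul1n.
by move/carmichael_min; rewrite leqNgt ltn_mod c0.
Qed.

(** Every unit modulo [n] lifts to a unit modulo [N]: take it congruent to 1 modulo [P], the part of
    [N] made of primes not dividing [n]. *)
Lemma carmichael_dvd_mono (n N : nat) : (0 < N)%N -> (n %| N)%N ->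
  (carmichael n %| carmichael N)%N.
Proof.
move=> N0 nN; have n0 : (0 < n)%N := dvdn_gt0 N0 nN.
apply: carmichael_dvd => //; first exact: carmichael_gt0.
move=> a ca; set P := (N`_(\pi(n)^'))%N.
have cnP : coprime n P by apply: (@pnat_coprime \pi(n)); rewrite ?pnat_pi ?part_pnat.
pose b := (chinese n P a 1 + n * P)%N.
have b0 : (0 < b)%N by rewrite addn_gt0 muln_gt0 n0 part_gt0 orbT.
have b1 : b = a %[mod n] by rewrite /b addnC [(n * P)%N]mulnC modnMDl chinese_modl.
have b2 : b = 1 %[mod P] by rewrite /b addnC modnMDl chinese_modr.
have cbn : coprime b n by rewrite -coprime_modl b1 coprime_modl.
have cbP : coprime b P by rewrite -coprime_modl b2 coprime_modl coprime1n.
have cbN : coprime b N.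

  rewrite -(partnC \pi(n) N0) -/P coprimeMr cbP andbT coprime_sym.
  apply: (@pnat_coprime \pi(n)); first exact: part_pnat.
  by rewrite -coprime_pi' // coprime_sym.
have h := carmichael_exp N0 cbN.
have : (b ^ carmichael N = 1 %[mod n])%N.
  by have := congr1 (modn^~ n) h; rewrite !modn_dvdm.
by rewrite -modnXm b1 modnXm.
Qed.

Lemma expand_pow (X m : nat) : exists w, ((1 + X) ^ m = 1 + m * X + X ^ 2 * w)%N.
Proof.
elim: m => [|m [w h]]; first by exists 0%N; rewrite expn0 muln0 mul0n.
exists (m + w + X * w)%N; rewrite expnS h; ring.
Qed.

Lemma dvdn_pred_of_mod (d n : nat) : (0 < n)%N -> (n = 1 %[mod d])%N -> (d %| n.-1)%N.
Proof. by move=> n0 /eqP; rewrite eqn_mod_dvd // subn1. Qed.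

(** Tests the exponent on the single element [1 + q ^ 2], whose order modulo [q ^ k.+2] is divisible
    by [q ^ k]. Taking [q ^ 2] rather than [q] treats [q = 2] like the odd primes. *)
Lemma carmichael_pfactor (q k N : nat) : prime q -> (0 < N)%N ->
  (q ^ k.+2 %| N)%N -> (q ^ k %| carmichael N)%N.
Proof.
move=> qp N0 /(carmichael_dvd_mono N0) h; apply: dvdn_trans h.
have q0 := prime_gt0 qp; have q1 := prime_gt1 qp.
set n := (q ^ k.+2)%N; have n0 : (0 < n)%N by rewrite expn_gt0 q0.
have cg : coprime (1 + q ^ 2) n.
  rewrite coprime_sym coprimeXl // /coprime gcdnC -[(q ^ 2)%N]/(q * q)%N.
  by rewrite -gcdn_modl addnC modnMDl gcdn_modl gcd1n.
(* Raising to the power [q] adds exactly one factor [q]: the terms beyond the linear one carry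
   [q ^ (2 b + 4)], which exceeds [q ^ b.+3]. *)
have hb b : exists2 u, ((1 + q ^ 2) ^ (q ^ b) = 1 + q ^ b.+2 * u)%N & ~~ (q %| u)%N.
  elim: b => [|b [u e hu]].
    by exists 1%N; rewrite ?expn0 ?expn1 ?muln1 // dvdn1 gtn_eqF.
  have [w hw] := expand_pow (q ^ b.+2 * u) q.
  exists (u + q ^ b.+1 * (u ^ 2 * w))%N.
    by rewrite (expnSr q b) expnM e hw !expnS expn0; ring.
  apply: contra hu; rewrite expnS -mulnA dvdn_addl // dvdn_mulr //.
have e := carmichael_exp n0 cg.
have c0 := carmichael_gt0 n; set c := carmichael n in e c0 *.
have [c' qc' ec] := pfactor_coprime qp c0; set b := logn q c in ec.
have [u eu hu] := hb b.
have [w hw] := expand_pow (q ^ b.+2 * u) c'.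
have eg : ((1 + q ^ 2) ^ c = 1 + q ^ b.+2 * (c' * u + q ^ b.+2 * (u ^ 2 * w)))%N.
  by rewrite ec mulnC expnM eu hw !expnS expn0; ring.
have dv : (q ^ k.+2 %| q ^ b.+2 * (c' * u + q ^ b.+2 * (u ^ 2 * w)))%N.
  move: e; rewrite eg => /dvdn_pred_of_mod; rewrite add1n; exact.
have nd : ~~ (q %| c' * u + q ^ b.+2 * (u ^ 2 * w))%N.
  rewrite dvdn_addl; last by rewrite expnS -mulnA dvdn_mulr.
  by rewrite Euclid_dvdM // (negbTE hu) orbF -prime_coprime.
have : (q ^ k.+2 %| q ^ b.+2)%N.
  move: dv; rewrite Gauss_dvdl // coprimeXl // prime_coprime //.
by rewrite dvdn_Pexp2l // !ltnS => kb; rewrite pfactor_dvdn.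
Qed.

(** Modulo [q ^ 2] the power [(1 + q) ^ c] is [1 + c q], which is 1 only if [q] divides [c]. *)
Lemma carmichael_sq (q N : nat) : prime q -> (0 < N)%N -> (q ^ 2 %| N)%N ->
  (q %| carmichael N)%N.
Proof.
move=> qp N0 /(carmichael_dvd_mono N0) h; apply: dvdn_trans h.
have q0 := prime_gt0 qp; have n0 : (0 < q ^ 2)%N by rewrite expn_gt0 q0.
have cg : coprime (1 + q) (q ^ 2).
  by rewrite coprime_sym coprimeXl // /coprime gcdnC -gcdn_modl modnDr gcdn_modl gcd1n.
have e := carmichael_exp n0 cg; set c := carmichael _ in e *.
have [w hw] := expand_pow q c; rewrite hw in e.
have := dvdn_pred_of_mod _ e; rewrite -addnA add1n => /(_ isT) /=.
by rewrite (dvdn_addl _ (dvdn_mulr w (dvdnn (q ^ 2)))) -mulnn dvdn_pmul2r.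
Qed.

(** The exponent kills a primitive root modulo [p]. *)
Lemma carmichael_pred (p N : nat) : prime p -> (0 < N)%N -> (p %| N)%N ->
  (p.-1 %| carmichael N)%N.
Proof.
move=> pp N0 /(carmichael_dvd_mono N0) h; apply: dvdn_trans h.
have p0 := prime_gt0 pp; have [z hz] := Fp_prim_root pp.
have zn : (val z)%:R = z by exact: natr_Zp.
have z0 : ~~ (p %| val z)%N.
  rewrite -(natF0 pp) zn; apply/eqP => h.
  have := prim_expr_order hz; rewrite h expr0n gtn_eqF.
    by move/eqP; rewrite eq_sym oner_eq0.
  by have := prime_gt1 pp; lia.
have cz : coprime (val z) p by rewrite coprime_sym prime_coprime.
have e := carmichael_exp p0 cz.
rewrite (prim_order_dvd hz) -zn -natrX -subr_eq0.
have v0 : (0 < val z ^ carmichael p)%N.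
  by rewrite expn_gt0 lt0n; case: (val z) z0 => //; rewrite dvdn0.
rewrite -(natrB _ v0) natF0 // subn1; exact: dvdn_pred_of_mod.
Qed.

Lemma pfactor_dvd_biglcm (q b : nat) (s : seq nat) (F : nat -> nat) :
  prime q -> (0 < b)%N -> (forall i, i \in s -> 0 < F i)%N ->
  (q ^ b %| \big[lcmn/1%N]_(i <- s) F i)%N -> exists2 i, i \in s & (q ^ b %| F i)%N.
Proof.
move=> qp b0; elim: s => [|i s IH] F0.
  rewrite big_nil dvdn1 => /eqP h; have : (1 < q ^ b)%N by rewrite -(expn0 q) ltn_exp2l // prime_gt1.
  by rewrite h.
rewrite big_cons => h; have Fi : (0 < F i)%N by apply: F0; rewrite inE eqxx.
have Fs j : j \in s -> (0 < F j)%N by move=> js; apply: F0; rewrite inE js orbT.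
have L0 : (0 < \big[lcmn/1%N]_(j <- s) F j)%N.
  by rewrite big_seq; elim/big_ind: _ => // a c a0 c0; rewrite lcmn_gt0 a0.
have : (q ^ b %| F i)%N || (q ^ b %| \big[lcmn/1%N]_(j <- s) F j)%N.
  by move: h; rewrite !pfactor_dvdn ?lcmn_gt0 ?Fi // logn_lcm // leq_max.
case/orP => [h1|h2]; first by exists i; rewrite ?inE ?eqxx.
by have [j js hj] := IH Fs h2; exists j; rewrite ?inE ?js ?orbT.
Qed.

(** By Euler's theorem [carmichael M] divides the lcm of the [phi(p ^ v)], and a prime power
    dividing an lcm divides one of its terms [(p - 1) p ^ (v - 1)]. The cases are [p = q] and
    [p != q]. *)
Lemma carmichael_pfactor_dvd (q b M : nat) : prime q -> (0 < b)%N -> (0 < M)%N ->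
  (q ^ b %| carmichael M)%N ->
  (q ^ b.+1 %| M)%N \/ exists p, [/\ prime p, (p %| M)%N & (q ^ b %| p.-1)%N].
Proof.
move=> qp b0 M0 h.
set L := \big[lcmn/1%N]_(p <- primes M) totient (p ^ logn p M).
have T0 p : p \in primes M -> (0 < totient (p ^ logn p M))%N.
  by rewrite mem_primes => /and3P[pp _ _]; rewrite totient_gt0 expn_gt0 prime_gt0.
have L0 : (0 < L)%N.
  by rewrite /L big_seq; elim/big_ind: _ => // a c a0 c0; rewrite lcmn_gt0 a0.
have dL p : p \in primes M -> (totient (p ^ logn p M) %| L)%N.
  rewrite /L; elim: (primes M) => // r s IH; rewrite inE big_cons => /orP[/eqP ->|].
    exact: dvdn_lcml.
  by move=> /IH hh; apply: dvdn_trans hh (dvdn_lcmr _ _).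
have dv : (carmichael M %| L)%N.
  apply: carmichael_dvd => // a ca; apply/eqP.
  have [a0|a0] := posnP a.
    move: ca; rewrite a0 /coprime gcd0n => /eqP ->; by rewrite !modn1.
  rewrite eqn_mod_dvd ?expn_gt0 ?a0 //.
  apply/dvdn_partP => // p; rewrite -[p \in _]/(p \in primes M) => pM.
  rewrite p_part -eqn_mod_dvd ?expn_gt0 ?a0 //.
  have cp : coprime a (p ^ logn p M) by apply: coprime_dvdr ca; rewrite pfactor_dvdnn.
  have /dvdnP[k ->] := dL p pM; rewrite mulnC expnM -modnXm.
  by rewrite (Euler_exp_totient cp) modnXm exp1n.
have := dvdn_trans h dv => /(pfactor_dvd_biglcm qp b0 T0) [p].
rewrite mem_primes => /and3P[pp _ pM].
have e0 : (0 < logn p M)%N by rewrite logn_gt0 mem_primes pp M0.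
rewrite totient_pfactor //; case: (eqVneq p q) => [pq|pq].
  rewrite pq Gauss_dvdr; last first.
    rewrite coprimeXl // prime_coprime //; apply/negP => /dvdn_leq.
    by have := prime_gt1 qp; lia.
  rewrite dvdn_Pexp2l ?prime_gt1 // => hb; left.
  by rewrite pfactor_dvdn //; rewrite pq in e0; lia.
rewrite Gauss_dvdl; last first.
  by rewrite coprimeXl // coprimeXr // prime_coprime // dvdn_prime2 // eq_sym.
by move=> hp; right; exists p.
Qed.

Lemma prime_dvd_prod (p : nat) (s : seq nat) (F : nat -> nat) : prime p ->
  (p %| \prod_(i <- s) F i)%N -> exists2 i, i \in s & (p %| F i)%N.
Proof.
move=> pp; elim: s => [|i s IH]; first by rewrite big_nil dvdn1 => /eqP h; rewrite h in pp.
rewrite big_cons Euclid_dvdM // => /orP[h|/IH[j js hj]].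
  by exists i; rewrite ?inE ?eqxx.
by exists j; rewrite ?inE ?js ?orbT.
Qed.

Lemma prime_dvd_totient (p n : nat) : prime p -> (0 < n)%N -> (p %| totient n)%N ->
  (p ^ 2 %| n)%N \/ exists r, [/\ prime r, (r %| n)%N & (p %| r.-1)%N].
Proof.
move=> pp n0; rewrite totientE // => /(prime_dvd_prod pp)[r].
rewrite mem_primes => /and3P[rp _ rn]; rewrite Euclid_dvdM // => /orP[h|h].
  by right; exists r.
left; move: h; rewrite Euclid_dvdX // dvdn_prime2 // => /andP[/eqP -> h].
by rewrite pfactor_dvdn //; lia.
Qed.

Lemma prime_dvd_carmichael (p n : nat) : prime p -> (0 < n)%N ->
  (p %| totient n)%N -> (p %| carmichael n)%N.
Proof.
move=> pp n0 /(prime_dvd_totient pp n0)[h|[r [rp rn pr]]].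
  exact: carmichael_sq.
by apply: dvdn_trans pr _; exact: carmichael_pred.
Qed.

Lemma carmichael_dvd_totient (n : nat) : (0 < n)%N -> (carmichael n %| totient n)%N.
Proof.
move=> n0; apply: carmichael_dvd => // [|a ca]; first by rewrite totient_gt0.
exact: Euler_exp_totient.
Qed.

Lemma totient_le (n : nat) : (totient n <= n)%N.
Proof.
rewrite totient_count_coprime; apply: leq_trans (_ : \sum_(0 <= d < n) 1 <= n)%N.
  by apply: leq_sum => i _; case: coprime.
by rewrite sum_nat_const_nat muln1 subn0.
Qed.

Lemma logn_totient (q n : nat) : prime q -> (0 < n)%N ->
  logn q (totient n) = (\sum_(p <- primes n) logn q p.-1 + (logn q n).-1)%N.
Proof.
move=> qp n0; rewrite totientE //.
have E (s : seq nat) : uniq s -> {subset s <= primes n} ->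
   logn q (\prod_(p <- s) (p.-1 * p ^ (logn p n).-1)) =
   (\sum_(p <- s) logn q p.-1 + if q \in s then (logn q n).-1 else 0)%N.
  elim: s => [|p s IH]; first by rewrite !big_nil logn1.
  move=> /= /andP[ps us] sub.
  have pp : prime p by have := sub p (mem_head _ _); rewrite mem_primes => /andP[].
  have p1 := prime_gt1 pp.
  have P0 : (0 < \prod_(r <- s) (r.-1 * r ^ (logn r n).-1))%N.
    rewrite big_seq; apply: prodn_cond_gt0 => r rs.
    have : prime r by have := sub r; rewrite inE rs orbT => /(_ isT); rewrite mem_primes => /andP[].
    by move=> /prime_gt1 r1; rewrite muln_gt0 expn_gt0; apply/andP; split; lia.
  have t0 : (0 < p ^ (logn p n).-1)%N by rewrite expn_gt0 ltnW.
  rewrite !big_cons lognM //; last by rewrite muln_gt0 t0 andbT; lia.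
  rewrite lognM //; last by lia.
  rewrite IH //; last by move=> r rs; apply: sub; rewrite inE rs orbT.
  rewrite lognX (@logn_prime q p pp) in_cons.
  case: (eqVneq q p) => [->|_] /=; last by rewrite muln0 addn0 addnA.
  by rewrite (negbTE ps) muln1 addn0; lia.
rewrite E ?primes_uniq //; congr (_ + _)%N; case: ifP => //.
by rewrite -logn_gt0; lia.
Qed.

End Carmichael.

(** * The logarithm of the quotient, prime by prime *)

Section RatioBounds.
Variable R : realType.

Let lratio (n : nat) : R :=
  ln ((carmichael (totient n))%:R / (carmichael (carmichael n))%:R).

Lemma lratio_sum (n : nat) : (0 < n)%N -> lratio n =
  \sum_(1 <= q < n.+1 | prime q) ((logn q (carmichael (totient n)))%:R -
     (logn q (carmichael (carmichael n)))%:R) * ln q%:R.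
Proof.
move=> n0; have N0 : (0 < totient n)%N by rewrite totient_gt0.
have c1 := carmichael_gt0 (totient n); have c2 := carmichael_gt0 (carmichael n).
have m0 := carmichael_gt0 n.
have le1 k : (0 < k)%N -> (carmichael k <= k)%N.
  move=> k0; apply: leq_trans (totient_le k); apply: dvdn_leq; rewrite ?totient_gt0 //.
  exact: carmichael_dvd_totient.
rewrite /lratio ln_div ?posrE ?ltr0n //.
rewrite (@ln_logn R _ n); last first.
  by rewrite c1 (leq_trans (le1 _ N0)) // totient_le.
rewrite (@ln_logn R (carmichael (carmichael n)) n); last first.
  by rewrite c2 (leq_trans (le1 _ m0)) // le1.
by rewrite -sumrB; apply: eq_bigr => q _; rewrite mulrBl.
Qed.

(** Let [q ^ b] be the power in lambda(phi n). Either [q ^ b.+1] divides phi(n), so [b] is at most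
    its exponent minus 1; or [q ^ b] divides [p - 1] with [p] dividing phi(n), hence lambda(n), and
    then it divides lambda(lambda n). *)
Lemma lratio_le (n : nat) : (0 < n)%N ->
  lratio n <= \sum_(1 <= q < n.+1 | prime q) (logn q (totient n)).-1%:R * ln q%:R.
Proof.
move=> n0; rewrite lratio_sum //; apply: ler_sum => q qp.
rewrite ler_wpM2r ?ln_nat_ge0 // lerBlDr -natrD ler_nat.
set b := logn q (carmichael (totient n)).
have [->//|b0] := posnP b.
have N0 : (0 < totient n)%N by rewrite totient_gt0.
have m0 := carmichael_gt0 n.
have hb : (q ^ b %| carmichael (totient n))%N by rewrite pfactor_dvdn ?carmichael_gt0.
have [h|[p [pp pN qb]]] := carmichael_pfactor_dvd qp b0 N0 hb.
  move: h; rewrite pfactor_dvdn //; case: (logn q (totient n)) => // v.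
  by rewrite ltnS /= => h; exact: leq_trans h (leq_addr _ _).
have pM : (p %| carmichael n)%N by exact: prime_dvd_carmichael.
have h := dvdn_trans qb (carmichael_pred pp m0 pM).
move: h; rewrite pfactor_dvdn ?carmichael_gt0 // => h.
exact: leq_trans h (leq_addl _ _).
Qed.

(** Discarding the primes above [Y] is legitimate because lambda(lambda n) divides lambda(phi n),
    which makes every term of the sum nonnegative. *)
Lemma lratio_ge (n Y : nat) : (0 < n)%N -> (Y <= n)%N ->
  \sum_(1 <= q < Y.+1 | prime q) ((logn q (totient n))%:R - 2
     - (logn q (carmichael (carmichael n)))%:R) * ln q%:R <= lratio n.
Proof.
move=> n0 Yn; rewrite lratio_sum //.
have N0 : (0 < totient n)%N by rewrite totient_gt0.
rewrite [X in _ <= X](big_cat_nat _ (n := Y.+1)) //= ler_wpDr //.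
  apply: sumr_ge0 => q qp; rewrite mulr_ge0 ?ln_nat_ge0 // subr_ge0 ler_nat.
  apply: dvdn_leq_log; first exact: carmichael_gt0.
  by apply: carmichael_dvd_mono => //; exact: carmichael_dvd_totient.
apply: ler_sum => q qp; rewrite ler_wpM2r ?ln_nat_ge0 // lerD2r.
rewrite lerBlDr -(natrD _ _ 2) ler_nat.
case: (leqP (logn q (totient n)) 2) => h; first by lia.
have := @carmichael_pfactor q (logn q (totient n) - 2) _ qp N0.
rewrite pfactor_dvdn // pfactor_dvdn ?carmichael_gt0 // => /(_ _); lia.
Qed.

End RatioBounds.

(** * Concentration *)

Section Moments.
Variables (R : realType) (x : nat).

Definition psum (f : nat -> R) (n : nat) : R :=
  \sum_(1 <= p < x.+1 | prime p && (p %| n)%N) f p.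
Definition pmean (f : nat -> R) : R := \sum_(1 <= p < x.+1 | prime p) f p / p%:R.

Lemma sum_primes (V : nmodType) (n : nat) (F : nat -> V) : (0 < n <= x)%N ->
  \sum_(p <- primes n) F p = \sum_(1 <= p < x.+1 | prime p && (p %| n)%N) F p.
Proof.
move=> /andP[n0 nx]; rewrite -[RHS]big_filter; apply: perm_big; apply: uniq_perm.
- exact: primes_uniq.
- by rewrite filter_uniq // iota_uniq.
move=> p; rewrite mem_filter mem_primes mem_index_iota n0 /=.
case: (boolP (prime p)) => //= pp; case: (boolP (p %| n)%N) => //= pn.
by rewrite prime_gt0 //= ltnS (leq_trans (dvdn_leq n0 pn)).
Qed.

Lemma count_multiples (d : nat) : (0 < d)%N ->
  \sum_(1 <= n < x.+1) (d %| n)%N%:R = (x %/ d)%:R :> R.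
Proof.
move=> d0; transitivity (\sum_(1 <= n < x.+1 | (d %| n)%N) 1 : R).
  by rewrite [RHS]big_mkcond; apply: eq_bigr => n _; case: (d %| n)%N.
by rewrite sum_multiples // sumr_const_nat subn1.
Qed.

Lemma count_multiples_le (d : nat) : (0 < d)%N ->
  \sum_(1 <= n < x.+1) (d %| n)%N%:R <= x%:R / d%:R :> R.
Proof.
move=> d0; rewrite count_multiples // ler_pdivlMr ?ltr0n // -natrM ler_nat.
exact: leq_trunc_div.
Qed.

Lemma psumE f n : psum f n = \sum_(1 <= p < x.+1 | prime p) (p %| n)%N%:R * f p.
Proof.
rewrite /psum big_mkcondr; apply: eq_bigr => p _.
by case: (p %| n)%N; rewrite ?mul1r ?mul0r.
Qed.

Lemma sum_psum f : \sum_(1 <= n < x.+1) psum f n =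
  \sum_(1 <= p < x.+1 | prime p) (x %/ p)%:R * f p.
Proof.
under eq_bigr => n _ do rewrite psumE.
rewrite exchange_big /=; apply: eq_bigr => p pp.
by rewrite -mulr_suml count_multiples // prime_gt0.
Qed.

Lemma sum_psum_le f : (forall p, 0 <= f p) ->
  \sum_(1 <= n < x.+1) psum f n <= x%:R * pmean f.
Proof.
move=> f0; rewrite sum_psum /pmean mulr_sumr; apply: ler_sum => p pp.
rewrite mulrCA [f p * _]mulrC ler_wpM2r // ler_pdivlMr ?ltr0n ?prime_gt0 //.
by rewrite -natrM ler_nat leq_trunc_div.
Qed.

Lemma sum_psum_ge f (H : R) : (forall p, 0 <= f p <= H) ->
  x%:R * pmean f - x%:R * H <= \sum_(1 <= n < x.+1) psum f n.
Proof.
move=> f0; have H0 : 0 <= H by have /andP[a b] := f0 0%N; exact: le_trans b.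
have E : x%:R * H = \sum_(1 <= p < x.+1) H.
  by rewrite sumr_const_nat subn1 mulr_natl.
have h : \sum_(1 <= p < x.+1 | prime p) f p <= x%:R * H.
  rewrite E big_mkcond; apply: ler_sum => p _; case: ifP => // _.
  by have /andP[] := f0 p.
suff : x%:R * pmean f - \sum_(1 <= p < x.+1 | prime p) f p <=
   \sum_(1 <= n < x.+1) psum f n.
  by move: h; move: (\sum_(_ <= _ < _ | _) _) => u; lra.
rewrite sum_psum /pmean mulr_sumr -sumrB; apply: ler_sum => p pp.
have p0 : 0 < p%:R :> R by rewrite ltr0n prime_gt0.
rewrite mulrCA -{2}[f p]mulr1 -mulrBr [_ * f p]mulrC ler_wpM2l //.
  by have /andP[] := f0 p.
rewrite lerBlDr natr1 ler_pdivrMr // -natrM ler_nat.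
by rewrite ltnW // ltn_ceil // prime_gt0.
Qed.

(** Pairs of distinct primes [p], [r] divide at most [x / (p r)] integers jointly; the diagonal is
    the sum for [f ^ 2]. *)
Lemma sum_psum_sq f : (forall p, 0 <= f p) ->
  \sum_(1 <= n < x.+1) psum f n ^+ 2 <=
  x%:R * pmean f ^+ 2 + \sum_(1 <= n < x.+1) psum (fun p => f p ^+ 2) n.
Proof.
move=> f0.
have -> : x%:R * pmean f ^+ 2 = \sum_(1 <= p < x.+1 | prime p)
   \sum_(1 <= r < x.+1 | prime r) f p * f r * (x%:R / (p%:R * r%:R)).
  rewrite expr2 {1}/pmean mulr_suml mulr_sumr; apply: eq_bigr => p _.
  rewrite /pmean mulr_sumr mulr_sumr; apply: eq_bigr => r _.
  by rewrite invfM; ring.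
have -> : \sum_(1 <= n < x.+1) psum (fun p => f p ^+ 2) n =
  \sum_(1 <= p < x.+1 | prime p) \sum_(1 <= r < x.+1 | prime r)
     f p * f r * (if p == r then (x %/ p)%:R else 0).
  rewrite sum_psum big_nat_cond [RHS]big_nat_cond.
  apply: eq_bigr => p /andP[hp pp].
  rewrite (eq_bigr (fun r => if r == p then f p ^+ 2 * (x %/ p)%:R else 0)); last first.
    move=> r _; rewrite eq_sym; case: eqP => [->|_]; last by rewrite mulr0.
    by rewrite expr2.
  rewrite -big_mkcondr /= (big_rem p) ?mem_index_iota //= pp eqxx /= mulrC.
  rewrite big_seq_cond big1 ?addr0 // => r.
  by rewrite mem_rem_uniq ?iota_uniq // inE => /andP[/andP[/negPf -> _]]; rewrite andbF.
have -> : \sum_(1 <= n < x.+1) psum f n ^+ 2 =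
  \sum_(1 <= p < x.+1 | prime p) \sum_(1 <= r < x.+1 | prime r)
     f p * f r * \sum_(1 <= n < x.+1) ((p %| n)%N && (r %| n)%N)%:R.
  transitivity (\sum_(1 <= n < x.+1) \sum_(1 <= p < x.+1 | prime p)
     \sum_(1 <= r < x.+1 | prime r) f p * f r * ((p %| n)%N && (r %| n)%N)%:R).
    apply: eq_bigr => n _; rewrite expr2 {1}psumE mulr_suml; apply: eq_bigr => p _.
    rewrite psumE mulr_sumr; apply: eq_bigr => r _.
    by case: (p %| n)%N; case: (r %| n)%N => /=; ring.
  rewrite exchange_big /=; apply: eq_bigr => p _.
  rewrite exchange_big /=; apply: eq_bigr => r _.
  by rewrite mulr_sumr.
rewrite -big_split /=; apply: ler_sum => p pp.
rewrite -big_split /=; apply: ler_sum => r rp.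
rewrite -mulrDr ler_wpM2l ?mulr_ge0 //.
have p0 := prime_gt0 pp; have r0 := prime_gt0 rp.
case: eqP => [->|/eqP pr].
  rewrite (eq_bigr (fun n => (r %| n)%N%:R)) => [|n _]; last by rewrite andbb.
  by rewrite count_multiples // lerDr divr_ge0 ?mulr_ge0.
rewrite addr0 -natrM; apply: le_trans (count_multiples_le (_ : 0 < p * r)%N); last first.
  by rewrite muln_gt0 p0.
apply: ler_sum => n _; rewrite Gauss_dvd // prime_coprime // dvdn_prime2 //.
Qed.

(** Expand the square: the [x * pmean f ^ 2] cancel, one [x * H * pmean f] comes from the diagonal
    and two from the floors in the cross term. *)
Lemma turan f (H : R) : (forall p, 0 <= f p <= H) ->
  \sum_(1 <= n < x.+1) (psum f n - pmean f) ^+ 2 <= 3 * (x%:R * H * pmean f).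
Proof.
move=> fH; have f0 p : 0 <= f p by have /andP[] := fH p.
have H0 : 0 <= H by have /andP[a b] := fH 0%N; exact: le_trans b.
have m0 : 0 <= pmean f by apply: sumr_ge0 => p _; rewrite divr_ge0.
have h1 := sum_psum_sq f0; have h2 := sum_psum_ge fH.
have h3 : \sum_(1 <= n < x.+1) psum (fun p => f p ^+ 2) n <= x%:R * H * pmean f.
  apply: le_trans (sum_psum_le _) _; first by move=> p; rewrite sqr_ge0.
  rewrite -mulrA ler_wpM2l ?ler0n // /pmean mulr_sumr; apply: ler_sum => p _.
  rewrite mulrA ler_wpM2r ?invr_ge0 // expr2 ler_wpM2r //.
  by have /andP[] := fH p.
have -> : \sum_(1 <= n < x.+1) (psum f n - pmean f) ^+ 2 =
  \sum_(1 <= n < x.+1) psum f n ^+ 2 - 2 * pmean f * \sum_(1 <= n < x.+1) psum f n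
  + x%:R * pmean f ^+ 2.
  rewrite mulr_sumr -sumrB.
  have -> : x%:R * pmean f ^+ 2 = \sum_(1 <= n < x.+1) pmean f ^+ 2.
    by rewrite sumr_const_nat subn1 mulr_natl.
  by rewrite -big_split /=; apply: eq_bigr => n _; ring.
have h4 := ler_wpM2l m0 h2.
move: h1 h3 h4; move: (\sum_(_ <= _ < _) _) (\sum_(_ <= _ < _) _) (\sum_(_ <= _ < _) _).
move: (pmean f) (x%:R) => m X a b c *; lra.
Qed.

Lemma markov_count (G : nat -> R) (t : R) : 0 < t -> (forall n, 0 <= G n) ->
  \sum_(1 <= n < x.+1) (t < G n)%R%:R <= (\sum_(1 <= n < x.+1) G n) / t.
Proof.
move=> t0 G0; rewrite ler_pdivlMr // mulr_suml; apply: ler_sum => n _.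
by case: ltP => h; rewrite ?mul1r ?mul0r // ltW.
Qed.

Lemma sum_pred_logn (q m : nat) : prime q -> (0 < m <= x)%N ->
  (logn q m).-1%:R = \sum_(2 <= a < x.+1) (q ^ a %| m)%N%:R :> R.
Proof.
move=> qp /andP[m0 mx]; have vx : (logn q m <= x)%N.
  by apply: leq_trans mx; rewrite ltnW // ltn_logl.
have x0 : (0 < x)%N by exact: leq_trans mx.
have : (logn q m)%:R = \sum_(1 <= a < x.+1) (q ^ a %| m)%N%:R :> R.
  rewrite -[LHS]mulr1 -(sum_ltn_cond 1 vx) big_mkcond; apply: eq_bigr => a _.
  by rewrite pfactor_dvdn //; case: (_ <= _)%N.
rewrite big_ltn // expn1.
case: (posnP (logn q m)) => [->|v0].
  case: (boolP (q %| m)%N) => [qm|_]; last by rewrite add0r.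
  move=> h; have : 0 <= \sum_(2 <= a < x.+1) (q ^ a %| m)%N%:R :> R by apply: sumr_ge0.
  by move: h; move: (\sum_(_ <= _ < _) _) => u /=; lra.
have -> : (q %| m)%N by move: v0; rewrite logn_gt0 mem_primes => /and3P[].
rewrite -{1}(prednK v0) -natr1 => /= h.
by move: h; move: (\sum_(_ <= _ < _) _) => u; lra.
Qed.

Lemma Bsum_pmean (m : nat) : Bsum R m x = pmean (fun p => (m %| p.-1)%N%:R).
Proof.
rewrite /Bsum /pmean big_mkcondr; apply: eq_bigr => p _.
by case: (m %| p.-1)%N; rewrite ?mul1r ?mul0r.
Qed.

(** [v_q (phi n) = c1 + c2 + c3] for [0 < n <= x]: one for each prime [p = 1 mod q] dividing [n],
    the excess from higher powers of [q] in [p - 1], and the contribution of powers of [q] dividing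
    [n] itself. *)
Definition c1 (q n : nat) : R := psum (fun p => (q %| p.-1)%N%:R) n.
Definition c2 (q n : nat) : R := psum (fun p => (logn q p.-1).-1%:R) n.
Definition c3 (q n : nat) : R := (logn q n).-1%:R.

Lemma c1_ge0 q n : 0 <= c1 q n. Proof. by apply: sumr_ge0. Qed.
Lemma c2_ge0 q n : 0 <= c2 q n. Proof. by apply: sumr_ge0. Qed.
Lemma c3_ge0 q n : 0 <= c3 q n. Proof. exact: ler0n. Qed.

Lemma logn_totient_nat (q n : nat) : prime q -> (0 < n <= x)%N ->
  exists a b : nat, [/\ c1 q n = a%:R, c2 q n = b%:R &
    logn q (totient n) = (a + b + (logn q n).-1)%N].
Proof.
move=> qp hn; have n0 : (0 < n)%N by case/andP: hn.
exists (\sum_(p <- primes n) (q %| p.-1))%N, (\sum_(p <- primes n) (logn q p.-1).-1)%N.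
split.
- by rewrite natr_sum (@sum_primes _ n (fun p => (q %| p.-1)%N%:R)).
- by rewrite natr_sum (@sum_primes _ n (fun p => (logn q p.-1).-1%:R)).
rewrite logn_totient // -big_split /=; congr (_ + _)%N.
rewrite big_seq [RHS]big_seq; apply: eq_bigr => p; rewrite mem_primes => /and3P[pp _ _].
have p0 : (0 < p.-1)%N by have := prime_gt1 pp; lia.
case: (posnP (logn q p.-1)) => h.
  have -> : (q %| p.-1)%N = false.
    by apply/negbTE/negP => h'; move: h; apply/eqP; rewrite -lt0n logn_gt0 mem_primes qp p0.
  by rewrite h.
have -> : (q %| p.-1)%N by move: h; rewrite logn_gt0 mem_primes => /and3P[].
by rewrite add1n prednK.
Qed.

(** The second bound rests on [a - 1 <= a (a - 1)] for [a >= 1]: the truncated predecessor ignores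
    an isolated prime [p = 1 mod q], and [c1 ^ 2 - c1] counts ordered pairs of them, of mean
    [O((y / q) ^ 2)]. *)
Lemma logn_totient_le (q n : nat) : prime q -> (0 < n <= x)%N ->
  (logn q (totient n)).-1%:R <= c1 q n + (c2 q n + c3 q n) /\
  (logn q (totient n)).-1%:R <= (c1 q n ^+ 2 - c1 q n) + (c2 q n + c3 q n).
Proof.
move=> qp hn; have [a [b [ea eb e]]] := logn_totient_nat qp hn.
rewrite ea eb /c3 e -!natrD -natrX; split; first by rewrite ler_nat; lia.
rewrite -natrB; last by rewrite -mulnn; case: (a) => // k; rewrite leq_pmulr.
by rewrite -natrD ler_nat; case: a {ea e} => [|a]; rewrite ?expnS ?expn0; nia.
Qed.

Lemma logn_totient_ge (q n : nat) : prime q -> (0 < n <= x)%N ->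
  c1 q n <= (logn q (totient n))%:R.
Proof.
move=> qp hn; have [a [b [ea eb e]]] := logn_totient_nat qp hn.
by rewrite ea e ler_nat; lia.
Qed.

End Moments.

(** * Main term, errors and exceptional integers up to a fixed [x] *)

Section Assembly.
Variables (R : realType) (C C2 : R) (x Y Y' T : nat).
Hypothesis C_gt0 : 0 < C.
Hypothesis hB : forall q a : nat, prime q ->
  Bsum R (q ^ a) x <= C * (1 + LL R x) / (q ^ a)%:R.
Hypothesis hA : forall q : nat, prime q -> `|Bsum R q x - LL R x / q.-1%:R| <= C2.
Hypothesis x3 : (3 <= x)%N.
Hypothesis Y_gt0 : (0 < Y)%N.
Hypothesis YY' : (Y <= Y')%N.
Hypothesis Y'x : (Y' <= x)%N.
Hypothesis T_gt0 : (0 < T)%N.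

Let lratio (n : nat) : R :=
  ln ((carmichael (totient n))%:R / (carmichael (carmichael n))%:R).
Let L := LL R x.
Let CB := C * (1 + L).

Let L0 : 0 <= L. Proof. exact: LL3_ge0. Qed.
Let CB0 : 0 <= CB. Proof. by rewrite mulr_ge0 ?(ltW C_gt0) // addr_ge0. Qed.
Let hB1 q : prime q -> Bsum R q x <= CB / q%:R.
Proof. by move=> qp; have := hB 1 qp; rewrite expn1. Qed.

(** Value at [p] of the additive function [F] of the overview, which is [psum x hfun]; [Hmax] bounds
    it for Turan's inequality. *)
Definition hfun (p : nat) : R := \sum_(1 <= q < Y.+1 | prime q) (q %| p.-1)%N%:R * ln q%:R.
Definition Hmax : R := \sum_(1 <= q < Y.+1 | prime q) ln q%:R.

Lemma theta_le (n : nat) : \sum_(1 <= q < n.+1 | prime q) ln q%:R <= 4 * n%:R :> R.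
Proof.
apply: le_trans (psi_le R n); rewrite /psi.
have -> : \sum_(1 <= d < n.+1) Lam R d = \sum_(1 <= d < n.+1) Lam R d * 1.
  by apply: eq_bigr => d _; rewrite mulr1.
rewrite sum_Lam big_nat_cond [X in _ <= X]big_nat_cond.
apply: ler_sum => p /andP[/andP[p0 pn] pp].
have n0 : (0 < n)%N by exact: leq_trans p0 _.
rewrite big_ltn_cond ?ltnS // expn1 -ltnS pn mulr1 lerDl; apply: sumr_ge0 => k _.
by rewrite ?mulr1 ln_nat_ge0.
Qed.

Lemma Hmax_le : Hmax <= 4 * Y%:R. Proof. exact: theta_le. Qed.

Lemma mertens_primes (n : nat) : (0 < n)%N ->
  (ln n%:R - 3 : R) <= \sum_(1 <= p < n.+1 | prime p) ln p%:R / p%:R <= (ln n%:R + 4 : R).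
Proof.
move=> n0; have [h1 h2] := sum_Lam_primes R predT n.
have g1 := sum_Lam_over_ge R n0; have g2 := sum_Lam_over_le R n0.
rewrite (eq_bigl prime) in h1 h2; last by move=> p; rewrite andbT.
by apply/andP; split; lra.
Qed.

Lemma sum_ln_sq_primes (a b : nat) : (0 < a)%N ->
  \sum_(a.+1 <= q < b | prime q) ln q%:R / (q%:R * (q%:R - 1)) <= (ln a%:R + 2) / a%:R :> R.
Proof.
move=> a0; apply: le_trans (sum_ln_over_sq R b a0); rewrite big_mkcond.
apply: ler_sum_nat => q /andP[aq _]; case: ifP => // _.
have : 1 < q%:R :> R by rewrite ltr1n (leq_ltn_trans a0).
by move=> h; rewrite divr_ge0 ?ln_nat_ge0 // mulr_ge0 //; lra.
Qed.

Lemma sum_ln_sq_primes1 (b : nat) :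
  \sum_(1 <= q < b | prime q) ln q%:R / (q%:R * (q%:R - 1)) <= 2 :> R.
Proof.
case: (leqP b 1) => b1; first by rewrite big_geq.
rewrite big_ltn_cond //=; apply: le_trans (sum_ln_sq_primes b (isT : (0 < 1)%N)) _.
by rewrite ln1 divr1 add0r.
Qed.

Lemma hfun_bounds p : 0 <= hfun p <= Hmax.
Proof.
apply/andP; split; first by apply: sumr_ge0 => q _; rewrite mulr_ge0 ?ln_nat_ge0.
apply: ler_sum => q _; rewrite -[X in _ <= X]mul1r ler_wpM2r ?ln_nat_ge0 //.
by case: (q %| p.-1)%N.
Qed.

Lemma psum_hfun n : psum x hfun n = \sum_(1 <= q < Y.+1 | prime q) c1 R x q n * ln q%:R.
Proof.
rewrite /psum /hfun exchange_big /=; apply: eq_bigr => q _.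
by rewrite /c1 /psum mulr_suml.
Qed.

Lemma pmean_hfun : pmean x hfun = \sum_(1 <= q < Y.+1 | prime q) Bsum R q x * ln q%:R.
Proof.
rewrite /pmean /hfun; under eq_bigr => p _ do rewrite mulr_suml.
rewrite exchange_big /=; apply: eq_bigr => q _.
by rewrite Bsum_pmean /pmean mulr_suml; apply: eq_bigr => p _; ring.
Qed.

(** Replacing each [Bsum] by [L / (q - 1)] costs [C2 * Hmax <= 4 C2 Y], which is where uniformity in
    [q] enters; Mertens evaluates the sum of [ln q / (q - 1)] up to 6. *)
Lemma pmean_est : `|pmean x hfun - L * ln Y%:R| <= 6 * L + 4 * C2 * Y%:R.
Proof.
have C20 : 0 <= C2 by apply: le_trans (hA (isT : prime 2)); rewrite normr_ge0.
pose S : R := \sum_(1 <= q < Y.+1 | prime q) ln q%:R / q.-1%:R.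
have hS : ln Y%:R - 3 <= S <= ln Y%:R + 6.
  have -> : S = \sum_(1 <= q < Y.+1 | prime q) ln q%:R / q%:R +
     \sum_(1 <= q < Y.+1 | prime q) ln q%:R / (q%:R * (q%:R - 1)).
    rewrite /S -big_split /=; apply: eq_bigr => q qp.
    have q1 := prime_gt1 qp.
    have e : q.-1%:R = q%:R - 1 :> R by rewrite -subn1 natrB // ltnW.
    have : 1 < q%:R :> R by rewrite ltr1n.
    by move=> h; rewrite e; field; rewrite !gt_eqF //; lra.
  have h1 := mertens_primes Y_gt0; have h2 := sum_ln_sq_primes1 Y.+1.
  have h3 : 0 <= \sum_(1 <= q < Y.+1 | prime q) ln q%:R / (q%:R * (q%:R - 1)) :> R.
    apply: sumr_ge0 => q qp; have : 1 < q%:R :> R by rewrite ltr1n prime_gt1.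
    by move=> h; rewrite divr_ge0 ?ln_nat_ge0 // mulr_ge0 //; lra.
  move: h1 => /andP[h1 h1']; move: h1 h1' h2 h3.
  by move: (\sum_(_ <= _ < _ | _) _) (\sum_(_ <= _ < _ | _) _) => u v *; apply/andP; split; lra.
have hM : `|pmean x hfun - L * S| <= C2 * Hmax.
  rewrite pmean_hfun /S /Hmax !mulr_sumr -sumrB.
  apply: le_trans (ler_norm_sum _ _ _) _; apply: ler_sum => q qp.
  have -> : Bsum R q x * ln q%:R - L * (ln q%:R / q.-1%:R) =
     (Bsum R q x - L / q.-1%:R) * ln q%:R by ring.
  by rewrite normrM (ger0_norm (ln_nat_ge0 R q)) ler_wpM2r ?ln_nat_ge0 // hA.
have hH := ler_wpM2l C20 Hmax_le.
move: hS => /andP[s1 s2]; have t1 := ler_wpM2l L0 s1; have t2 := ler_wpM2l L0 s2.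
move: hM; rewrite !ler_norml => /andP[m1 m2]; apply/andP; split; lra.
Qed.

Definition Gerr (n : nat) : R :=
  \sum_(Y.+1 <= q < Y'.+1 | prime q) c1 R x q n * ln q%:R +
  \sum_(Y'.+1 <= q < x.+1 | prime q) (c1 R x q n ^+ 2 - c1 R x q n) * ln q%:R +
  \sum_(1 <= q < x.+1 | prime q) (c2 R x q n + c3 R q n) * ln q%:R.

Lemma c1_sq_ge0 q n : 0 <= c1 R x q n ^+ 2 - c1 R x q n.
Proof.
rewrite /c1 /psum.
have -> : \sum_(1 <= p < x.+1 | prime p && (p %| n)%N) (q %| p.-1)%N%:R =
  (\sum_(1 <= p < x.+1 | prime p && (p %| n)%N) (q %| p.-1))%N%:R :> R by rewrite natr_sum.
rewrite -natrX subr_ge0 ler_nat -mulnn; case: (\sum_(_ <= _ < _ | _) _)%N => // k.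
by rewrite leq_pmulr.
Qed.

Lemma Gerr_ge0 n : 0 <= Gerr n.
Proof.
rewrite !addr_ge0 //; apply: sumr_ge0 => q _; rewrite mulr_ge0 ?ln_nat_ge0 //.
- exact: c1_ge0.
- exact: c1_sq_ge0.
by rewrite addr_ge0 ?c2_ge0 ?c3_ge0.
Qed.

Lemma lratio_upper n : (0 < n <= x)%N -> lratio n <= psum x hfun n + Gerr n.
Proof.
move=> hn; have /andP[n0 nx] := hn.
apply: le_trans (lratio_le R n0) _.
apply: (@le_trans _ _ (\sum_(1 <= q < x.+1 | prime q) (logn q (totient n)).-1%:R * ln q%:R)).
  rewrite [X in _ <= X](big_cat_nat _ (n := n.+1)) //= lerDl.
  by apply: sumr_ge0 => q _; rewrite mulr_ge0 ?ln_nat_ge0.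
rewrite psum_hfun /Gerr !addrA.
have -> : \sum_(1 <= q < Y.+1 | prime q) c1 R x q n * ln q%:R +
  \sum_(Y.+1 <= q < Y'.+1 | prime q) c1 R x q n * ln q%:R =
  \sum_(1 <= q < Y'.+1 | prime q) c1 R x q n * ln q%:R.
  by rewrite [RHS](big_cat_nat _ (n := Y.+1)).
rewrite (big_cat_nat _ (n := Y'.+1)) //= [X in _ <= _ + X](big_cat_nat _ (n := Y'.+1)) //=.
rewrite addrACA -!big_split /=; apply: lerD; apply: ler_sum => q qp.
  rewrite -mulrDl ler_wpM2r ?ln_nat_ge0 //; by have [] := logn_totient_le R qp hn.
rewrite -mulrDl ler_wpM2r ?ln_nat_ge0 //; by have [] := logn_totient_le R qp hn.
Qed.

Lemma sum_c1 q : \sum_(1 <= n < x.+1) c1 R x q n <= x%:R * Bsum R q x.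
Proof. by rewrite Bsum_pmean; apply: sum_psum_le. Qed.

(** For an indicator, [f ^ 2 = f], so subtracting [c1] removes the diagonal of the second moment
    exactly. *)
Lemma sum_c1_sq q : prime q ->
  \sum_(1 <= n < x.+1) (c1 R x q n ^+ 2 - c1 R x q n) <= x%:R * Bsum R q x ^+ 2.
Proof.
move=> qp; rewrite sumrB.
have h := @sum_psum_sq R x (fun p => (q %| p.-1)%N%:R) (fun p => ler0n _ _).
rewrite -Bsum_pmean in h.
rewrite lerBlDr; apply: le_trans h _; rewrite lerD2l le_eqVlt; apply/orP; left.
apply/eqP; apply: eq_bigr => n _; rewrite /c1 /psum; apply: eq_bigr => p _.
by case: (q %| p.-1)%N; rewrite ?expr1n ?expr0n.
Qed.

(** The truncated exponent is the number of [a >= 2] with [q ^ a] dividing [p - 1]; the sieve bound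
    for each such power sums to a geometric tail. *)
Lemma sum_c2 q : prime q ->
  \sum_(1 <= n < x.+1) c2 R x q n <= x%:R * CB * (q%:R * (q%:R - 1))^-1.
Proof.
move=> qp; apply: le_trans (@sum_psum_le R x (fun p => (logn q p.-1).-1%:R) _) _.
  by move=> p; exact: ler0n.
rewrite -mulrA ler_wpM2l ?ler0n //.
have -> : pmean x (fun p => (logn q p.-1).-1%:R) =
   \sum_(2 <= a < x.+1) Bsum R (q ^ a) x.
  transitivity (\sum_(1 <= p < x.+1 | prime p)
     \sum_(2 <= a < x.+1) (q ^ a %| p.-1)%N%:R / p%:R : R).
    rewrite /pmean big_nat_cond [RHS]big_nat_cond.
    apply: eq_bigr => p /andP[/andP[p0 px] pp].
    have hp : (0 < p.-1 <= x)%N by have := prime_gt1 pp; lia.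
    by rewrite (sum_pred_logn R qp hp) mulr_suml.
  by rewrite exchange_big /=; apply: eq_bigr => a _; rewrite Bsum_pmean.
apply: le_trans (_ : CB * \sum_(2 <= a < x.+1) (q ^ a)%:R^-1 <= _).
  by rewrite mulr_sumr; apply: ler_sum => a _; exact: hB.
by rewrite ler_wpM2l // geom_tail // prime_gt1.
Qed.

Lemma sum_c3 q : prime q ->
  \sum_(1 <= n < x.+1) c3 R q n <= x%:R * (q%:R * (q%:R - 1))^-1.
Proof.
move=> qp; have -> : \sum_(1 <= n < x.+1) c3 R q n =
   \sum_(1 <= n < x.+1) \sum_(2 <= a < x.+1) (q ^ a %| n)%N%:R.
  by apply: eq_big_nat => n hn; rewrite /c3 (sum_pred_logn R qp hn).
rewrite exchange_big /=.
apply: le_trans (_ : x%:R * \sum_(2 <= a < x.+1) (q ^ a)%:R^-1 <= _).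
  rewrite mulr_sumr; apply: ler_sum => a _; apply: count_multiples_le.
  by rewrite expn_gt0 prime_gt0.
by rewrite ler_wpM2l ?ler0n // geom_tail // prime_gt1.
Qed.

Definition Gtot : R := CB * (ln Y'%:R - ln Y%:R + 7) +
  CB ^+ 2 * ((ln Y'%:R + 2) / Y'%:R) + 2 * (CB + 1).

Lemma sum_Gerr : \sum_(1 <= n < x.+1) Gerr n <= x%:R * Gtot.
Proof.
have Y'0 : (0 < Y')%N by exact: leq_trans Y_gt0 YY'.
have x0R : 0 <= x%:R :> R by exact: ler0n.
rewrite /Gerr !big_split /= /Gtot.
set g1 := CB * (_ + 7); set g2 := CB ^+ 2 * _; set g3 := 2 * _.
rewrite [x%:R * (_ + g3)]mulrDr [x%:R * (g1 + g2)]mulrDr; apply: lerD; first apply: lerD.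
- rewrite exchange_big /=.
  apply: (@le_trans _ _ (x%:R * CB * \sum_(Y.+1 <= q < Y'.+1 | prime q) ln q%:R / q%:R)).
    rewrite mulr_sumr; apply: ler_sum => q qp; rewrite -mulr_suml.
    have -> : x%:R * CB * (ln q%:R / q%:R) = x%:R * (CB / q%:R) * ln q%:R by ring.
    rewrite ler_wpM2r ?ln_nat_ge0 //; apply: le_trans (sum_c1 q) _.
    by rewrite ler_wpM2l // hB1.
  rewrite /g1 -mulrA ler_wpM2l // ler_wpM2l //.
  have /andP[_ h1] := mertens_primes Y'0; have /andP[h2 _] := mertens_primes Y_gt0.
  move: h1; rewrite (big_cat_nat _ (n := Y.+1)) //=.
  by move: h2; move: (\sum_(_ <= _ < _ | _) _) (\sum_(_ <= _ < _ | _) _) => u v; lra.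
- rewrite exchange_big /=.
  apply: (@le_trans _ _ (x%:R * CB ^+ 2 *
     \sum_(Y'.+1 <= q < x.+1 | prime q) ln q%:R / (q%:R * (q%:R - 1)))).
    rewrite mulr_sumr; apply: ler_sum => q qp; rewrite -mulr_suml.
    have q1 : 1 < q%:R :> R by rewrite ltr1n prime_gt1.
    apply: (@le_trans _ _ (x%:R * (CB / q%:R) ^+ 2 * ln q%:R)).
      rewrite ler_wpM2r ?ln_nat_ge0 //; apply: le_trans (sum_c1_sq qp) _.
      by rewrite ler_wpM2l // lerXn2r ?nnegrE ?Bsum_ge0 ?divr_ge0 // hB1.
    have -> : x%:R * (CB / q%:R) ^+ 2 * ln q%:R =
       x%:R * CB ^+ 2 * (ln q%:R * (q%:R ^+ 2)^-1) by rewrite expr_div_n; ring.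
    apply: ler_wpM2l; first by rewrite mulr_ge0 ?sqr_ge0.
    apply: ler_wpM2l; first exact: ln_nat_ge0.
    rewrite lef_pV2 ?posrE ?mulr_gt0 ?exprn_gt0 //; try lra.

  rewrite /g2 -mulrA ler_wpM2l // ler_wpM2l ?sqr_ge0 //; exact: sum_ln_sq_primes.
rewrite exchange_big /=.
apply: (@le_trans _ _ (x%:R * (CB + 1) *
   \sum_(1 <= q < x.+1 | prime q) ln q%:R / (q%:R * (q%:R - 1)))).
  rewrite mulr_sumr; apply: ler_sum => q qp; rewrite -mulr_suml big_split /=.
  have -> : x%:R * (CB + 1) * (ln q%:R / (q%:R * (q%:R - 1))) =
    (x%:R * CB * (q%:R * (q%:R - 1))^-1 + x%:R * (q%:R * (q%:R - 1))^-1) * ln q%:R by ring.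
  by rewrite ler_wpM2r ?ln_nat_ge0 // lerD ?sum_c2 ?sum_c3.
rewrite /g3 -mulrA ler_wpM2l // [2 * _]mulrC ler_wpM2l ?addr_ge0 //.
exact: sum_ln_sq_primes1.
Qed.

Definition badn (n : nat) : bool :=
  has (fun q => prime q && (T < q ^ logn q (carmichael (carmichael n)))%N) (index_iota 1 Y.+1).

(** Applying [carmichael_pfactor_dvd] twice leaves these causes: a power of [q] in [n]; a prime [p]
    dividing [n] with [q ^ b] dividing [p - 1]; or such a [p] dividing phi(n), which needs [p ^ 2]
    dividing [n] or a prime [r = 1 mod p] dividing [n]. *)
Lemma chain_dvd (q b n : nat) : prime q -> (0 < b)%N -> (0 < n <= x)%N ->
  (q ^ b %| carmichael (carmichael n))%N ->
  1 <= (q ^ b %| n)%N%:R + psum x (fun p => (q ^ b %| p.-1)%N%:R) n +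
    \sum_(1 <= p < x.+1 | prime p && (q ^ b %| p.-1)%N)
       ((p ^ 2 %| n)%N%:R + psum x (fun r => (p %| r.-1)%N%:R) n) :> R.
Proof.
move=> qp b0 hn h; have /andP[n0 nx] := hn.
have m0 := carmichael_gt0 n.
have ps0 (P : pred nat) : 0 <= psum x (fun p => (P p)%:R) n :> R by apply: sumr_ge0.
have ps1 (P : pred nat) p : prime p -> (p %| n)%N -> P p ->
   1 <= psum x (fun p => (P p)%:R) n :> R.
  move=> pp pn Pp; rewrite /psum (big_rem p) /=; last first.
    by rewrite mem_index_iota prime_gt0 //= ltnS (leq_trans (dvdn_leq n0 pn)).
  by rewrite pp pn Pp lerDl; apply: sumr_ge0.
have t3 : 0 <= \sum_(1 <= p < x.+1 | prime p && (q ^ b %| p.-1)%N)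
   ((p ^ 2 %| n)%N%:R + psum x (fun r => (p %| r.-1)%N%:R) n) :> R.
  by apply: sumr_ge0 => p _; rewrite addr_ge0.
have [h1|[p [pp pM qb]]] := carmichael_pfactor_dvd qp b0 m0 h.
  have [h2|[p [pp pn qb]]] := carmichael_pfactor_dvd qp (ltn0Sn b) n0 h1.
    have -> : (q ^ b %| n)%N by apply: dvdn_trans h2; rewrite dvdn_exp2l // -addn2 leq_addr.
    by rewrite -addrA lerDl addr_ge0.
  have hq : (q ^ b %| p.-1)%N by apply: dvdn_trans qb; rewrite dvdn_exp2l.
  have h3 := ps1 (fun p => (q ^ b %| p.-1)%N) p pp pn hq.
  apply: le_trans h3 _; rewrite addrAC lerDr addr_ge0 //.
have pT : (p %| totient n)%N by apply: dvdn_trans pM _; exact: carmichael_dvd_totient.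
have px : p \in index_iota 1 x.+1.
  rewrite mem_index_iota prime_gt0 //= ltnS; apply: leq_trans nx.
  by apply: leq_trans (totient_le n); apply: dvdn_leq; rewrite ?totient_gt0.
have key : 1 <= (p ^ 2 %| n)%N%:R + psum x (fun r => (p %| r.-1)%N%:R) n :> R.
  have [->|[r [rp rn pr]]] := prime_dvd_totient pp n0 pT; first by rewrite lerDl.
  have h3 := ps1 (fun r => (p %| r.-1)%N) r rp rn pr.
  by apply: le_trans h3 _; rewrite lerDr.
apply: le_trans key _; rewrite (big_rem p) //= pp qb /=.
have := ler0n R (q ^ b %| n)%N; have := ps0 (fun p => (q ^ b %| p.-1)%N).
set w := \sum_(_ <- _ | _) _; have : 0 <= w by apply: sumr_ge0 => r _; rewrite addr_ge0.
by move: w (psum _ _ n) (psum _ _ n) => w u v; lra.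
Qed.

(** With [m = q ^ b], the three causes have means [1 / m], [CB / m] and [(1 + CB) CB / m], whose sum
    is [(1 + CB) ^ 2 / m]. *)
Lemma sum_chain (q b : nat) : prime q -> (0 < b)%N ->
  \sum_(1 <= n < x.+1) (q ^ b %| carmichael (carmichael n))%N%:R <=
  x%:R * ((1 + CB) ^+ 2 / (q ^ b)%:R).
Proof.
move=> qp b0; set m := (q ^ b)%N; have m0 : (0 < m)%N by rewrite expn_gt0 prime_gt0.
have m0R := natR_gt0 R m0; have x0R : 0 <= x%:R :> R by exact: ler0n.
apply: (@le_trans _ _ (\sum_(1 <= n < x.+1) ((m %| n)%N%:R +
    psum x (fun p => (m %| p.-1)%N%:R) n +
    \sum_(1 <= p < x.+1 | prime p && (m %| p.-1)%N)
       ((p ^ 2 %| n)%N%:R + psum x (fun r => (p %| r.-1)%N%:R) n)))).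
  apply: ler_sum_nat => n hn; case: (boolP (m %| carmichael (carmichael n))%N) => h.
    exact: chain_dvd.
  rewrite !addr_ge0 //; first by apply: sumr_ge0.
  by apply: sumr_ge0 => p _; rewrite addr_ge0 //; apply: sumr_ge0.
rewrite !big_split /= exchange_big /=.
have h1 := @count_multiples_le R x m m0.
have h2 := @sum_psum_le R x (fun p => (m %| p.-1)%N%:R) (fun p => ler0n _ _).
rewrite -Bsum_pmean in h2.
have h3 : \sum_(1 <= p < x.+1 | prime p && (m %| p.-1)%N) \sum_(1 <= n < x.+1)
    ((p ^ 2 %| n)%N%:R + psum x (fun r => (p %| r.-1)%N%:R) n) <=
    x%:R * (1 + CB) * Bsum R m x.
  rewrite /Bsum mulr_sumr; apply: ler_sum => p /andP[pp _]; rewrite big_split /=.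
  have p0 := prime_gt0 pp; have p0R := natR_gt0 R p0.
  have -> : x%:R * (1 + CB) / p%:R = x%:R / p%:R + x%:R * (CB / p%:R) by ring.
  apply: lerD.
    apply: le_trans (@count_multiples_le R x (p ^ 2) _) _; first by rewrite expn_gt0 p0.
    rewrite ler_wpM2l // lef_pV2 ?posrE ?ltr0n ?expn_gt0 ?p0 // ler_nat -mulnn.
    by rewrite leq_pmulr.
  apply: le_trans (sum_c1 p) _; by rewrite ler_wpM2l // hB1.
have hBm : Bsum R m x <= CB / m%:R by exact: hB.
have g2 : x%:R * Bsum R m x <= x%:R * (CB / m%:R) by rewrite ler_wpM2l.
have g3 : x%:R * (1 + CB) * Bsum R m x <= x%:R * (1 + CB) * (CB / m%:R).
  by rewrite ler_wpM2l // mulr_ge0 // addr_ge0.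
have -> : x%:R * ((1 + CB) ^+ 2 / m%:R) =
  x%:R / m%:R + x%:R * (CB / m%:R) + x%:R * (1 + CB) * (CB / m%:R) by ring.
apply: lerD; first (apply: lerD => //; exact: le_trans h2 g2).
exact: le_trans h3 g3.
Qed.

(** For each [q <= Y] take the least exponent [b q] with [q ^ b q > T]; a bad [n] has one of these
    powers dividing lambda(lambda n). *)
Lemma sum_badn : \sum_(1 <= n < x.+1) (badn n)%:R <=
  x%:R * (Y%:R * ((1 + CB) ^+ 2 / T%:R)).
Proof.
have x0R : 0 <= x%:R :> R by exact: ler0n.
have T0R := natR_gt0 R T_gt0.
have t0 : 0 <= (1 + CB) ^+ 2 / T%:R by rewrite divr_ge0 ?sqr_ge0.
pose b q := up_log q T.+1.
apply: (@le_trans _ _ (\sum_(1 <= n < x.+1) \sum_(1 <= q < Y.+1 | prime q)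
    (q ^ b q %| carmichael (carmichael n))%N%:R)).
  apply: ler_sum_nat => n /andP[n0 nx]; case: (boolP (badn n)) => [|_]; last exact: sumr_ge0.
  move=> /hasP[q qi /andP[qp hq]]; rewrite (big_rem q) //= qp.
  have -> : (q ^ b q %| carmichael (carmichael n))%N.
    rewrite pfactor_dvdn ?carmichael_gt0 //; apply: up_log_min => //.
    exact: prime_gt1.
  by rewrite lerDl; apply: sumr_ge0.
rewrite exchange_big /=.
have -> : x%:R * (Y%:R * ((1 + CB) ^+ 2 / T%:R)) =
   \sum_(1 <= q < Y.+1) x%:R * ((1 + CB) ^+ 2 / T%:R).
  by rewrite sumr_const_nat subn1 /= -[RHS]mulr_natl; ring.
rewrite big_mkcond; apply: ler_sum => q _; case: ifP => [qp|_]; last by rewrite mulr_ge0.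
have q1 := prime_gt1 qp.
have hb : (T < q ^ b q)%N by exact: up_logP.
have b0 : (0 < b q)%N.
  by rewrite lt0n; apply/eqP => e; move: hb; rewrite e expn0 ltnS leqNgt T_gt0.
apply: le_trans (sum_chain qp b0) _; rewrite ler_wpM2l // ler_wpM2l ?sqr_ge0 //.
by rewrite lef_pV2 ?posrE // ?ltr0n ?expn_gt0 ?prime_gt0 // ler_nat ltnW.
Qed.

Lemma lratio_lower n : (Y <= n <= x)%N -> ~~ badn n ->
  psum x hfun n - 2 * Hmax - Y%:R * ln T%:R <= lratio n.
Proof.
move=> /andP[Yn nx] nb; have n0 : (0 < n)%N by exact: leq_trans Yn.
have hn : (0 < n <= x)%N by rewrite n0.
apply: le_trans (lratio_ge R n0 Yn).
have hT : \sum_(1 <= q < Y.+1 | prime q)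
    (logn q (carmichael (carmichael n)))%:R * ln q%:R <= Y%:R * ln T%:R :> R.
  have -> : Y%:R * ln T%:R = \sum_(1 <= q < Y.+1) ln T%:R :> R.
    by rewrite sumr_const_nat subn1 /= mulr_natl.
  rewrite big_mkcond; apply: ler_sum_nat => q hq; case: ifP => [qp|_]; last exact: ln_nat_ge0.
  rewrite -ln_natX ?prime_gt0 //; apply: ler_ln_nat; rewrite expn_gt0 prime_gt0 //=.
  rewrite leqNgt; apply/negP => h; move/hasPn: nb => /(_ q).
  by rewrite mem_index_iota hq qp h => /(_ isT).
rewrite psum_hfun /Hmax; move: hT; rewrite mulr_sumr -!sumrB => hT.
apply: le_trans (lerB (lexx _) hT) _; rewrite -!sumrB; apply: ler_sum => q qp.
have := logn_totient_ge R qp hn; have := ln_nat_ge0 R q.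
by move=> v0 huv; rewrite -!mulrBl ler_wpM2r // !lerD2r.
Qed.

Definition Mmax : R := L * ln Y%:R + 6 * L + 4 * C2 * Y%:R.
(** In order: Turan's deviation, the error [Gerr], the error of the mean, twice [Hmax], and the
    prime powers up to [T] in lambda(lambda n). *)
Definition Dtot (a b : R) : R :=
  a + b + (6 * L + 4 * C2 * Y%:R) + 8 * Y%:R + Y%:R * ln T%:R.

Lemma count_exceptional (a b : R) : 0 < a -> 0 < b ->
  \sum_(1 <= n < x.+1) ((Y <= n)%N && (Dtot a b < `|lratio n - L * ln Y%:R|)%R)%:R <=
  x%:R * (12 * (Y%:R * Mmax) / a ^+ 2 + Gtot / b + Y%:R * ((1 + CB) ^+ 2 / T%:R)).
Proof.
move=> a0 b0; have x0R : 0 <= x%:R :> R by exact: ler0n.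
pose V n : R := (psum x hfun n - pmean x hfun) ^+ 2.
have V0 n : 0 <= V n by exact: sqr_ge0.
have a20 : 0 < a ^+ 2 by rewrite exprn_gt0.
apply: (@le_trans _ _ (\sum_(1 <= n < x.+1) ((a ^+ 2 < V n)%R%:R + (b < Gerr n)%R%:R + (badn n)%:R))).
  apply: ler_sum_nat => n hn; case: (boolP (_ && _)) => h; last by rewrite !addr_ge0.
  case: (ltP (a ^+ 2) (V n)) => hV; first by rewrite -addrA lerDl addr_ge0.
  case: (ltP b (Gerr n)) => hG; first by rewrite add0r lerDl.
  case: (boolP (badn n)) => hb; first by rewrite !add0r.
  exfalso; move: h => /andP[Yn]; apply/negP; rewrite -leNgt.
  have h1 := lratio_upper hn.
  have h2 := @lratio_lower n _ hb; rewrite Yn -ltnS in h2; have /andP[_ nx] := hn.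
  have {}h2 := h2 nx; have h3 := Hmax_le; have h4 := pmean_est.
  have h5 : `|psum x hfun n - pmean x hfun| <= a.
    have : `|psum x hfun n - pmean x hfun| ^+ 2 <= a ^+ 2 by rewrite real_normK ?num_real.
    by rewrite ler_pXn2r // nnegrE ?normr_ge0 // (ltW a0).
  have l0 : 0 <= Y%:R * ln T%:R :> R by rewrite mulr_ge0 ?ln_nat_ge0.
  have y0 : 0 <= Y%:R :> R by exact: ler0n.
  move: h4 h5; rewrite /Dtot !ler_norml => /andP[p1 p2] /andP[p3 p4].
  by apply/andP; split; lra.
rewrite !big_split /= mulrDr mulrDr; apply: lerD; first apply: lerD.
- apply: le_trans (markov_count x a20 V0) _.
  rewrite mulrA ler_wpM2r ?invr_ge0 ?(ltW a20) //.
  apply: le_trans (turan x hfun_bounds) _.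
  have H0 : 0 <= Hmax by apply: sumr_ge0 => q _; exact: ln_nat_ge0.
  have m0 : 0 <= pmean x hfun.
    apply: sumr_ge0 => p _; rewrite divr_ge0 //; by have /andP[] := hfun_bounds p.
  have hM : pmean x hfun <= Mmax.
    by have := pmean_est; rewrite ler_norml /Mmax => /andP[_]; lra.
  have h : x%:R * Hmax * pmean x hfun <= x%:R * (4 * Y%:R) * Mmax.
    by apply: ler_pM => //; rewrite ?mulr_ge0 // ler_wpM2l // Hmax_le.
  apply: le_trans (ler_wpM2l _ h) _ => //; rewrite le_eqVlt; apply/orP; left.
  by apply/eqP; ring.
- apply: le_trans (markov_count x b0 Gerr_ge0) _.
  rewrite mulrA ler_wpM2r ?invr_ge0 ?(ltW b0) //; exact: sum_Gerr.
exact: sum_badn.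
Qed.

End Assembly.

(** * From counting exceptions to a set of density one *)

Section NormalOrder.
Variable R : realType.

(* The bad sets increase as the tolerance shrinks, so requiring tolerance
   [1/(k+1)] only beyond a threshold [M k] costs a set of density zero. *)
Lemma normal_order_of_density (f g : nat -> R) (n0 : nat) :
  (forall n, (n0 <= n)%N -> 0 < g n) ->
  (forall e d : R, 0 < e -> 0 < d -> exists N0 : nat, forall N, (N0 <= N)%N ->
     \sum_(1 <= n < N.+1) (e * g n < `|f n - g n|)%R%:R <= d * N%:R) ->
  normal_order f g.
Proof.
move=> g0 dens.
pose e (k : nat) : R := k.+1%:R^-1.
have e0 k : 0 < e k by rewrite invr_gt0 ltr0n.
have emono i j : (i <= j)%N -> e j <= e i.
  by move=> ij; rewrite lef_pV2 ?posrE ?ltr0n // ler_nat ltnS.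
have [Nf hN] := choice (fun k => dens (e k) (e k) (e0 k) (e0 k)).
(* Dominates every [Nf i] with [i <= k], and the summand [k] ensures that only finitely many
   thresholds lie below a given [N]. *)
pose M k := (n0 + k + \sum_(i < k.+1) Nf i)%N.
have MN k : (Nf k <= M k)%N.
  by rewrite /M big_ord_recr /=; lia.
have Mk k : (k <= M k)%N by rewrite /M; lia.
have Mn0 k : (n0 <= M k)%N by rewrite /M; lia.
pose S : set nat := [set n | (0 < n)%N /\ forall k, (M k <= n)%N -> `|f n - g n| <= e k * g n].
have cnt j N : (M j <= N)%N ->
   \sum_(1 <= n < N.+1) (1 - \1_S n) <= e j * N%:R.
  move=> jN.
  have bd k : (M k <= N)%N -> (k <= N)%N by apply: leq_trans.
  (* [K] is the strictest tolerance in force up to [N]. Tolerances decrease, so any [n <= N] outside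
     [S] also violates tolerance [e K], and one count at level [K] covers all of them. *)
  case: (ex_maxnP (ex_intro (fun k => (M k <= N)%N) j jN) bd) => K KN Kmax.
  have jK := Kmax j jN.
  apply: le_trans (_ : e K * N%:R <= _); last by rewrite ler_wpM2r ?emono.
  apply: le_trans (hN K N (leq_trans (MN K) KN)).
  apply: ler_sum_nat => n /andP[n1 nN]; rewrite indicE.
  case: (boolP (n \in S)) => nS; first by rewrite subrr.
  rewrite subr0; case: ltP => // h; exfalso; move/negP: nS; apply.
  rewrite inE; split => // k Mkn; apply: le_trans h _.
  have gn : 0 < g n by apply: g0; apply: leq_trans (Mn0 k) Mkn.
  rewrite ler_wpM2r ?(ltW gn) //; apply: emono; apply: Kmax.
  by apply: leq_trans Mkn _; rewrite -ltnS.
have arch (d : R) : 0 < d -> exists k, e k <= d.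
  move=> d0; have dV : 0 <= d^-1 by rewrite invr_ge0 ltW.
  have /andP[_ h] := truncn_itv dV; exists (Num.truncn d^-1).
  rewrite /e -[X in _ <= X]invrK lef_pV2 ?posrE ?invr_gt0 ?ltr0n //.
  exact: ltW.
exists S; split.
- by move=> n [].
- apply/cvgrPdist_le => d d0; have [k hk] := arch d d0.
  exists (M k).+1 => // N /= MN'; have N0 : (0 < N)%N by exact: leq_trans MN'.
  have N0R := natR_gt0 R N0.
  have h := cnt k N (ltnW MN').
  rewrite sumrB sumr_const_nat subn1 /= in h.
  set s := \sum_(1 <= i < N.+1) \1_S i in h *.
  have sN : s <= N%:R.
    have -> : N%:R = \sum_(1 <= i < N.+1) 1 :> R by rewrite sumr_const_nat subn1.
    by apply: ler_sum => i _; rewrite indicE; case: (_ \in _).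
  have -> : 1 - s / N%:R = (N%:R - s) / N%:R by rewrite mulrBl mulfV // gt_eqF.
  rewrite ger0_norm ?divr_ge0 ?subr_ge0 // ler_pdivrMr //.
  by apply: le_trans h _; rewrite ler_wpM2r.
exists (fun n => f n / g n - 1); split.
  apply/cvgrPdist_le => d d0; have [k hk] := arch d d0.
  exists (M k) => // n /= Mn [n1 hS]; have gn : 0 < g n by apply: g0; apply: leq_trans (Mn0 k) Mn.
  rewrite sub0r normrN; have := hS k Mn.
  have -> : f n / g n - 1 = (f n - g n) / g n by rewrite mulrBl mulfV // gt_eqF.
  rewrite normrM normfV (gtr0_norm gn) ler_pdivrMr // => h; apply: le_trans h _.
  by rewrite ler_wpM2r // ltW.
exists n0 => // n /= hn _; have gn := g0 n hn.
by rewrite addrC subrK divfK // gt_eqF.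
Qed.

(** By [ln l <= 2 sqrt l], for [l >= 1] the left side is at most [(K + 2 c) sqrt l], and
    [sqrt l >= (K + 2 c) / eta] suffices. *)
Lemma ln_absorb (K c eta : R) : 0 <= K -> 0 <= c -> 0 < eta ->
  exists L0 : R, forall l, L0 <= l -> K + c * ln l <= eta * l.
Proof.
move=> K0 c0 e0; pose s0 := 1 + (K + 2 * c) / eta.
have q0 : 0 <= (K + 2 * c) / eta.
  by apply: divr_ge0; [rewrite addr_ge0 // mulr_ge0 | exact: ltW].
exists (s0 ^+ 2) => l hl.
have s1 : 1 <= s0 by rewrite /s0; lra.
have l0 : 0 < l by apply: lt_le_trans hl; rewrite exprn_gt0 //; lra.
set s := Num.sqrt l; have ss : s ^+ 2 = l by rewrite sqr_sqrtr // ltW.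
have sp : 0 < s by rewrite sqrtr_gt0.
have hs : s0 <= s.
  have : s0 ^+ 2 <= s ^+ 2 by rewrite ss.
  rewrite ler_pXn2r // nnegrE; lra.
have h := ln_le_sqrt l0; rewrite -/s in h.
have h2 : c * ln l <= c * (2 * s) by rewrite ler_wpM2l.
have h3 : (K + 2 * c) <= eta * s.
  have : (K + 2 * c) / eta <= s by move: hs; rewrite /s0; lra.
  by rewrite ler_pdivrMr // [s * _]mulrC.
have h4 : (K + 2 * c) * s <= eta * s * s by rewrite ler_wpM2r // ltW.
have h5 : K * 1 <= K * s by rewrite ler_wpM2l //; lra.
have -> : eta * l = eta * s * s by rewrite -{1}ss expr2 mulrA.
lra.
Qed.

(** Such an [n] above [m] satisfies [n m <= n ^ 2 < x]. With [m] fixed and large, this shows that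
    the integers below [sqrt x] are negligible. *)
Lemma square_lt_count (x m : nat) : (0 < m)%N ->
  \sum_(1 <= n < x.+1) (n ^ 2 < x)%N%:R <= m%:R + x%:R / m%:R :> R.
Proof.
move=> m0; have m0R := natR_gt0 R m0.
apply: (@le_trans _ _ (m + x %/ m)%:R); last first.
  rewrite natrD lerD2l ler_pdivlMr // -natrM ler_nat; exact: leq_trunc_div.
set k := (m + x %/ m)%N.
have h n : (n ^ 2 < x)%N -> (n <= k)%N.
  rewrite -mulnn => hn; case: (leqP n m) => nm.
    exact: leq_trans nm (leq_addr _ _).
  apply: leq_trans (leq_addl _ _); rewrite leq_divRL //.
  by apply: leq_trans (ltnW hn); rewrite leq_mul2l (ltnW nm) orbT.
apply: (@le_trans _ _ (\sum_(1 <= n < x.+1) (n <= k)%N%:R)).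
  by apply: ler_sum => n _; case: (boolP (n ^ 2 < x)%N) => // /h ->.
case: (leqP k x) => kx.
  have := @sum_ltn_cond R x k 1 kx; rewrite mulr1 => <-.
  by rewrite [X in _ <= X]big_mkcond; apply: ler_sum => n _; case: (_ <= _)%N.
apply: le_trans (_ : \sum_(1 <= n < x.+1) 1 <= _).
  by apply: ler_sum => n _; case: (_ <= _)%N.
by rewrite sumr_const_nat subn1 ler_nat ltnW.
Qed.

End NormalOrder.

(** * Choice of the parameters and collection of the error terms *)

Section MainDensity.
Variable R : realType.

Lemma ln2_mul (u v : R) : 0 < u -> 0 < v -> ln (2 * u * v) <= 1 + ln u + ln v.
Proof.
move=> u0 v0; rewrite lnM ?posrE ?mulr_gt0 // lnM ?posrE //.
by have := ln2_le R; lra.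
Qed.

(** The last bound makes the range legitimate: it yields [Y' <= 2 y l <= x], and [y <= n] as soon as
    [n ^ 2 >= x]. *)
Lemma scale_facts (x : nat) (l y : R) : y = LL R x -> l = ln y -> 6 <= l ->
  [/\ 64 <= y, 2 * l <= y & 2 * y ^+ 2 <= x%:R].
Proof.
move=> ey el l6.
have y0 : 0 < y.
  by rewrite ltNge; apply/negP => h; move: l6; rewrite el ln0 //; lra.
have yl : y = expR l by rewrite el lnK ?posrE.
have y64 : 64 <= y.
  apply: le_trans (_ : expR 6 <= _); last by rewrite yl ler_expR.
  by apply: le_trans (pow2_le_expR R 6); rewrite -natrX ler_nat.
have y2 : 2 * l <= y.
  have h := expR_ge1Dx (l / 2).
  have e : expR l = expR (l / 2) ^+ 2 by rewrite -expRM_natl; congr expR; lra.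
  rewrite yl e; move: (expR _) h => v h; nra.
have lx0 : 0 < ln x%:R :> R.
  by rewrite ltNge; apply/negP => h; move: y0; rewrite ey /LL ln0 // ltxx.
have x0 : 0 < x%:R :> R.
  by rewrite ltNge; apply/negP => h; move: lx0; rewrite ln0 // ltxx.
have lx : ln x%:R = expR y by rewrite ey /LL lnK ?posrE.
have h1 : 1 + ln x%:R <= x%:R :> R.
  by have := @ln_le_subr1 R x%:R x0; lra.
split=> //; have h := expR_ge1Dx (y / 3).
have e : expR y = expR (y / 3) ^+ 3 by rewrite -expRM_natl; congr expR; lra.
have h3 : (1 + y / 3) ^+ 3 <= expR (y / 3) ^+ 3.
  by rewrite lerXn2r ?nnegrE ?expR_ge0 //; lra.
rewrite -e -lx in h3; apply: le_trans (_ : (1 + y / 3) ^+ 3 <= _); last by lra.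
have : 0 <= (y - 64) * y ^+ 2 by rewrite mulr_ge0 ?sqr_ge0 // subr_ge0.
rewrite !exprS expr0; nra.
Qed.

Lemma nat_between (v : R) : 1 <= v ->
  exists n : nat, [/\ (0 < n)%N, v <= n%:R & n%:R <= 2 * v].
Proof.
move=> v1; have v0 : 0 <= v by lra.
have /andP[a b] := truncn_itv v0; exists (Num.truncn v).+1; split=> //.
  exact: ltW.
by rewrite -[(_.+1)%:R]natr1; lra.
Qed.

(** Here [z] is [Y], [w] is [y / l] and [k] is [ln Y]. The numerator is [O(y ^ 2)] since [w l = y],
    against [(e y l) ^ 2]. *)
Lemma variance_small (e d C y l w z k : R) : 0 < e -> 0 < C -> 0 < d ->
  0 < y -> 6 <= l -> w * l = y -> w <= y -> 0 <= z -> z <= w -> k <= l ->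
  12 * (7 + 4 * C) / e ^+ 2 <= d * l ->
  12 * (z * (y * k + 6 * y + 4 * C * z)) / (e * (y * l)) ^+ 2 <= d.
Proof.
move=> e0 C0 d0 y0 l6 wl wy z0 zw kl f.
have l0 : 0 < l by lra.
rewrite ler_pdivrMr ?exprn_gt0 ?mulr_gt0 //.
have M1 : y * k + 6 * y + 4 * C * z <= y * (l + 6 + 4 * C).
  have a1 := ler_wpM2l (ltW y0) kl.
  have a2 : C * z <= C * y by rewrite ler_wpM2l ?(ltW C0) //; lra.
  lra.
have M2 : z * (y * k + 6 * y + 4 * C * z) <= y ^+ 2 * (7 + 4 * C).
  apply: (@le_trans _ _ (w * (y * (l + 6 + 4 * C)))).
    apply: (@le_trans _ _ (z * (y * (l + 6 + 4 * C)))).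
      by rewrite ler_wpM2l.
    by rewrite ler_wpM2r // mulr_ge0 ?(ltW y0) //; lra.
  have -> : w * (y * (l + 6 + 4 * C)) = y * (w * l + w * (6 + 4 * C)) by ring.
  rewrite wl expr2 -mulrA ler_wpM2l ?(ltW y0) //.
  have : w * (6 + 4 * C) <= y * (6 + 4 * C) by rewrite ler_wpM2r //; lra.
  lra.
rewrite ler_pdivrMr ?exprn_gt0 // in f.
apply: (@le_trans _ _ (y ^+ 2 * (d * l * e ^+ 2))).
  have := ler_wpM2l (sqr_ge0 y) f; move: M2; clear; lra.
have -> : d * (e * (y * l)) ^+ 2 = y ^+ 2 * (d * l * e ^+ 2) * l by ring.
rewrite ler_peMr //; last by lra.
apply: mulr_ge0; first exact: sqr_ge0.
by apply: mulr_ge0; [rewrite mulr_ge0 ?(ltW d0) ?(ltW l0) | exact: sqr_ge0].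
Qed.

(** Here [b] is [CB], [z'] is [Y'], and [k], [k'] are the logarithms of [Y], [Y']. Since
    [k' - k <= 2 ln l + 2] and [b ^ 2 (k' + 2) / z' <= 20 C ^ 2 y], the whole is [O(y ln l)]. *)
Lemma error_mean_small (e d C y l b k k' z' : R) : 0 < e -> 0 < C -> 0 < d ->
  64 <= y -> 6 <= l -> ln l <= l -> 0 <= b -> b <= 2 * C * y ->
  l - ln l - 1 <= k -> 0 <= k' -> k <= k' -> k' <= 1 + l + ln l -> y * l <= z' ->
  22 * C + 20 * C ^+ 2 + 2 + 4 * C * ln l <= d * e * l ->
  (b * (k' - k + 7) + b ^+ 2 * ((k' + 2) / z') + 2 * (b + 1)) / (e * (y * l)) <= d.
Proof.
move=> e0 C0 d0 y64 l6 lll b0 bC kl k'0 kk' k'l zl f.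
have y0 : 0 < y by lra.
have l0 : 0 < l by lra.
have z0 : 0 < z' by apply: lt_le_trans zl; rewrite mulr_gt0.
rewrite ler_pdivrMr ?mulr_gt0 //.
apply: (@le_trans _ _ (y * (22 * C + 20 * C ^+ 2 + 2 + 4 * C * ln l))); last first.
  by have := ler_wpM2l (ltW y0) f; move: (22 * C + _ + _ + _) => v; lra.
have G1 : b * (k' - k + 7) <= 2 * C * y * (2 * ln l + 9) by apply: ler_pM => //; lra.
have G2 : b ^+ 2 * ((k' + 2) / z') <= 20 * C ^+ 2 * y.
  have q1 : (k' + 2) / z' <= 5 / y.
    rewrite ler_pdivrMr // mulrAC ler_pdivlMr //.
    apply: (@le_trans _ _ (5 * l * y)).
      by rewrite ler_wpM2r ?(ltW y0) //; lra.
    by rewrite -mulrA ler_wpM2l // mulrC.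
  have q2 : b ^+ 2 <= (2 * C * y) ^+ 2.
    by rewrite lerXn2r ?nnegrE // (le_trans b0 bC).
  have q3 : 0 <= (k' + 2) / z' by rewrite divr_ge0 ?addr_ge0 // ltW.
  apply: le_trans (ler_pM (sqr_ge0 _) q3 q2 q1) _.
  have -> // : (2 * C * y) ^+ 2 * (5 / y) = 20 * C ^+ 2 * y.
  by field; exact: lt0r_neq0.
move: (b ^+ 2 * _) (b * (_ + 7)) G1 G2 => v2 v1 G1 G2; clear -G1 G2 bC y64; lra.
Qed.

(** The numerator is [O(y ^ 3)]; the exponent 4 for [t], which is [T], beats it while [ln T] stays
    [O(l)]. *)
Lemma large_prime_power_small (d C y l b z t : R) : 0 < d -> 0 < C -> 64 <= y ->
  0 < l -> l <= y -> 0 <= b -> b <= 2 * C * y -> 0 <= z -> z <= y -> y ^+ 4 <= t ->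
  (1 + 2 * C) ^+ 2 <= d * l ->
  z * ((1 + b) ^+ 2 / t) <= d.
Proof.
move=> d0 C0 y64 l0 ly b0 bC z0 zy ty f; have y0 : 0 < y by lra.
rewrite mulrA ler_pdivrMr; last by apply: lt_le_trans ty; rewrite exprn_gt0.
apply: (@le_trans _ _ (y * ((1 + 2 * C) * y) ^+ 2)).
  apply: ler_pM; rewrite ?sqr_ge0 //.
  have b1 : 1 + b <= (1 + 2 * C) * y by lra.
  have b2 : 0 <= 1 + b by lra.
  by rewrite lerXn2r ?nnegrE // (le_trans b2 b1).
apply: (@le_trans _ _ (d * y ^+ 4)); last by rewrite ler_wpM2l // ltW.
have -> : y * ((1 + 2 * C) * y) ^+ 2 = (1 + 2 * C) ^+ 2 * y ^+ 3 by ring.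
have -> : d * y ^+ 4 = d * y * y ^+ 3 by ring.
rewrite ler_wpM2r ?exprn_ge0 ?(ltW y0) //; apply: le_trans f _.
by rewrite ler_wpM2l // ltW.
Qed.

(** For [sqrt x <= n <= x] the logarithms differ by a factor at most 2, so log log moves by at most
    [ln 2], and the target function at [n] may be compared with [y * l]. *)
Lemma sqrt_range_LL (x n : nat) (y l : R) : y = LL R x -> l = ln y -> 64 <= y ->
  (0 < n <= x)%N -> (x <= n ^ 2)%N -> 2 * y ^+ 2 <= x%:R ->
  [/\ y - 1 <= LL R n <= y, l - 1 <= ln (LL R n) <= l & y <= n%:R].
Proof.
move=> ey el y64 /andP[n0 nx] nsq xy2; have y0 : 0 < y by lra.
have n0R := natR_gt0 R n0.
have lx0 : 0 < ln x%:R :> R.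
  by rewrite ltNge; apply/negP => h; move: y0; rewrite ey /LL ln0 // ltxx.
have lxn : ln x%:R <= 2 * ln n%:R :> R.
  have : ln x%:R <= ln (n ^ 2)%:R :> R.
    by apply: ler_ln_nat; rewrite (leq_trans n0 nx).
  by rewrite ln_natX.
have lnx : ln n%:R <= ln x%:R :> R by apply: ler_ln_nat; rewrite n0.
have ln0 : 0 < ln n%:R :> R by lra.
have u1 : y - 1 <= LL R n.
  have : ln (ln x%:R / 2) <= LL R n by rewrite /LL ler_ln ?posrE ?divr_gt0 //; lra.
  by rewrite ln_div ?posrE // -[ln (ln x%:R)]/(LL R x) -ey; have := ln2_le R; lra.
have u2 : LL R n <= y by rewrite ey /LL ler_ln ?posrE.
have up : 0 < LL R n by lra.
rewrite u1 u2; split=> //.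
  apply/andP; split; last by rewrite el ler_ln ?posrE.
  have : ln (y / 2) <= ln (LL R n) by rewrite ler_ln ?posrE ?divr_gt0 //; lra.
  by rewrite ln_div ?posrE // -el; have := ln2_le R; lra.
have : y ^+ 2 <= n%:R ^+ 2.
  apply: (@le_trans _ _ x%:R); last by rewrite -natrX ler_nat.
  by have := sqr_ge0 y; lra.
by rewrite ler_pXn2r // nnegrE ltW.
Qed.

(** Everything except the two terms [e1 y l] is [O(y (1 + ln l))], because [z t <= w (4 + 4 l)] and
    [w l = y]. The total is at most [4 e1 y l], and [s >= y l / 2] doubles the constant. *)
Lemma deviation_small (e1 C y l w z k t s F : R) : 0 < e1 -> 0 < C ->
  64 <= y -> 6 <= l -> l <= y -> 0 <= ln l ->
  w * l = y -> w <= y -> 0 <= z -> z <= w ->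
  l - ln l - 1 <= k -> k <= l -> 0 <= t -> t <= 4 + 4 * l ->
  23 + 4 * C + ln l <= e1 * l -> 2 <= e1 * l ->
  y * l - y - l + 1 <= s -> s <= y * l ->
  `|F - y * k| <=
    e1 * (y * l) + e1 * (y * l) + (6 * y + 4 * C * z) + 8 * z + z * t ->
  `|F - s| <= 8 * e1 * s.
Proof.
move=> e10 C0 y64 l6 l_y ll0 wl wy z0 zw lk kl t0 tl f1 f2 s1 s2 hF.
have y0 : 0 < y by lra.
have a1 : z * t <= w * (4 + 4 * l) by exact: ler_pM.
have a2 : C * z <= C * y by rewrite ler_wpM2l ?(ltW C0) //; lra.
have a3 : w * (4 + 4 * l) = 4 * w + 4 * y by rewrite -wl; ring.
rewrite a3 in a1.
have D2 := ler_wpM2l (ltW y0) lk.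
have D3 := ler_wpM2l (ltW y0) kl.
have D4 := mulr_ge0 (ltW y0) ll0.
have F1 := ler_wpM2l (ltW y0) f1.
have F2 := ler_wpM2l (ltW y0) f2.
have ly : 6 * y <= l * y by rewrite ler_wpM2r // ltW.
have ll : 64 * l <= y * l by rewrite ler_wpM2r //; lra.
have hfg : `|F - s| <= 4 * (e1 * (y * l)).
  move: hF; rewrite !ler_norml => /andP[q1 q2].
  clear -a1 a2 D2 D3 D4 l_y F1 F2 ly ll s1 s2 q1 q2 y64 l6 zw wy.
  by apply/andP; split; lra.
apply: le_trans hfg _; have : y * l / 2 <= s by lra.
by move=> /(ler_wpM2l (ltW e10)); lra.
Qed.

Let f (n : nat) : R :=
  ln ((carmichael (totient n))%:R / (carmichael (carmichael n))%:R).
Let g (n : nat) : R := ln (ln n%:R) * ln (ln (ln n%:R)).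

(** The integers below [sqrt x] account for [2 d x] exceptions, and the three terms of
    [count_exceptional] for [d x] each. *)
Lemma density_at_scale (e d C C2 : R) (m x : nat) (y l : R) :
  0 < e -> 0 < d -> 0 < C -> 0 < C2 ->
  (forall q a x : nat, prime q -> (2 < x)%N ->
     Bsum R (q ^ a) x <= C * (1 + LL R x) / (q ^ a)%:R) ->
  (forall q x : nat, prime q -> (2 < x)%N ->
     `|Bsum R q x - LL R x / q.-1%:R| <= C2) ->
  (0 < m)%N -> d^-1 <= m%:R -> y = LL R x -> l = ln y -> 6 <= l ->
  23 + 4 * C2 + ln l <= e * l ->
  12 * (7 + 4 * C2) / e ^+ 2 <= d * l ->
  22 * C + 20 * C ^+ 2 + 2 + 4 * C * ln l <= d * e * l ->
  (1 + 2 * C) ^+ 2 <= d * l ->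
  2 <= e * l ->
  m%:R <= d * l ->
  \sum_(1 <= n < x.+1) (8 * e * g n < `|f n - g n|)%R%:R <= 8 * d * x%:R.
Proof.
move=> e0 d0 C0 C20 hB hA m_gt0 hm ey el l6 f1 f2 f3 f4 f5 f6.
have [y64 yl2 xy2] := @scale_facts x l y ey el l6.
have l0 : 0 < l by lra.
have y0 : 0 < y by lra.
have ll0 : 0 <= ln l by apply: ln_ge0; lra.
have lll : ln l <= l by have := ln_le_subr1 l0; lra.
pose w := y / l.
have wl : w * l = y by rewrite divfK // gt_eqF.
have w2 : 2 <= w by rewrite ler_pdivlMr.
have w0 : 0 < w by lra.
have wy : w <= y by rewrite -wl ler_peMr //; lra.
have lw : ln w = l - ln l by rewrite ln_div ?posrE // -el.
(* Starting from [w / 2] puts [Y] between [w / 2] and [w], so that [Y <= y / l] holds without a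
   constant. *)
have [Y [Y0 Y1 Y2]] := @nat_between (w / 2) ltac:(lra).
rewrite [2 * _]mulrC divfK ?pnatr_eq0 // in Y2.
have Y0R := natR_gt0 R Y0.
have lnY1 : l - ln l - 1 <= ln Y%:R.
  have : ln (w / 2) <= ln Y%:R by rewrite ler_ln ?posrE // divr_gt0.
  by rewrite ln_div ?posrE // lw; have := ln2_le R; lra.
have lnY2 : ln Y%:R <= l.
  have : ln Y%:R <= ln w by rewrite ler_ln ?posrE.
  by rewrite lw; lra.
have yl1 : y <= y * l by rewrite ler_peMr ?(ltW y0) //; lra.
have [Y' [Y'0 Y'3 Y'4]] := @nat_between (y * l) ltac:(lra).
have Y'0R := natR_gt0 R Y'0.
rewrite mulrA in Y'4.
have lnY' : ln Y'%:R <= 1 + l + ln l.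
  by rewrite {1}el; apply: le_trans (ln2_mul y0 l0); rewrite ler_ln ?posrE // !mulr_gt0.
have YY' : (Y <= Y')%N by rewrite -(ler_nat R); lra.
have lnYY' : ln Y%:R <= ln Y'%:R :> R by apply: ler_ln_nat; rewrite Y0.
have ly : l <= y by lra.
have Y'x : (Y' <= x)%N.
  rewrite -(ler_nat R); apply: le_trans xy2; apply: le_trans Y'4 _.
  by rewrite -mulrA ler_wpM2l // expr2 ler_wpM2l // (ltW y0).
have [tr [tr0 tr1 tr2]] := @nat_between y ltac:(lra).
have tr0R := natR_gt0 R tr0.
pose T := (tr ^ 4)%N.
have T0 : (0 < T)%N by rewrite expn_gt0 tr0.
have T1 : y ^+ 4 <= T%:R by rewrite natrX lerXn2r ?nnegrE ?(ltW y0) ?(ltW tr0R).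
have lnT : ln T%:R <= 4 + 4 * l.
  rewrite ln_natX //; have h : ln tr%:R <= ln (2 * y * 1).
    by rewrite mulr1 ler_ln ?posrE ?mulr_gt0.
  by have := le_trans h (ln2_mul y0 ltr01); rewrite ln1 addr0 -el; lra.
have xl : y <= x%:R.
  apply: le_trans xy2; rewrite expr2 mulrA ler_peMl ?(ltW y0) //; lra.
have x3 : (3 <= x)%N by rewrite -(ler_nat R); lra.
pose a := e * (y * l).
have a0 : 0 < a by rewrite !mulr_gt0.
have cnt := @count_exceptional R C C2 x Y Y' T C0 (fun q k qp => hB q k x qp x3)
  (fun q qp => hA q x qp x3) x3 Y0 YY' Y'x T0 a a a0 a0.
have sq := @square_lt_count R x m m_gt0.
have CB : C * (1 + LL R x) <= 2 * C * y.
  rewrite -ey [2 * C]mulrC -mulrA ler_wpM2l ?(ltW C0) //; lra.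
have CB0 : 0 <= C * (1 + LL R x) by rewrite -ey mulr_ge0 ?addr_ge0 ?(ltW y0) ?(ltW C0).
have x0R : 0 <= x%:R :> R by exact: ler0n.
have Y0W := ltW Y0R.
have E1 : 12 * (Y%:R * Mmax C2 x Y) / a ^+ 2 <= d.
  by rewrite /Mmax -ey; apply: (@variance_small e d C2 y l w).
have E2 : Gtot C x Y Y' / a <= d.
  by rewrite /Gtot; apply: (@error_mean_small e d C y l) => //; exact: ln_nat_ge0.
have E3 : Y%:R * ((1 + C * (1 + LL R x)) ^+ 2 / T%:R) <= d.
  by apply: (@large_prime_power_small d C y l) => //; lra.
(* [m] is at least [1 / d] but fixed, so both [m] and [x / m] are at most [d x]. *)
have E4 : m%:R + x%:R / m%:R <= 2 * d * x%:R.
  have lx' : l <= x%:R by lra.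
  have h1 : d * l <= d * x%:R by rewrite ler_wpM2l // ltW.
  have h2 : x%:R / m%:R <= d * x%:R.
    rewrite mulrC ler_wpM2r // -[d]invrK lef_pV2 ?posrE ?invr_gt0 ?ltr0n //.
  move: (_ / _) h2 => v h2; clear -h1 h2 f6; lra.
have step n : (0 < n < x.+1)%N -> ((8 * e * g n < `|f n - g n|)%R%:R : R) <=
   (n ^ 2 < x)%N%:R + ((Y <= n)%N && (Dtot C2 x Y T a a < `|f n - LL R x * ln Y%:R|)%R)%:R.
  move=> /andP[n0 nx]; case: (ltnP (n ^ 2) x) => nsq.
    by apply: (@le_trans _ _ 1); [case: (_ < _)%R | rewrite lerDl].
  rewrite add0r; case: (ltP (8 * e * g n)) => // hlt.
  have n0x : (0 < n <= x)%N by rewrite n0.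
  have [/andP[u1 u2] /andP[v1 v2] yn] := @sqrt_range_LL x n y l ey el y64 n0x nsq xy2.
  have -> : (Y <= n)%N by rewrite -(ler_nat R); lra.
  rewrite /=; case: ltP => // hD; exfalso.
  have eg : g n = LL R n * ln (LL R n) by [].
  have g1 : g n <= y * l by rewrite eg; apply: ler_pM => //; clear -u1 u2 v1 v2 y64 l6; lra.
  have g2 : y * l - y - l + 1 <= g n.
    have -> : y * l - y - l + 1 = (y - 1) * (l - 1) by ring.
    by rewrite eg; apply: ler_pM => //; clear -u1 u2 v1 v2 y64 l6; lra.
  rewrite /Dtot -ey in hD; have tT := ln_nat_ge0 R T.
  have := @deviation_small e C2 y l w Y%:R (ln Y%:R) (ln T%:R) (g n) (f n)
    e0 C20 y64 l6 ly ll0 wl wy Y0W Y2 lnY1 lnY2 tT lnT f1 f5 g2 g1 hD.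
  by rewrite leNgt hlt.
apply: (@le_trans _ _ (\sum_(1 <= n < x.+1) ((n ^ 2 < x)%N%:R +
   ((Y <= n)%N && (Dtot C2 x Y T a a < `|f n - LL R x * ln Y%:R|)%R)%:R))).
  by apply: ler_sum_nat => n hn; exact: step.
rewrite big_split /=; apply: le_trans (lerD (le_trans sq E4) cnt) _.
move: (_ / a ^+ 2) (_ / a) (_ * (_ / T%:R)) E1 E2 E3 => p1 p2 p3 E1 E2 E3.
have h1 : x%:R * (p1 + p2 + p3) <= x%:R * (3 * d) by rewrite ler_wpM2l //; clear -E1 E2 E3; lra.
have h2 : 0 <= d * x%:R by rewrite mulr_ge0 // ltW.
by clear -h1 h2; lra.
Qed.

(** Every requirement on [l] has the shape treated by [ln_absorb], and [l], the triple logarithm of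
    [x], eventually exceeds all the resulting bounds. *)
Lemma density_small (e d : R) : 0 < e -> 0 < d -> exists N0 : nat, forall x, (N0 <= x)%N ->
  \sum_(1 <= n < x.+1) (e * g n < `|f n - g n|)%R%:R <= d * x%:R.
Proof.
move=> e0 d0; have [C C0 hB] := Bsum_le R; have [C2 C20 hA] := Bsum_asymp R.
pose e1 := e / 8; pose d1 := d / 8.
have e10 : 0 < e1 by rewrite divr_gt0.
have d10 : 0 < d1 by rewrite divr_gt0.
have [m [m0 mm _]] : exists m : nat, [/\ (0 < m)%N, d1^-1 + 1 <= m%:R & m%:R <= 2 * (d1^-1 + 1)].
  by apply: nat_between; rewrite lerDr invr_ge0 ltW.
have {}mm : d1^-1 <= m%:R by apply: le_trans mm; rewrite lerDl.
have m0R : 0 <= m%:R :> R by exact: ler0n.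
have K2p : 0 <= 12 * (7 + 4 * C2) / e1 ^+ 2.
  by apply: divr_ge0; [lra | exact: sqr_ge0].
have K3p : 0 <= 22 * C + 20 * C ^+ 2 + 2.
  by rewrite !addr_ge0 ?mulr_ge0 ?sqr_ge0 ?(ltW C0).
have [L1 h1] := @ln_absorb R (23 + 4 * C2) 1 e1 ltac:(lra) ltac:(lra) e10.
have [L2 h2] := @ln_absorb R (12 * (7 + 4 * C2) / e1 ^+ 2) 0 d1 K2p (lexx _) d10.
have [L3 h3] := @ln_absorb R (22 * C + 20 * C ^+ 2 + 2) (4 * C) (d1 * e1) K3p
   ltac:(lra) (mulr_gt0 d10 e10).
have [L4 h4] := @ln_absorb R ((1 + 2 * C) ^+ 2) 0 d1 (sqr_ge0 _) (lexx _) d10.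
have [L5 h5] := @ln_absorb R 2 0 e1 ltac:(lra) (lexx _) e10.
have [L6 h6] := @ln_absorb R m%:R 0 d1 m0R (lexx _) d10.
pose L0 := \big[Num.max/6]_(v <- [:: L1; L2; L3; L4; L5; L6]) v.
have [N0 [N00 N0l _]] := @nat_of_ln R (expR (expR L0)) (expR_ge0 _).
exists N0 => x N0x.
have lx : expR (expR L0) <= ln x%:R.
  by apply: le_trans N0l _; apply: ler_ln_nat; rewrite N00.
have lx0 : 0 < ln x%:R :> R by apply: lt_le_trans lx; exact: expR_gt0.
have yL : expR L0 <= LL R x.
  by rewrite /LL -(expRK (expR L0)) ler_ln ?posrE ?expR_gt0.
have y0 : 0 < LL R x by apply: lt_le_trans yL; exact: expR_gt0.
have : L0 <= ln (LL R x) by rewrite -(expRK L0) ler_ln ?posrE ?expR_gt0.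
rewrite /L0 !big_cons big_nil !ge_max => /and5P[a1 a2 a3 a4 /and3P[a5 a6 a7]].
have -> : e = 8 * e1 by rewrite mulrC divfK // pnatr_eq0.
have -> : d = 8 * d1 by rewrite mulrC divfK // pnatr_eq0.
apply: (@density_at_scale e1 d1 C C2 m x _ _ e10 d10 C0 C20 hB hA m0 mm erefl erefl) => //.
- by have := h1 _ a1; rewrite mul1r.
- by have := h2 _ a2; rewrite mul0r addr0.
- exact: h3.
- by have := h4 _ a4; rewrite mul0r addr0.
- by have := h5 _ a5; rewrite mul0r addr0.
- by have := h6 _ a6; rewrite mul0r addr0.
Qed.

End MainDensity.

Theorem theorem1 (R : realType) :
  normal_order
    (fun n : nat =>
       ln ((carmichael (totient n))%:R / (carmichael (carmichael n))%:R) : R)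
    (fun n : nat => ln (ln n%:R) * ln (ln (ln n%:R)) : R).
Proof.
(* Beyond this threshold the triple logarithm is at least 1, so no default value of [ln] is involved
   and the comparison function is positive. *)
have [n0 [n00 hn0 _]] := @nat_of_ln R (expR (expR 1)) (expR_ge0 _).
apply: (@normal_order_of_density R _ _ n0); last exact: density_small.
move=> n nn.
have lx : expR (expR 1) <= ln n%:R :> R.
  by apply: le_trans hn0 _; apply: ler_ln_nat; rewrite n00.
have lx0 : 0 < ln n%:R :> R by apply: lt_le_trans lx; exact: expR_gt0.
have yL : expR 1 <= ln (ln n%:R) :> R.
  by rewrite -(expRK (expR 1)) ler_ln ?posrE ?expR_gt0.
have y0 : 0 < ln (ln n%:R) :> R by apply: lt_le_trans yL; exact: expR_gt0.
rewrite mulr_gt0 //; apply: (@lt_le_trans _ _ 1) => //.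
by rewrite -{1}(expRK 1) ler_ln ?posrE ?expR_gt0.
Qed.
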